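(* Consider a system of similarities $\{S_i\}_{i\in\mathcal I}$ on $[0,1]^d$ and a transitive subshift of finite type $\Sigma_A$ such that $F_A$ satisfies the strong separation property. Assume also that $F_A$ satisfies the minimality assumption for some $k\in\{1,\dots,d-1\}$, and let $\mu$ be a Gibbs measure for $F_A$. Then for all orthogonal projections $\pi\in\Pi_{d,k}$, \[ \dim_{\mathrm H}\pi\mu=\min\{k,\dim_{\mathrm H}\mu\} \qquad\text{and}\qquad \dim_{\mathrm H}\pi F_A=\min\{k,\dim_{\mathrm H}F_A\}. \]
   Context: **Symbolic notation.** $\mathcal I=\{0,\dots,M-1\}$ is a finite alphabet, $\Sigma=\mathcal I^{\mathbb N}$, $\sigma$ the left shift; for $\alpha=(\alpha_0,\alpha_1,\dots)\in\Sigma$ write $\alpha|_n=(\alpha_0,\dots,\alpha_{n-1})$. For an $M\times M$ matrix $A$ with entries in $\{0,1\}$, $\Sigma_A=\{\alpha\in\Sigma: A_{\alpha_l,\alpha_{l+1}}=1\ \forall l\ge 0\}$ is the subshift of finite type, with cylinders $[\alpha|_n]=\{\beta\in\Sigma_A:\beta|_n=\alpha|_n\}$. It is transitive if $A$ is irreducible: for all $i,j\in\mathcal I$ there is $n\in\mathbb N$ with $(A^n)_{i,j}>0$. **System of similarities.** A finite family $\{S_i\}_{i\in\mathcal I}$ of contracting similarities mapping $X=[0,1]^d$ into itself; $S_{\alpha|_n}=S_{\alpha_0}\circ\cdots\circ S_{\alpha_{n-1}}$; $\Pi:\Sigma\to X$ is given by $\{\Pi(\alpha)\}=\bigcap_{n\ge1}S_{\alpha|_n}(X)$;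 $F_A=\Pi(\Sigma_A)$. **Strong separation property.** Two finite words are incomparable if neither is a subword of the other. $F_A$ satisfies the strong separation property if for all $\alpha,\beta\in\Sigma_A$ and $m,n\in\mathbb N$ with $\alpha|_m,\beta|_n$ incomparable, $S_{\alpha|_m}(X)\cap S_{\beta|_n}(X)=\emptyset$. **Gibbs measures.** Let $\phi:\Sigma_A\to\mathbb R$ be continuous with summable variations: $\sum_{l\ge0}\mathrm{var}_l(\phi)<\infty$, where $\mathrm{var}_n(\phi)=\sup\{|\phi(\alpha)-\phi(\beta)|:\alpha,\beta\in\Sigma_A,\ \alpha|_n=\beta|_n\}$. Let $\phi^n=\sum_{l=0}^{n-1}\phi\circ\sigma^l$ and let $P(\phi)=\lim_n\frac1n\log\sum_{[w],\,|w|=n}\sup_{[w]}e^{\phi^n}$ be the pressure. A Borel probability measure $\mu_{\rm sym}$ on $\Sigma_A$ is a Gibbs measure for $\phi$ if there are constants $C_1,C_2>0$ with $C_1\le \mu_{\rm sym}([\alpha|_n])/\exp(\phi^n(\alpha)-nP(\phi))\le C_2$ for all $\alpha\in\Sigma_A$, $n\in\mathbb N$ (shift-invariance is not assumed). A Gibbs measure for $F_A$ is a measure $\mu=\mu_{\rm sym}\circ\Pi^{-1}$ with $\mu_{\rm sym}$ a Gibbs measure for such a $\phi$. **Projections and minimality.** $\Pi_{d,k}$ is the Grassmannian manifold of orthogonal projections from $\mathbb R^d$ to $\mathbb R^k$ (a projection being identified with the $k$-dimensional subspace of $\mathbb R^d$ orthogonal to its kernel), with its usual topology. For an orthogonal matrix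 $O$, $\pi O$ denotes the composition $\pi\circ O$ viewed as an element of $\Pi_{d,k}$. For a similarity $S$, written $S(x)=rOx+t$ with $r>0$, $O$ orthogonal, $t\in\mathbb R^d$, $O(S):=O$ is its orthogonal part. $F_A$ satisfies the minimality assumption for $k$ if for all $\pi\in\Pi_{d,k}$ the set $\{\pi O(S_{\alpha|_n}):\alpha\in\Sigma_A,\ n\in\mathbb N\}$ is dense in $\Pi_{d,k}$. $\pi\mu=\mu\circ\pi^{-1}$ is the push-forward. $\dim_{\mathrm H}$ of a set is Hausdorff dimension, and $\dim_{\mathrm H}\mu=\inf\{\dim_{\mathrm H}E:\mu(E)>0\}$ for a measure. *)

(* Defs.v *)
From HB Require Import structures.
From mathcomp Require Import all_boot all_order all_algebra.
From mathcomp Require Import all_classical all_reals all_analysis.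

Set Implicit Arguments.
Unset Strict Implicit.
Unset Printing Implicit Defensive.

Import Order.TTheory GRing.Theory Num.Theory.
Import numFieldNormedType.Exports.

Local Open Scope classical_set_scope.
Local Open Scope ring_scope.

Definition borelType (T : ptopologicalType) := g_sigma_algebraType (@open T).

(** * Symbolic dynamics *)

(* The alphabet {0, ..., M-1} is 'I_m.+1 with M = m.+1: it is nonempty, as it
   must be for a probability measure on the subshift to exist. *)
Definition Sigma (m : nat) : Type :=
  prod_topology (fun _ : nat => discrete_topology 'I_m.+1).

HB.instance Definition _ (m : nat) := Topological.copy (Sigma m)
  (prod_topology (fun _ : nat => discrete_topology 'I_m.+1)).
HB.instance Definition _ (m : nat) := isPointed.Build (Sigma m) (fun=> ord0).

Section Symbolic.
Context {m : nat}.
Implicit Types (A : 'M[nat]_m.+1) (alpha : Sigma m) (w : seq 'I_m.+1).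

Definition word alpha (n : nat) : seq 'I_m.+1 := mkseq alpha n.

Definition shift alpha : Sigma m := fun l => alpha l.+1.

Definition zero_one A := forall i j, A i j = 0%N \/ A i j = 1%N.

Definition irreducible_mx A :=
  forall i j, exists n : nat, (0 < n)%N /\ (0 < (A ^+ n) i j)%N.

Definition SFT A : set (Sigma m) :=
  [set alpha | forall l : nat, A (alpha l) (alpha l.+1) = 1%N].

Definition cylinder A w : set (Sigma m) :=
  [set beta | SFT A beta /\ word beta (size w) = w].

Definition incomparable w1 w2 := ~~ infix w1 w2 /\ ~~ infix w2 w1.

End Symbolic.

(** * Thermodynamic formalism *)

Section Gibbs.
Context {R : realType} {m : nat}.
Implicit Types (A : 'M[nat]_m.+1) (phi : Sigma m -> R).

(* Potentials are total functions on the full shift; only their restriction to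
   SFT A is ever used. *)

Definition variation A phi (n : nat) : \bar R :=
  ereal_sup [set `|phi p.1 - phi p.2|%:E | p in
    [set p : Sigma m * Sigma m |
      [/\ SFT A p.1, SFT A p.2 & word p.1 n = word p.2 n]]].

Definition summable_variations A phi :=
  (\sum_(0 <= l <oo) variation A phi l < +oo)%E.

Definition birkhoff_sum phi (n : nat) (alpha : Sigma m) : R :=
  \sum_(0 <= l < n) phi (iter l shift alpha).

Definition partition_sum A phi (n : nat) : R :=
  \sum_(w : n.-tuple 'I_m.+1 | `[< cylinder A w !=set0 >])
    sup [set expR (birkhoff_sum phi n alpha) | alpha in cylinder A w].

Definition pressure A phi : R :=
  lim ((fun n : nat => n%:R^-1 * ln (partition_sum A phi n)) @ \oo).

(* A Borel probability measure on the closed set SFT A is regarded as one on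
   the full shift that gives SFT A full mass. *)
Definition gibbs_symbolic A phi (nu : probability (borelType (Sigma m)) R) :=
  nu (SFT A) = 1%E /\
  exists C1 C2 : R, [/\ 0 < C1, 0 < C2 &
    forall alpha n, SFT A alpha ->
      C1 <= fine (nu (cylinder A (word alpha n)))
              / expR (birkhoff_sum phi n alpha - n%:R * pressure A phi) <= C2].

End Gibbs.

(** * Systems of similarities *)

Section Similarities.
Context {R : realType} {d m : nat}.
Implicit Types (f : 'cV[R]_d -> 'cV[R]_d) (S : 'I_m.+1 -> 'cV[R]_d -> 'cV[R]_d).
Implicit Types (A : 'M[nat]_m.+1) (alpha : Sigma m).

Definition unit_cube : set 'cV[R]_d := [set x | forall i, 0 <= x i 0 <= 1].

Definition orthogonal_mx (O : 'M[R]_d) := O^T *m O = 1%:M.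

Definition similarity f (r : R) (O : 'M[R]_d) (t : 'cV[R]_d) :=
  [/\ 0 < r, orthogonal_mx O & forall x, f x = r *: (O *m x) + t].

Definition orthogonal_part f (O : 'M[R]_d) := exists r t, similarity f r O t.

Definition similarity_system S :=
  forall i, (exists r O t, similarity (S i) r O t /\ r < 1) /\
            S i @` unit_cube `<=` unit_cube.

Definition S_word S (w : seq 'I_m.+1) : 'cV[R]_d -> 'cV[R]_d :=
  foldr (fun i f => S i \o f) idfun w.

(* The intersection is a singleton for a similarity system; the default value 0
   of xget is then never used. *)
Definition coding S alpha : 'cV[R]_d :=
  xget 0 (\bigcap_(n in [set n : nat | (1 <= n)%N])
            (S_word S (word alpha n) @` unit_cube)).

Definition fractal S A : set 'cV[R]_d := coding S @` SFT A.

Definition strong_separation S A :=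
  forall alpha beta (p q : nat), SFT A alpha -> SFT A beta ->
    incomparable (word alpha p) (word beta q) ->
    (S_word S (word alpha p) @` unit_cube)
      `&` (S_word S (word beta q) @` unit_cube) = set0.

Definition gibbs_on_fractal S A (mu : probability (borelType 'cV[R]_d) R) :=
  exists (phi : Sigma m -> R) (nu : probability (borelType (Sigma m)) R),
    [/\ {within SFT A, continuous phi}, summable_variations A phi,
        gibbs_symbolic A phi nu &
        forall E : set (borelType 'cV[R]_d), measurable E ->
          mu E = nu (coding S @^-1` E)].

End Similarities.

(** * Projections and the Grassmannian *)

Section Projections.
Context {R : realType} {d k : nat}.

(* Orthogonal projections from R^d to R^k are the k x d matrices with
   orthonormal rows, acting on column vectors. *)
Definition orth_projection (p : 'M[R]_(k, d)) := p *m p^T = 1%:M.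

Definition project (p : 'M[R]_(k, d)) :
    borelType 'cV[R]_d -> borelType 'cV[R]_k := fun x => p *m x.

(* The k-dimensional subspace orthogonal to the kernel of p, encoded by the
   matrix of the orthogonal projector of R^d onto it; two projections with the
   same kernel give the same point. The usual topology of the Grassmannian is
   the one induced by 'M[R]_d on these projectors. *)
Definition grassmann_pt (p : 'M[R]_(k, d)) : 'M[R]_d := p^T *m p.

Definition grassmannian : set 'M[R]_d :=
  grassmann_pt @` [set p | orth_projection p].

(* Density, in the topology induced on the Grassmannian. *)
Definition minimality (m : nat) (S : 'I_m.+1 -> 'cV[R]_d -> 'cV[R]_d)
    (A : 'M[nat]_m.+1) :=
  forall p : 'M[R]_(k, d), orth_projection p ->
    grassmannian `<=` closure [set Q | exists (alpha : Sigma m) n O,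
      [/\ SFT A alpha, orthogonal_part (S_word S (word alpha n)) O &
          Q = grassmann_pt (p *m O)]].

End Projections.

Arguments minimality {R d} k {m} S A.

(** * Hausdorff dimension *)

Section Hausdorff.
Context {R : realType} {n : nat}.
Implicit Types (E U : set 'cV[R]_n).

(* The library norm on matrices is the sup norm, hence this definition. *)
Definition euclidean_norm (x : 'cV[R]_n) : R :=
  Num.sqrt (\sum_i x i 0 ^+ 2).

(* The point 0 is added so that the empty set has diameter 0. *)
Definition diam U : \bar R :=
  ereal_sup (0%E |` [set (euclidean_norm (p.1 - p.2))%:E | p in U `*` U]).

Definition hausdorff_premeasure (s delta : R) E : \bar R :=
  ereal_inf [set (\sum_(0 <= i <oo) poweR (diam (U i)) s)%E | U in
    [set U : nat -> set 'cV[R]_n |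
      E `<=` \bigcup_i U i /\ forall i, (diam (U i) <= delta%:E)%E]].

Definition hausdorff_measure (s : R) E : \bar R :=
  ereal_sup [set hausdorff_premeasure s delta E | delta in
    [set delta : R | 0 < delta]].

(* Only s > 0 is used, so the value of 0 `^ 0 is irrelevant; the infimum is the
   same as over s >= 0. *)
Definition dimH E : \bar R :=
  ereal_inf [set s%:E | s in
    [set s : R | 0 < s /\ hausdorff_measure s E = 0%E]].

(* E ranges over Borel sets. *)
Definition dimH_measure (nu : set (borelType 'cV[R]_n) -> \bar R) : \bar R :=
  ereal_inf [set dimH E | E in
    [set E : set (borelType 'cV[R]_n) | measurable E /\ (0 < nu E)%E]].

End Hausdorff.

(* Main.v *)
(* Work on the symbolic side with a measure nu whose cylinder weights g satisfy
   g(uv) ~ g(u) g(v) for admissible uv; both Gibbs measures and Markov measures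
   have this property. The heart is a lower bound for the projection of nu.

   Fix s < s1 < min(k, dim) and cut words into blocks of large length L. Call a
   direction p good for blocks if a discretised energy Phi(p) of the projected
   blocks is small. Averaging over a finite family of perturbed coordinate
   projections (transversality, Marstrand) shows that most members of the family
   are good. Record for every block its letter counts and the cell of the
   projected point, relative to its own scale. If p O_u is good for the prefix u,
   then with high conditional probability the next label carries conditional
   mass at most r_v^sigma; a Chernoff bound over the blocks turns this into a
   bound for the mass of the points projecting near a given z, provided few
   prefixes give a bad direction. A maximal inequality of rising-sun type and
   compactness produce one direction q in the family, composed with a rotation
   O_u, for which a set of points of positive mass sees few bad directions in
   every initial segment.

   Minimality transfers this to an arbitrary p: the set of directions reachable
   from p by loops at a letter is an equivalence class (rotations are recurrent),
   some class has interior (finite Baire argument), hence every class is open and,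
   the Grassmannian being connected, there is only one. So from any p and any
   cylinder a bounded word leads close to q, and a density argument localises the
   bound in any set of positive measure. The mass distribution principle then
   gives the lower bounds. For the set F_A one uses, for s below dim F_A, a Markov
   measure with g(w) <= K r_w^s, built from a vector h <= B_s h, where B_s is the
   adjacency matrix weighted by r_i^s. *)
Require Import Defs.
From HB Require Import structures.
From mathcomp Require Import all_boot all_order all_algebra.
From mathcomp Require Import all_classical all_reals all_analysis.
From mathcomp Require Import ring lra zify.
Set Implicit Arguments.
Unset Strict Implicit.
Unset Printing Implicit Defensive.
Import Order.TTheory GRing.Theory Num.Theory.
Import numFieldNormedType.Exports.
Local Open Scope classical_set_scope.
Local Open Scope ring_scope.

(** * Words and quasi-Bernoulli weights *)

Section Words.
Context {m : nat}.
Local Notation I := 'I_m.+1.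

(** Without invariance of the measure no ergodic theorem supplies a typical direction. It is
    selected by averaging over starting times as well as over the finite family, and the conclusion
    is only known on a set whose mass is bounded below; hence the recurring constants in [C] and
    [m.+1]. The maps contract at different rates, so words of equal length have no common scale.
    Letter counts restore one, at the price of [(L+1)^(m+1)] possible values per block, which is
    polynomial in [L]. Over [N] blocks the number of label sequences near a point is the [N]-th
    power of such a quantity. It is beaten by a reserve of [2 e] in the exponent, worth
    [rM ^ (2 e L)] per block. Coding blocks by their words would make the count exponential in [L]
    and defeat this. Words of one path may have different rotations, so a direction is good or bad
    for a word and not for a path. The estimate of heavy labels therefore compares the mass of a
    whole path with the energy seen from a single prefix. The perturbed projections are not
    orthonormal, so directions are compared up to an invertible matrix on the target, which distorts
    distances by a bounded factor. *)

Fixpoint words (n : nat) : seq (seq I) :=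
  if n is n'.+1 then [seq i :: w | i <- enum I, w <- words n'] else [:: [::]].

Lemma mem_words n w : (w \in words n) = (size w == n).
Proof.
elim: n w => [|n IH] w; first by rewrite inE; case: w.
apply/allpairsP/idP => [[[j v] /= [_ + ->]]|]; first by rewrite IH eqSS.
by case: w => // i w; rewrite eqSS -IH => h; exists (i, w); rewrite /= mem_enum.
Qed.

Lemma words_uniq n : uniq (words n).
Proof.
elim: n => //= n IH; apply: allpairs_uniq => //; first exact: enum_uniq.
by move=> [i w] [j v] _ _ /= [-> ->].
Qed.

Lemma sum_wordsS (V : nmodType) n (F : seq I -> V) :
  \sum_(w <- words n.+1) F w = \sum_i \sum_(w <- words n) F (i :: w).
Proof. by rewrite /= big_allpairs_dep /= big_enum. Qed.

Lemma sum_words0 (V : nmodType) (F : seq I -> V) :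
  \sum_(w <- words 0) F w = F [::].
Proof. by rewrite big_seq1. Qed.

Lemma sum_words_cat (V : nmodType) n p (F : seq I -> V) :
  \sum_(w <- words (n + p)) F w
    = \sum_(u <- words n) \sum_(v <- words p) F (u ++ v).
Proof.
elim: n F => [|n IH] F; first by rewrite add0n sum_words0.
by rewrite addSn !sum_wordsS; apply: eq_bigr => i _; rewrite IH.
Qed.

Lemma eq_sum_words (V : nmodType) n (F G : seq I -> V) :
  (forall w, size w = n -> F w = G w) ->
  \sum_(w <- words n) F w = \sum_(w <- words n) G w.
Proof.
by move=> h; apply: eq_big_seq => w; rewrite mem_words => /eqP; exact: h.
Qed.

Lemma ler_sum_words (R : numDomainType) n (F G : seq I -> R) :
  (forall w, size w = n -> F w <= G w) ->
  \sum_(w <- words n) F w <= \sum_(w <- words n) G w.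
Proof.
move=> h; rewrite big_seq [leRHS]big_seq; apply: ler_sum => w.
by rewrite mem_words => /eqP; exact: h.
Qed.

Context {R : realFieldType}.
Implicit Types g : seq I -> R.

(* Both inequalities hold for the cylinder weights of a Gibbs measure and of a
   Markov measure; the second one is only required of words of positive weight. *)
Record quasi_bernoulli g (C : R) := QuasiBernoulli {
  qb_nil : g [::] = 1;
  qb_ge0 : forall w, 0 <= g w;
  qb_rcons : forall w, \sum_i g (rcons w i) = g w;
  qb_le : forall u v, g (u ++ v) <= C * g u * g v;
  qb_ge : forall u v, 0 < g (u ++ v) -> g u * g v <= C * g (u ++ v) }.

Section QB.
Context {g : seq I -> R} {C : R} (qb : quasi_bernoulli g C).

Lemma qb_C1 : 1 <= C.
Proof. by have := qb_le qb [::] [::]; rewrite cats0 (qb_nil qb) !mulr1. Qed.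

Lemma qb_sum u n : \sum_(v <- words n) g (u ++ v) = g u.
Proof.
elim: n u => [|n IH] u; first by rewrite sum_words0 cats0.
rewrite sum_wordsS -[RHS](qb_rcons qb); apply: eq_bigr => i _.
by rewrite -(IH (rcons u i)); apply: eq_bigr => w _; rewrite cat_rcons.
Qed.

Lemma qb_sum1 n : \sum_(v <- words n) g v = 1.
Proof. by rewrite -(qb_nil qb) -(qb_sum [::] n). Qed.

Lemma qb_cat_le u v : g (u ++ v) <= g u.
Proof.
rewrite -(qb_sum u (size v)) (big_rem v) ?mem_words//= lerDl.
by apply: sumr_ge0 => w _; exact: qb_ge0 qb _.
Qed.

Lemma qb_le1 u : g u <= 1.
Proof. by rewrite -(qb_nil qb) -[u]cat0s qb_cat_le. Qed.

End QB.

End Words.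

(** * Matrix entries, rotations and affine maps *)

Section EntryBound.
Context {R : realFieldType}.

(** The sup norm of the entries. Each matrix product costs a factor of the inner dimension, which
    only affects constants. *)
Definition mle (a b : nat) (X : 'M[R]_(a, b)) (e : R) :=
  forall i j, `|X i j| <= e.

Lemma mleD a b (X Y : 'M[R]_(a, b)) e f :
  mle X e -> mle Y f -> mle (X + Y) (e + f).
Proof.
by move=> hX hY i j; rewrite mxE (le_trans (ler_normD _ _))// lerD.
Qed.

Lemma mleN a b (X : 'M[R]_(a, b)) e : mle X e -> mle (- X) e.
Proof. by move=> hX i j; rewrite mxE normrN. Qed.

Lemma mleB a b (X Y : 'M[R]_(a, b)) e f :
  mle X e -> mle Y f -> mle (X - Y) (e + f).
Proof. by move=> hX /mleN; apply: mleD. Qed.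

Lemma mleZ a b (X : 'M[R]_(a, b)) c e :
  0 <= c -> mle X e -> mle (c *: X) (c * e).
Proof. by move=> c0 hX i j; rewrite mxE normrM ger0_norm// ler_wpM2l. Qed.

Lemma mle_le a b (X : 'M[R]_(a, b)) e f : e <= f -> mle X e -> mle X f.
Proof. by move=> ef hX i j; apply: le_trans ef. Qed.

Lemma mleM a b c (X : 'M[R]_(a, b)) (Y : 'M[R]_(b, c)) e f :
  0 <= e -> mle X e -> mle Y f -> mle (X *m Y) (b%:R * (e * f)).
Proof.
move=> e0 hX hY i j; rewrite mxE (le_trans (ler_norm_sum _ _ _))//.
rewrite -[b in b%:R]card_ord -sum1_card natr_sum mulr_suml; apply: ler_sum => l _.
by rewrite mul1r normrM ler_pM.
Qed.

Lemma mleT a b (X : 'M[R]_(a, b)) e : mle X e -> mle X^T e.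
Proof. by move=> hX i j; rewrite mxE. Qed.

Lemma mleBC a b (X Y : 'M[R]_(a, b)) e : mle (X - Y) e -> mle (Y - X) e.
Proof. by move=> /mleN; rewrite opprB. Qed.

Lemma mle_tri a b (X Y Z : 'M[R]_(a, b)) e f :
  mle (X - Y) e -> mle (Y - Z) f -> mle (X - Z) (e + f).
Proof. by move=> h1 /(mleD h1); rewrite addrA subrK. Qed.

End EntryBound.

Section Orthogonal.
Context {R : realType} {d : nat}.
Implicit Types O : 'M[R]_d.

Lemma orthogonal_mxV O : orthogonal_mx O -> O *m O^T = 1%:M.
Proof. exact: mulmx1C. Qed.

Lemma orthogonal_mx1 : orthogonal_mx (1%:M : 'M[R]_d).
Proof. by rewrite /orthogonal_mx trmx1 mulmx1. Qed.

Lemma orthogonal_mxM O O' :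
  orthogonal_mx O -> orthogonal_mx O' -> orthogonal_mx (O *m O').
Proof.
by move=> h h'; rewrite /orthogonal_mx trmx_mul mulmxA -(mulmxA _ (O^T)) h mulmx1.
Qed.

Lemma orthogonal_mxT O : orthogonal_mx O -> orthogonal_mx O^T.
Proof. by move=> /orthogonal_mxV; rewrite /orthogonal_mx trmxK. Qed.

Lemma orthogonal_rows_mle k (p : 'M[R]_(k, d)) : p *m p^T = 1%:M -> mle p 1.
Proof.
move=> h i j; have := congr1 (fun X : 'M[R]_k => X i i) h; rewrite !mxE eqxx mulr1n => hi.
have : p i j ^+ 2 <= 1.
  rewrite -hi (bigD1 j)//= mxE -expr2 lerDl sumr_ge0// => l _.
  by rewrite mxE -expr2 sqr_ge0.
by rewrite -real_normK ?num_real// expr_le1.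
Qed.

Lemma orthogonal_mle O : orthogonal_mx O -> mle O 1.
Proof. by move=> /orthogonal_mxV/orthogonal_rows_mle. Qed.

Lemma orthogonal_mulmx_mle a O (y : 'M[R]_(d, a)) e :
  orthogonal_mx O -> mle y e -> mle (O *m y) (d%:R * e).
Proof.
by move=> /orthogonal_mle hO hy; have := mleM ler01 hO hy; rewrite mul1r.
Qed.

Lemma orthogonal_mulmx_mle_inv a O (y : 'M[R]_(d, a)) e :
  orthogonal_mx O -> mle (O *m y) e -> mle y (d%:R * e).
Proof.
move=> hO /(orthogonal_mulmx_mle (orthogonal_mxT hO)).
by rewrite mulmxA hO mul1mx.
Qed.

End Orthogonal.

(* The maps $S_w$ in coordinates: [S_w x = rr w *: (OO w *m x) + tt w]. *)
Section Affine.
Context {R : realType} {d m : nat}.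
Local Notation I := 'I_m.+1.
Context (r : I -> R) (O : I -> 'M[R]_d) (t : I -> 'cV[R]_d).

Definition rr (w : seq I) : R := \prod_(i <- w) r i.
Definition OO (w : seq I) : 'M[R]_d := foldr (fun i X => O i *m X) 1%:M w.
Definition tt (w : seq I) : 'cV[R]_d :=
  foldr (fun i y => r i *: (O i *m y) + t i) 0 w.

Lemma rr_cat u v : rr (u ++ v) = rr u * rr v.
Proof. by rewrite /rr big_cat. Qed.

Lemma rr_nil : rr [::] = 1.
Proof. by rewrite /rr big_nil. Qed.

Lemma rr_cons i w : rr (i :: w) = r i * rr w.
Proof. by rewrite /rr big_cons. Qed.

Lemma OO_cat u v : OO (u ++ v) = OO u *m OO v.
Proof. by elim: u => [|i u IH] /=; rewrite ?mul1mx// IH mulmxA. Qed.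

Lemma tt_cat u v : tt (u ++ v) = tt u + rr u *: (OO u *m tt v).
Proof.
elim: u => [|i u IH] /=; first by rewrite /rr big_nil scale1r mul1mx add0r.
rewrite IH /rr big_cons mulmxDr scalerDr -scalemxAr scalerA mulmxA.
by rewrite addrAC.
Qed.

(** The vector [tt w] is the image of the origin under the word [w]; the field [sd_t] is what is
    kept of the invariance of the unit cube. *)
Record system_data (rm rM : R) := SystemData {
  sd_rm : 0 < rm;
  sd_rM : rM < 1;
  sd_r : forall i, rm <= r i <= rM;
  sd_O : forall i, orthogonal_mx (O i);
  sd_t : forall w i, 0 <= tt w i 0 <= 1 }.

Section Data.
Context {rm rM : R} (sd : system_data rm rM).

Lemma sd_r_gt0 i : 0 < r i.
Proof. by have /andP[h _] := sd_r sd i; apply: lt_le_trans h; exact: sd_rm sd. Qed.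

Lemma sd_rmM : rm <= rM.
Proof. by have /andP[h1 h2] := sd_r sd ord0; apply: le_trans h2. Qed.

Lemma sd_rM0 : 0 < rM.
Proof. exact: lt_le_trans (sd_rm sd) sd_rmM. Qed.

Lemma rr_gt0 w : 0 < rr w.
Proof.
elim: w => [|i w IH]; first by rewrite rr_nil.
by rewrite rr_cons mulr_gt0// sd_r_gt0.
Qed.

Lemma rr_le w : rr w <= rM ^+ size w.
Proof.
elim: w => [|i w IH]; first by rewrite rr_nil.
rewrite rr_cons exprS ler_pM ?(ltW (sd_r_gt0 _)) ?(ltW (rr_gt0 _))//.
by have /andP[] := sd_r sd i.
Qed.

Lemma rr_ge w : rm ^+ size w <= rr w.
Proof.
elim: w => [|i w IH]; first by rewrite rr_nil.
rewrite rr_cons exprS ler_pM ?exprn_ge0 ?(ltW (sd_rm sd))//.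
by have /andP[] := sd_r sd i.
Qed.

Lemma rr_le1 w : rr w <= 1.
Proof.
by apply: le_trans (rr_le w) _; rewrite exprn_ile1// ?ltW ?sd_rM0 ?(sd_rM sd).
Qed.

Lemma rr_cat_le u v : rr (u ++ v) <= rr u.
Proof. by rewrite rr_cat ler_piMr ?rr_le1// ltW// rr_gt0. Qed.

Lemma OO_orth w : orthogonal_mx (OO w).
Proof.
elim: w => [|i w IH] /=; first exact: orthogonal_mx1.
by apply: orthogonal_mxM => //; apply: sd_O sd _.
Qed.

Lemma tt_mle w : mle (tt w) 1.
Proof. by move=> i j; rewrite ord1; have /andP[h1 h2] := sd_t sd w i; rewrite ger0_norm. Qed.

Lemma ttB_mle v v' : mle (tt v - tt v') 1.
Proof.
move=> i j; rewrite ord1 !mxE ler_norml.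
have /andP[h1 h2] := sd_t sd v i; have /andP[h3 h4] := sd_t sd v' i.
lra.
Qed.

End Data.
End Affine.

Lemma floor_eq_dist (R : realType) (x y : R) :
  Num.floor x = Num.floor y -> `|x - y| <= 1.
Proof.
move=> h; have /andP[h1 h2] := floor_itv x; have /andP[h3 h4] := floor_itv y.
by move: h1 h2 h3 h4; rewrite h !intrD => h1 h2 h3 h4; rewrite ler_norml; lra.
Qed.

(** * Mass of the labelled paths *)

Section Paths.
Context {R : realType} {d m k : nat}.
Local Notation I := 'I_m.+1.
Context (r : I -> R) (O : I -> 'M[R]_d) (t : I -> 'cV[R]_d) (g : seq I -> R).
Context (L : nat) (good : pred (seq I)) (sigma phi0 : R).
Local Notation rr := (rr r).
Local Notation OO := (OO O).
Local Notation tt := (tt r O t).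
Implicit Types (p : 'M[R]_(k, d)) (u v w : seq I).

(** The constant [c] is 1 or 2 in applications: the slack between the two values absorbs a
    perturbation of the direction in [Phi_perturb]. *)
Definition near c p v v' : bool :=
  [forall i, `|(p *m (tt v - tt v')) i 0| <= c * rr v].

(* A discretised [sigma]-energy of the projection at the scale of blocks of
   length [L]; only pairs of blocks of equal contraction ratio are compared. *)
Definition Phi c p : R :=
  \sum_(v <- words L | good v)
    \sum_(v' <- words L | [&& good v', rr v == rr v' & near c p v v'])
      g v * g v' * rr v `^ (- sigma).

Definition letter_count v : {ffun I -> 'I_L.+1} :=
  [ffun i => inord (count_mem i v)].

Definition cell p w : {ffun 'I_k -> int} :=
  [ffun i => Num.floor ((p *m tt w) i 0 / rr w)].

(* The letter counts of a block determine its contraction ratio, so words with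
   the same sequence of labels project to cells of the same size and address. *)
Definition label p u v := (letter_count v, cell p (u ++ v)).

Definition block n w := take L (drop (n * L) w).

Fixpoint path_of p n w :=
  if n is n'.+1 then
    rcons (path_of p n' w) (label p (take (n' * L) w) (block n' w))
  else [::].

Definition path_mass p n w : R :=
  \sum_(u <- words (n * L) | path_of p n u == path_of p n w) g u.

Definition good_dir p u : bool := Phi 1 (p *m OO u) <= phi0.

Definition heavy p n u v : bool :=
  good_dir p u && (rr v `^ sigma * path_mass p n u < path_mass p n.+1 (u ++ v)).

Definition num_heavy p n w : nat :=
  \sum_(i < n) heavy p i (take (i * L) w) (block i w).

Lemma letter_count_rr v v' : size v = L -> size v' = L ->
  letter_count v = letter_count v' -> rr v = rr v'.
Proof.
move=> hv hv' h; rewrite /rr; apply: perm_big; apply/allP => i _ /=; apply/eqP.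
have := congr1 (fun f : {ffun I -> 'I_L.+1} => f i : nat) h.
by rewrite !ffunE !inordK// ltnS ?(leq_trans (count_size _ _))// ?hv ?hv'.
Qed.

Lemma block_last n u v : size u = (n * L)%N -> size v = L -> block n (u ++ v) = v.
Proof. by move=> hu hv; rewrite /block -hu drop_size_cat// -hv take_size. Qed.

Lemma take_catl i n u v : (i <= n)%N -> size u = (n * L)%N ->
  take (i * L) (u ++ v) = take (i * L) u.
Proof.
move=> lin hu; rewrite take_cat hu; case: ltnP => // h.
have -> : (i * L = n * L)%N by apply/eqP; rewrite eqn_leq h leq_mul2r lin orbT.
by rewrite subnn take0 cats0 take_oversize ?hu.
Qed.

Lemma block_catl i n u v : (i < n)%N -> size u = (n * L)%N ->
  block i (u ++ v) = block i u.
Proof. by move=> lin hu; rewrite /block !take_drop -!mulSn (@take_catl i.+1 n). Qed.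

Lemma path_of_catl p j n u v : (j <= n)%N -> size u = (n * L)%N ->
  path_of p j (u ++ v) = path_of p j u.
Proof.
elim: j => //= j IH jn hu; rewrite IH ?(ltnW jn)//.
by rewrite (@take_catl j n) ?(ltnW jn)// (@block_catl j n).
Qed.

Lemma path_of_cat p n u v : size u = (n * L)%N -> size v = L ->
  path_of p n.+1 (u ++ v) = rcons (path_of p n u) (label p u v).
Proof.
move=> hu hv /=; rewrite (@path_of_catl p n n)// (@take_catl n n)//.
by rewrite take_oversize ?hu// block_last.
Qed.

Lemma num_heavy_cat p n u v : size u = (n * L)%N -> size v = L ->
  num_heavy p n.+1 (u ++ v) = (num_heavy p n u + heavy p n u v)%N.
Proof.
move=> hu hv; rewrite /num_heavy big_ord_recr /= block_last// (@take_catl n n)//.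
rewrite take_oversize ?hu//; congr addn; apply: eq_bigr => i _.
by rewrite (@take_catl i n) ?(ltnW (ltn_ord i))// (@block_catl i n).
Qed.

Context {C : R} (qb : quasi_bernoulli g C).

Lemma path_mass_cat p n u v : size u = (n * L)%N -> size v = L ->
  path_mass p n.+1 (u ++ v) =
  \sum_(u' <- words (n * L) | path_of p n u' == path_of p n u)
    \sum_(v' <- words L | label p u' v' == label p u v) g (u' ++ v').
Proof.
move=> hu hv; rewrite /path_mass mulSnr big_mkcond sum_words_cat [RHS]big_mkcond.
apply: eq_sum_words => u' hu'; rewrite [X in if _ then X else _]big_mkcond.
case: ifPn => [/eqP e|e].
  apply: eq_sum_words => v' hv'; rewrite !path_of_cat// eqseq_rcons e eqxx.
  by rewrite eq_sym.
under eq_sum_words => v' hv'.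
  by rewrite !path_of_cat// eqseq_rcons (negbTE e) over.
by rewrite big1.
Qed.

Lemma path_mass_ge p n u : size u = (n * L)%N -> g u <= path_mass p n u.
Proof.
move=> hu; rewrite /path_mass big_mkcond (big_rem u) ?mem_words ?hu//= eqxx lerDl.
by apply: sumr_ge0 => w _; case: ifP => // _; exact: qb_ge0 qb _.
Qed.

Lemma path_mass_cat_le p n u v : size u = (n * L)%N -> size v = L ->
  path_mass p n.+1 (u ++ v) <= path_mass p n u.
Proof.
move=> hu hv; rewrite path_mass_cat//; apply: ler_sum => u' _.
rewrite -[leRHS](qb_sum qb u' L) big_mkcond; apply: ler_sum => v' _.
by case: ifP => // _; exact: qb_ge0 qb _.
Qed.

End Paths.

Lemma sum_class_ratio_le1 (R : realFieldType) (T lT : eqType) (X : seq T)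
    (P : pred T) (f : T -> lT) (G : T -> R) l :
  \sum_(v <- X | P v && (f v == l))
    G v / (\sum_(v' <- X | P v' && (f v' == f v)) G v') <= 1.
Proof.
set b := \sum_(v <- X | P v && (f v == l)) G v.
rewrite (eq_bigr (fun v => G v / b)); last by move=> v /andP[_ /eqP->].
rewrite -mulr_suml -/b; have [->|b0] := eqVneq b 0; first by rewrite mul0r.
by rewrite divff.
Qed.

(** The arithmetic-geometric inequality, splitting 1 into a term and a multiple of its inverse; in
    [heavy_le] this replaces an explicit count of labels of large conditional mass. *)
Lemma le_amgm1 (R : realFieldType) (z : R) : 0 < z -> 1 <= z + (4 * z)^-1.
Proof.
move=> z0; rewrite -subr_ge0.
have -> : z + (4 * z)^-1 - 1 = (2 * z - 1) ^+ 2 / (4 * z).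
  by field; rewrite gt_eqF.
by rewrite divr_ge0 ?sqr_ge0// mulr_ge0// ltW.
Qed.

Section Heavy.
Context {R : realType} {d m k : nat}.
Local Notation I := 'I_m.+1.
Context (r : I -> R) (O : I -> 'M[R]_d) (t : I -> 'cV[R]_d) (g : seq I -> R).
Context (L : nat) (good : pred (seq I)) (sigma phi0 : R) {rm rM : R}.
Local Notation rr := (rr r).
Local Notation OO := (OO O).
Local Notation tt := (tt r O t).
Local Notation near := (near r O t).
Local Notation Phi := (Phi r O t g L good sigma).
Local Notation label := (label r O t L).
Local Notation path_of := (path_of r O t L).
Local Notation path_mass := (path_mass r O t g L).
Local Notation good_dir := (good_dir r O t g L good sigma phi0).
Local Notation heavy := (heavy r O t g L good sigma phi0).
Local Notation num_heavy := (num_heavy r O t g L good sigma phi0).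
Implicit Types (p : 'M[R]_(k, d)) (u v w : seq I).
Context (sd : system_data r O t rm rM) {C : R} (qb : quasi_bernoulli g C).

(** Equal cells put the projected points within one unit of the common scale [rr (u ++ v)]; dividing
    by [rr u] turns this into nearness of the blocks in the rotated direction. *)
Lemma label_near p u v v' : size v = L -> size v' = L ->
  label p u v = label p u v' -> rr v = rr v' /\ near 1 (p *m OO u) v v'.
Proof.
move=> hv hv' [h1 h2]; have e := letter_count_rr r hv hv' h1; split=> //.
apply/forallP => i; have := congr1 (fun f : {ffun 'I_k -> int} => f i) h2.
rewrite !ffunE => /floor_eq_dist.
have E w : (p *m tt (u ++ w)) i 0
    = (p *m tt u) i 0 + rr u * (p *m OO u *m tt w) i 0.
  by rewrite tt_cat mulmxDr -scalemxAr mulmxA [LHS]mxE [X in _ + X]mxE.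
have -> : (p *m OO u *m (tt v - tt v')) i 0
    = (p *m OO u *m tt v) i 0 - (p *m OO u *m tt v') i 0.
  by rewrite mulmxBr [LHS]mxE [X in _ + X]mxE.
rewrite !E !rr_cat e -mulrBl.
have ru := rr_gt0 sd u; have rv := rr_gt0 sd v'.
rewrite normrM normfV (gtr0_norm (mulr_gt0 _ _))// ler_pdivrMr ?mulr_gt0//.
by rewrite !mul1r opprD addrACA subrr add0r -mulrBr normrM gtr0_norm// ler_pM2l.
Qed.

(** Over each label class the ratios sum to at most 1, so every label contributes its path mass at
    most once, and the path masses of distinct labels add up to at most that of [u]. *)
Lemma sum_heavy_ratio p n u (V : pred (seq I)) : size u = (n * L)%N ->
  \sum_(v <- words L | V v)
    g (u ++ v) / (\sum_(v' <- words L | V v' && (label p u v' == label p u v))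
                     g (u ++ v')) * path_mass p n.+1 (u ++ v)
  <= path_mass p n u.
Proof.
move=> hu.
pose B v := \sum_(v' <- words L | V v' && (label p u v' == label p u v)) g (u ++ v').
have E : \sum_(v <- words L | V v) g (u ++ v) / B v * path_mass p n.+1 (u ++ v)
  = \sum_(u' <- words (n * L) | path_of p n u' == path_of p n u)
      \sum_(v' <- words L) g (u' ++ v') *
        \sum_(v <- words L | V v && (label p u v == label p u' v'))
          g (u ++ v) / B v.
  transitivity (\sum_(v <- words L | V v)
     \sum_(u' <- words (n * L) | path_of p n u' == path_of p n u)
      \sum_(v' <- words L) (if label p u v == label p u' v' then
        g (u' ++ v') * (g (u ++ v) / B v) else 0)).
    rewrite big_mkcond [RHS]big_mkcond; apply: eq_sum_words => v hv.
    case: ifP => // _; rewrite path_mass_cat// mulr_sumr.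
    apply: eq_bigr => u' _; rewrite mulr_sumr big_mkcond; apply: eq_bigr => v' _.
    by rewrite [in RHS]eq_sym; case: ifP => // _; rewrite mulrC.
  rewrite exchange_big; apply: eq_bigr => u' _; rewrite exchange_big.
  apply: eq_bigr => v' _; rewrite mulr_sumr big_mkcondr.
  by apply: eq_bigr => v _; case: ifP.
rewrite [leLHS]E; apply: ler_sum => u' _; rewrite -[leRHS](qb_sum qb u' L).
apply: ler_sum => v' _; rewrite ler_piMr ?(qb_ge0 qb)//.
exact: (sum_class_ratio_le1 _ V (label p u) (fun v => g (u ++ v))).
Qed.

(* Conditionally on the past a label is heavy only with small probability:
   at most [1/q] labels have conditional mass [>= q], and a good direction
   spreads the good blocks evenly over the labels. *)
Lemma heavy_le p n u delta : size u = (n * L)%N -> 0 < phi0 ->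
  \sum_(v <- words L | ~~ good v) g v <= delta ->
  \sum_(v <- words L | heavy p n u v) g (u ++ v)
    <= (C * delta + Num.sqrt phi0 * (1 + C ^+ 2 / 4)) * g u.
Proof.
move=> hu phi0_gt0 hdelta; have g0 := qb_ge0 qb.
have C0 : 0 <= C by apply: le_trans (qb_C1 qb).
have [gu|gu] := ltrP 0 (g u); last first.
  have gu0 : g u = 0 by apply/le_anti; rewrite gu g0.
  apply: (@le_trans _ _ (g u)); last by rewrite gu0 mulr0.
  rewrite -[leRHS](qb_sum qb u L) big_mkcond.
  by apply: ler_sum => v _; case: ifP.
rewrite (bigID good)/= addrC mulrDl lerD//.
  apply: (@le_trans _ _ (\sum_(v <- words L | ~~ good v) C * g u * g v)).
    rewrite big_mkcond [leRHS]big_mkcond; apply: ler_sum => v _.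
    case: (heavy p n u v) (good v) => [] [] //=; rewrite ?(qb_le qb)//.
    by rewrite !mulr_ge0.
  by rewrite -mulr_sumr [leRHS]mulrAC ler_wpM2l ?mulr_ge0.
case: (boolP (good_dir p u)) => [gd|/negbTE gd]; last first.
  by rewrite big1 ?mulr_ge0 ?sqrtr_ge0 ?addr_ge0 ?divr_ge0 ?exprn_ge0//
     => v; rewrite /heavy gd.
set V : pred (seq I) := fun v => heavy p n u v && good v.
pose B v := \sum_(v' <- words L | V v' && (label p u v' == label p u v)) g (u ++ v').
pose M v := path_mass p n.+1 (u ++ v); pose A := path_mass p n u.
have A0 : 0 < A by apply: lt_le_trans gu _; exact: (path_mass_ge r O t qb).
(* The choice of [tau] balances the two sums below: the first contributes at most [tau], the second
   at most [C^2 g(u)^2 phi0 / (4 tau)]. *)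
pose s := Num.sqrt phi0; have s0 : 0 < s by rewrite sqrtr_gt0.
pose tau := g u * s; have tau0 : 0 < tau by rewrite mulr_gt0.
have Bge v : size v = L -> V v -> g (u ++ v) <= B v.
  move=> hv Vv; rewrite /B big_mkcond (big_rem v) ?mem_words ?hv//= Vv eqxx lerDl.
  by apply: sumr_ge0 => w _; case: ifP.
have Mge v : V v -> rr v `^ sigma * A < M v by move=> /andP[/andP[]].
have Rs v : 0 < rr v `^ sigma by rewrite powR_gt0// (rr_gt0 sd).
have S1 : \sum_(v <- words L | V v) g (u ++ v) / B v * M v <= A.
  exact: sum_heavy_ratio.
(* Heaviness bounds [M v] from below by [rr v ^ sigma] times [A], so each pair of blocks with one
   label is dominated by its term in the energy, which is small because the direction of [u] is
   good. *)
have S2 : \sum_(v <- words L | V v) g (u ++ v) * B v / M v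
    <= C ^+ 2 * g u ^+ 2 * phi0 / A.
  apply: (@le_trans _ _ (C ^+ 2 * g u ^+ 2 * Phi 1 (p *m OO u) / A)); last first.
    by rewrite ler_wpM2r ?invr_ge0 ?(ltW A0)// ler_wpM2l ?mulr_ge0 ?exprn_ge0.
  rewrite /Phi mulr_sumr mulr_suml big_mkcond [leRHS]big_mkcond.
  apply: ler_sum_words => v hv; case: ifPn => [Vv|]; last first.
    case: ifP => // gv _; apply: divr_ge0; last exact: ltW.
    rewrite mulr_ge0 ?mulr_ge0 ?exprn_ge0//; apply: sumr_ge0 => v' _.
    by rewrite mulr_ge0 ?mulr_ge0// powR_ge0.
  have -> : good v by case/andP: Vv.
  rewrite mulrAC; apply: (@le_trans _ _ (g (u ++ v) * rr v `^ (- sigma) / A * B v)).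
    apply: ler_wpM2r; first by apply: sumr_ge0.
    rewrite -mulrA ler_wpM2l// powRN -invfM lef_pV2 ?posrE ?mulr_gt0//.
      by rewrite ltW// Mge.
    by rewrite (lt_trans _ (Mge _ Vv))// mulr_gt0.
  rewrite /B mulr_sumr mulr_sumr mulr_suml big_mkcond [leRHS]big_mkcond.
  apply: ler_sum_words => v' hv'; case: ifPn => [/andP[Vv' /eqP e]|]; last first.
    case: ifP => // _ _; apply: divr_ge0; last exact: ltW.
    by rewrite ?mulr_ge0 ?exprn_ge0// powR_ge0.
  have [e1 e2] := label_near hv hv' (esym e).
  have -> : good v' by case/andP: Vv'.
  rewrite e1 eqxx e2 /= -e1.
  rewrite mulrAC ler_wpM2r ?invr_ge0 ?(ltW A0)//.
  have -> : C ^+ 2 * g u ^+ 2 * (g v * g v' * rr v `^ (- sigma))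
      = (C * g u * g v) * rr v `^ (- sigma) * (C * g u * g v') by ring.
  have P := powR_ge0 (rr v) (- sigma); have Q := qb_le qb u.
  by apply: ler_pM; rewrite ?(mulr_ge0 (g0 _) P) ?g0 ?Q// ler_pM ?g0 ?Q.
apply: (@le_trans _ _ (tau / A * A + A / (4 * tau) * (C ^+ 2 * g u ^+ 2 * phi0 / A))).
  apply: (@le_trans _ _ (tau / A * (\sum_(v <- words L | V v) g (u ++ v) / B v * M v)
    + A / (4 * tau) * (\sum_(v <- words L | V v) g (u ++ v) * B v / M v))); last first.
    apply: lerD; apply: ler_wpM2l => //; apply: divr_ge0; rewrite ?(ltW A0)//.
      exact: ltW.
    by rewrite mulr_ge0// ltW.
  rewrite !mulr_sumr -big_split /= big_mkcond [leRHS]big_mkcond.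
  apply: ler_sum_words => v hv; rewrite -/(V v); case: (boolP (V v)) => [Vv|//].
  have := g0 (u ++ v); rewrite le_eqVlt => /orP[/eqP<-|y0].
    by rewrite !(mul0r, mulr0) addr0.
  have B0 := lt_le_trans y0 (Bge v hv Vv).
  have M0 : 0 < M v by rewrite (lt_trans _ (Mge _ Vv))// mulr_gt0.
  have z0 : 0 < tau * M v / (A * B v) by rewrite divr_gt0 ?mulr_gt0.
  have := le_amgm1 z0; rewrite -(ler_pM2l y0) mulr1 => /le_trans; apply.
  by rewrite le_eqVlt; apply/orP; left; apply/eqP; field; rewrite !gt_eqF.
rewrite le_eqVlt; apply/orP; left; apply/eqP.
rewrite -/s -[phi0](sqr_sqrtr (ltW phi0_gt0)) -/s /tau; field.
by rewrite !gt_eqF.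
Qed.

End Heavy.

Section PathMass.
Context {R : realType} {d m k : nat}.
Local Notation I := 'I_m.+1.
Context (r : I -> R) (O : I -> 'M[R]_d) (t : I -> 'cV[R]_d) (g : seq I -> R).
Context (L : nat) (good : pred (seq I)) (sigma phi0 : R) {rm rM : R}.
Local Notation rr := (rr r).
Local Notation OO := (OO O).
Local Notation path_mass := (path_mass r O t g L).
Local Notation good_dir := (good_dir r O t g L good sigma phi0).
Local Notation heavy := (heavy r O t g L good sigma phi0).
Local Notation num_heavy := (num_heavy r O t g L good sigma phi0).
Implicit Types (p : 'M[R]_(k, d)) (u v w : seq I).
Context (sd : system_data r O t rm rM) {C : R} (qb : quasi_bernoulli g C).

Definition num_bad_dir p n w : nat :=
  \sum_(i < n) ~~ good_dir p (take (i * L) w).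

Lemma num_bad_dir_cat p n u v : size u = (n * L)%N ->
  num_bad_dir p n.+1 (u ++ v) = (num_bad_dir p n u + ~~ good_dir p u)%N.
Proof.
move=> hu; rewrite /num_bad_dir big_ord_recr /= (@take_catl _ L n n)//.
rewrite take_oversize ?hu//; congr addn; apply: eq_bigr => i _.
by rewrite (@take_catl _ L i n) ?(ltnW (ltn_ord i)).
Qed.

(** Whatever the prefix, one more block multiplies the exponential moment by at most [1 + b theta];
    a conditional bound replaces independence. *)
Lemma heavy_mgf p N (b theta : R) : 1 <= b ->
  (forall n u, size u = (n * L)%N ->
    \sum_(v <- words L | heavy p n u v) g (u ++ v) <= theta * g u) ->
  \sum_(w <- words (N * L)) g w * b ^+ num_heavy p N w <= (1 + b * theta) ^+ N.
Proof.
move=> b1 H; have g0 := qb_ge0 qb; have b0 : 0 <= b by apply: le_trans b1.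
have theta0 : 0 <= theta.
  by have := H 0 [::] erefl; rewrite (qb_nil qb) mulr1; apply: le_trans;
    apply: sumr_ge0.
elim: N => [|N IH]; first by rewrite sum_words0 /num_heavy big_ord0 (qb_nil qb) mulr1.
rewrite mulSnr sum_words_cat exprSr.
apply: (@le_trans _ _ (\sum_(w <- words (N * L))
    g w * b ^+ num_heavy p N w * (1 + b * theta))); last first.
  by rewrite -mulr_suml ler_wpM2r// addr_ge0// mulr_ge0.
apply: ler_sum_words => u hu.
apply: (@le_trans _ _ (b ^+ num_heavy p N u *
   (\sum_(v <- words L) g (u ++ v)
     + b * \sum_(v <- words L | heavy p N u v) g (u ++ v)))).
  rewrite mulr_sumr [X in _ + X]big_mkcond -big_split mulr_sumr /=.
  apply: ler_sum_words => v hv; rewrite num_heavy_cat// exprD mulrCA.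
  rewrite ler_wpM2l ?exprn_ge0//; case: heavy => /=.
    by rewrite expr1 mulrC lerDr.
  by rewrite expr0 addr0 mulr1.
rewrite (qb_sum qb) mulrAC [leRHS]mulrC ler_wpM2l ?exprn_ge0//.
by rewrite mulrDr mulr1 lerD2l [leRHS]mulrC -mulrA ler_wpM2l ?H.
Qed.

(** Markov's inequality for [b ^ num_heavy]: the moment is at most [2^N], while exceeding the
    threshold contributes at least [4^N]. *)
Lemma heavy_tail p N (b theta kappa : R) : 1 <= b -> b * theta <= 1 ->
  4 <= b `^ kappa ->
  (forall n u, size u = (n * L)%N ->
    \sum_(v <- words L | heavy p n u v) g (u ++ v) <= theta * g u) ->
  \sum_(w <- words (N * L) | kappa * N%:R < (num_heavy p N w)%:R) g w
    <= 2^-1 ^+ N.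
Proof.
move=> b1 bt b4 H; have g0 := qb_ge0 qb; have b0 : 0 <= b by apply: le_trans b1.
rewrite -(@ler_pM2l _ (4 ^+ N)) ?exprn_gt0// -exprMn.
have -> : 4 * 2^-1 = 2 :> R by field.
apply: (@le_trans _ _ (\sum_(w <- words (N * L)) g w * b ^+ num_heavy p N w)).
  rewrite mulr_sumr big_mkcond; apply: ler_sum => w _; case: ifPn => [h|_].
    rewrite mulrC ler_wpM2l//; apply: (@le_trans _ _ ((b `^ kappa) ^+ N)).
      by rewrite lerXn2r// nnegrE ?powR_ge0.
    by rewrite -powR_mulrn ?powR_ge0// -powRrM -powR_mulrn// ler_powR// ltW.
  by rewrite mulr_ge0 ?exprn_ge0.
apply: (le_trans (heavy_mgf N b1 H)).
have theta0 : 0 <= theta.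
  by have := H 0 [::] erefl; rewrite (qb_nil qb) mulr1; apply: le_trans;
    apply: sumr_ge0.
rewrite lerXn2r// ?nnegrE ?addr_ge0 ?mulr_ge0//.
by rewrite (_ : 2 = 1 + 1) ?lerD2l// -natr1.
Qed.

(** A block that is not heavy in a good direction gains the factor [rr v ^ sigma]. At any other
    block the mass merely does not grow, and as [rr v >= rm ^ L] the missing factor costs at most
    [(rm ^ L) ^ (- sigma)]. *)
Lemma path_mass_bound p N w : 0 <= sigma -> size w = (N * L)%N ->
  path_mass p N w <=
    rr w `^ sigma * ((rm ^+ L) `^ (- sigma)) ^+ (num_bad_dir p N w + num_heavy p N w).
Proof.
move=> s0; have rm0 := sd_rm sd; elim: N w => [|N IH] w.
  move=> /size0nil ->; rewrite /num_bad_dir /num_heavy !big_ord0 rr_nil powR1 expr0.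
  by rewrite /path_mass big_mkcond sum_words0 /= (qb_nil qb) mulr1.
rewrite mulSnr => hw.
have hu : size (take (N * L) w) = (N * L)%N by rewrite size_takel// hw leq_addr.
have hv : size (drop (N * L) w) = L by rewrite size_drop hw addKn.
move: (take _ w) (drop _ w) hu hv (cat_take_drop (N * L) w) => u v hu hv <-{w hw}.
rewrite num_bad_dir_cat// num_heavy_cat//.
have rv := rr_gt0 sd v; have ru := rr_gt0 sd u.
set q := (rm ^+ L) `^ (- sigma); have q0 : 0 <= q by apply: powR_ge0.
have qv : 1 <= rr v `^ sigma * q.
  rewrite /q powRN ler_pdivlMr ?powR_gt0 ?exprn_gt0// mul1r.
  rewrite ge0_ler_powR// ?nnegrE ?exprn_ge0 ?(ltW rm0) ?(ltW rv)//.
  by rewrite -hv (rr_ge sd).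
have q1 : 1 <= q.
  have e1 : 1 `^ sigma = 1 :> R by rewrite powR1.
  apply: (le_trans qv); rewrite ler_piMl// -e1.
  by rewrite ge0_ler_powR ?nnegrE// ?(ltW rv)// (rr_le1 sd).
set Z := num_bad_dir p N u; set Y := num_heavy p N u.
have := IH _ hu; rewrite -/Z -/Y => IHu.
rewrite rr_cat powRM ?(ltW ru) ?(ltW rv)//.
have key : rr u `^ sigma * q ^+ (Z + Y) * (rr v `^ sigma * q) <=
    rr u `^ sigma * rr v `^ sigma * q ^+ (Z + ~~ good_dir p u + (Y + heavy p N u v)) ->
    path_mass p N.+1 (u ++ v) <=
    rr u `^ sigma * rr v `^ sigma * q ^+ (Z + ~~ good_dir p u + (Y + heavy p N u v)).
  apply: le_trans; apply: (le_trans (path_mass_cat_le r O t qb p hu hv)).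
  apply: (le_trans IHu); rewrite ler_peMr// mulr_ge0 ?powR_ge0 ?exprn_ge0//.
case: (boolP (good_dir p u)) key => [gd|gd] /= key; last first.
  apply: key; rewrite mulrACA ler_wpM2l ?mulr_ge0 ?powR_ge0//.
  by rewrite -exprSr ler_weXn2l//; lia.
case: (boolP (heavy p N u v)) key => [hh|hh] /= key.
  apply: key; rewrite mulrACA ler_wpM2l ?mulr_ge0 ?powR_ge0//.
  by rewrite -exprSr ler_weXn2l//; lia.
rewrite !addn0; move: hh; rewrite /heavy gd /= -leNgt => /le_trans; apply.
by rewrite [leLHS]mulrC mulrAC ler_wpM2r ?powR_ge0.
Qed.

End PathMass.

(** * Transversality and Marstrand averaging *)

Section Transversality.
Context {R : realType}.

Lemma card_interval (n : nat) (a h rho : R) : h != 0 -> 0 <= rho ->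
  \sum_(e < n) (`|a + h * e%:R| <= rho)%R%:R <= 2 * rho / `|h| + 1.
Proof.
move=> h0 rho0; pose P := [pred e : 'I_n | `|a + h * e%:R| <= rho].
have h0' : 0 < `|h| by rewrite normr_gt0.
have -> : \sum_(e < n) (`|a + h * e%:R| <= rho)%R%:R = #|P|%:R :> R.
  rewrite -natr_sum -sum1_card [in RHS]big_mkcond; congr (_%:R);
    apply: eq_bigr => e _; by rewrite inE /=; case: (_ <= _)%R.
have B0 : 0 <= 2 * rho / `|h| by rewrite divr_ge0// mulr_ge0.
have [e1 Pe1|P0] := pickP P; last by rewrite eq_card0// addr_ge0.
case: (arg_minnP (fun e : 'I_n => e : nat) Pe1) => e0 Pe0 e0min.
set N := Num.trunc (2 * rho / `|h|).
have key e : P e -> (e - e0 < N.+1)%N.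
  move=> Pe; rewrite ltnS -(ler_nat R) natrB ?e0min//.
  have : (e%:R - e0%:R : R) <= 2 * rho / `|h|.
    rewrite ler_pdivlMr// -[leLHS]ger0_norm; last first.
      by rewrite mulr_ge0// subr_ge0 ler_nat e0min.
    rewrite normrM normr_id -normrM mulrC mulrBr.
    have -> : h * e%:R - h * e0%:R = (a + h * e%:R) - (a + h * e0%:R) by ring.
    by rewrite (le_trans (ler_normB _ _))//; move: Pe Pe0; rewrite /P /=; lra.
  rewrite -natrB ?e0min// => hle.
  by rewrite ler_nat -ltnS -(ltr_nat R) (le_lt_trans hle)// truncnS_gt.
have : (#|P| <= #|'I_N.+1|)%N.
  apply: (@leq_card_in _ _ (fun e : 'I_n => inord (e - e0) : 'I_N.+1)).
  move=> e e' Pe Pe' /(congr1 val); rewrite /= !inordK ?key// => e_e'.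
  by apply: val_inj; have := e0min _ Pe; have := e0min _ Pe'; move: e_e' => /=; lia.
rewrite card_ord -(ler_nat R) => /le_trans; apply.
by rewrite -natr1 lerD2r; have /andP[] := truncn_itv B0.
Qed.

(** A finite Fubini argument: exchanging the coordinate [j] with a fresh value is an involution of
    pairs, so averaging over that coordinate first leaves the total unchanged. *)
Lemma sum_ffun_update (J E : finType) (F : {ffun J -> E} -> R) (B : R) (j : J) :
  (forall f, \sum_e F [ffun l => if l == j then e else f l] <= B) ->
  #|E|%:R * \sum_f F f <= #|{ffun J -> E}|%:R * B.
Proof.
move=> h; pose upd (x : {ffun J -> E} * E) : {ffun J -> E} * E :=
  ([ffun l => if l == j then x.2 else x.1 l], x.1 j).
have updK : involutive upd.
  move=> [f e]; rewrite /upd /=; congr pair; last by rewrite ffunE eqxx.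
  by apply/ffunP => l; rewrite !ffunE; case: eqP => // ->.
have -> : #|E|%:R * \sum_f F f = \sum_f \sum_(e : E) F f.
  by rewrite mulr_sumr; apply: eq_bigr => f _; rewrite sumr_const mulr_natl.
rewrite pair_big /= (reindex_inj (inv_inj updK)) /=.
rewrite -(pair_big predT predT (fun (f : {ffun J -> E}) e => F [ffun l => if l == j then e else f l])) /=.
rewrite mulr_natl -sumr_const; apply: ler_sum => f _; exact: h.
Qed.

Context {k d : nat}.

(* A finite family of full-rank k x d matrices, small perturbations of the
   coordinate projection, playing the role of a random projection. *)
Definition grid_mx (Q : nat) (e : {ffun 'I_k -> {ffun 'I_d -> 'I_Q.+1}}) :
    'M[R]_(k, d) :=
  \matrix_(i, j) ((i == j :> nat)%:R + (2 * k%:R * Q.+1%:R)^-1 * (e i j)%:R).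

(** The rows are chosen independently, so the proportion is a product over rows. In each row only
    the entry of column [j] is varied, and the upper bound on [|y j 0|] turns the additional 1 of
    [card_interval] into a multiple of [rho / |y j 0|]. *)
Lemma grid_transversal Q (y : 'cV[R]_d) j rho : (0 < k)%N -> 0 <= rho ->
  y j 0 != 0 -> `|y j 0| <= Q.+1%:R * rho ->
  \sum_(e : {ffun 'I_k -> {ffun 'I_d -> 'I_Q.+1}})
     [forall i, `|(grid_mx e *m y) i 0| <= rho]%:R
  <= #|{ffun 'I_k -> {ffun 'I_d -> 'I_Q.+1}}|%:R
       * ((4 * k%:R + 1) * rho / `|y j 0|) ^+ k.
Proof.
move=> k0 rho0 yj0 yQ; pose E := {ffun 'I_d -> 'I_Q.+1}.
have yj : 0 < `|y j 0| by rewrite normr_gt0.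
have kR : 0 < k%:R :> R by rewrite ltr0n.
pose c : R := (2 * k%:R * Q.+1%:R)^-1.
have c0 : 0 < c by rewrite invr_gt0 !mulr_gt0.
pose F (i : 'I_k) (f : E) : R :=
  (`|\sum_(l < d) ((i == l :> nat)%:R + c * (f l)%:R) * y l 0| <= rho)%R%:R.
have -> : \sum_(e : {ffun 'I_k -> E}) [forall i, `|(grid_mx e *m y) i 0| <= rho]%:R
   = \prod_i \sum_f F i f.
  rewrite bigA_distr_bigA; apply: eq_bigr => e _.
  have Ee i : F i (e i) = (`|(grid_mx e *m y) i 0| <= rho)%R%:R.
    by rewrite /F mxE; under [in RHS]eq_bigr do rewrite mxE.
  under [RHS]eq_bigr do rewrite Ee.
  case: (boolP [forall i, _]) => [/forallP h|]; first by rewrite big1// => i _; rewrite (h i).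
  by rewrite negb_forall => /existsP[i /negbTE hi]; rewrite (bigD1 i)//= hi mul0r.
have -> : #|{ffun 'I_k -> E}|%:R * ((4 * k%:R + 1) * rho / `|y j 0|) ^+ k
   = \prod_(i < k) (#|E|%:R * ((4 * k%:R + 1) * rho / `|y j 0|)).
  by rewrite prodr_const card_ord [in RHS]exprMn [in LHS]card_ffun card_ord natrX.
apply: ler_prod => i _; rewrite sumr_ge0 => [|f _]; last by rewrite ler0n.
have Q0 : 0 < Q.+1%:R :> R by rewrite ltr0n.
have := @sum_ffun_update _ _ (F i) (2 * rho / `|c * y j 0| + 1) j.
rewrite card_ord => su; rewrite -(ler_pM2l Q0); apply: (le_trans (su _)).
  move=> f; pose a := \sum_(l < d | l != j) ((i == l :> nat)%:R + c * (f l)%:R) * y l 0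
     + (i == j :> nat)%:R * y j 0.
  apply: le_trans (card_interval Q.+1 a _ rho0); last by rewrite mulf_neq0// gt_eqF.
  apply: ler_sum => e _; rewrite /F (bigD1 j)//= ffunE eqxx.
  rewrite (eq_bigr (fun l : 'I_d => ((i == l :> nat)%:R + c * (f l)%:R) * y l 0)); last first.
    by move=> l /negbTE lj; rewrite ffunE lj.
  by rewrite /a; set s := \sum_(_ | _) _;
    rewrite (_ : _ + s = s + (i == j :> nat)%:R * y j 0 + c * y j 0 * e%:R)//; ring.
rewrite mulrCA ler_wpM2l ?ler0n// normrM (gtr0_norm c0) /c.
rewrite (_ : 2 * rho / _ = Q.+1%:R * (4 * k%:R * rho / `|y j 0|)); last first.
  by field; rewrite !gt_eqF.
rewrite (_ : (4 * k%:R + 1) * rho / _ = 4 * k%:R * rho / `|y j 0| + rho / `|y j 0|);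
  last by field; rewrite gt_eqF.
by rewrite [leRHS]mulrDr lerD2l mulrA ler_pdivlMr// mul1r.
Qed.

End Transversality.

Lemma orthogonal_entry_ge (R : realType) d (O : 'M[R]_d) (X : 'cV[R]_d) l c :
  orthogonal_mx O -> c <= `|X l 0| -> exists l', c / d%:R <= `|(O *m X) l' 0|.
Proof.
move=> hO hc.
case: (@arg_maxP _ R _ l predT (fun i => `|(O *m X) i 0|) isT) => l' _ l'max.
exists l'; have d0 : 0 < d%:R :> R by rewrite ltr0n (leq_ltn_trans _ (ltn_ord l)).
rewrite ler_pdivrMr// (le_trans hc)// mulrC.
by apply: (orthogonal_mulmx_mle_inv hO) => i j; rewrite ord1; exact: l'max.
Qed.

Lemma seq_split_diff (T : eqType) (v v' : seq T) : size v = size v' -> v != v' ->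
  exists u i j a b, [/\ v = u ++ i :: a, v' = u ++ j :: b & i != j].
Proof.
elim: v v' => [|i v IH] [|j v']//= [hs]; rewrite eqseq_cons negb_and.
have [<-{j} /= /(IH _ hs)[u [i' [j' [a [b [-> -> h]]]]]]|ij _] := eqVneq i j.
  by exists (i :: u), i', j', a, b.
by exists [::], i, j, v, v'.
Qed.

Section Marstrand.
Context {R : realType} {d m k : nat}.
Local Notation I := 'I_m.+1.
Context (r : I -> R) (O : I -> 'M[R]_d) (t : I -> 'cV[R]_d) (g : seq I -> R).
Context (n0 L : nat) (s sigma c : R) {rm rM : R}.
Local Notation rr := (rr r).
Local Notation OO := (OO O).
Local Notation tt := (tt r O t).
Local Notation near := (near r O t).
Implicit Types (p : 'M[R]_(k, d)) (u v w : seq I).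
Context (sd : system_data r O t rm rM) {C : R} (qb : quasi_bernoulli g C).

Definition separated (e : R) :=
  forall i j u v, i != j -> exists l, e <= `|(tt (i :: u) - tt (j :: v)) l 0|.

(** Short prefixes are exempt because the Frostman bound only holds from some generation on; the
    exemption costs the factor [rm^-1 ^ (n0 * k)] in [average_bound]. *)
Definition good_word v : bool :=
  all (fun n => (n < n0)%N || (g (take n v) <= rr (take n v) `^ s)) (iota 0 L.+1).

Definition marstrand_const : R := 2 * (4 * k%:R + 1) * d%:R ^+ 2 / c + 1.

Definition average_bound : R :=
  L.+1%:R * marstrand_const ^+ k * rm^-1 ^+ (n0 * k) * (rM ^+ L) `^ (s - sigma).

Context (c0 : 0 < c) (sep : separated c) (k0 : (0 < k)%N).

Lemma marstrand_const_ge1 : 1 <= marstrand_const.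
Proof.
by rewrite lerDr divr_ge0 ?mulr_ge0 ?addr_ge0 ?exprn_ge0 ?mulr_ge0 ?ler0n// ltW.
Qed.

Lemma separated_words v v' : size v = size v' -> v != v' ->
  exists u, [/\ (size u < size v)%N, take (size u) v = u, take (size u) v' = u
    & exists l, c / d%:R * rr u <= `|(tt v - tt v') l 0| ].
Proof.
move=> hs /(seq_split_diff hs)[u [i [j [a [b [-> -> /sep ij]]]]]].
exists u; rewrite !take_size_cat//; split => //.
  by rewrite size_cat /= addnS ltnS leq_addr.
have [l hl] := ij a b; have [l' hl'] := orthogonal_entry_ge (OO_orth sd u) hl.
exists l'; rewrite [tt (u ++ i :: a)]tt_cat [tt (u ++ _)]tt_cat.
rewrite opprD addrACA subrr add0r -scalerBr -mulmxBr.
rewrite [X in `|X|]mxE normrM gtr0_norm ?(rr_gt0 sd)//.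
by rewrite [leLHS]mulrC ler_wpM2l// ltW// (rr_gt0 sd).
Qed.

(** Transversality only involves the longest common prefix, whose length varies with [v']. Summing
    over all common prefixes allows the later sum over [v'] to be taken one prefix length at a
    time. *)
Lemma near_average Q v v' (O' : 'M[R]_d) : size v = L -> size v' = L ->
  orthogonal_mx O' -> d%:R <= Q.+1%:R * rm ^+ L ->
  \sum_(e : {ffun 'I_k -> {ffun 'I_d -> 'I_Q.+1}}) (near 2 (grid_mx e *m O') v v')%:R
  <= #|{ffun 'I_k -> {ffun 'I_d -> 'I_Q.+1}}|%:R *
     \sum_(n < L.+1) (take n v == take n v')%:R
         * (marstrand_const * rr v / rr (take n v)) ^+ k.
Proof.
move=> hv hv' hO' hQ; have rv := rr_gt0 sd v.
set E := #|_|%:R; have E0 : 0 <= E by rewrite ler0n.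
have term_ge0 n : 0 <= (take n v == take n v')%:R
         * (marstrand_const * rr v / rr (take n v)) ^+ k.
  rewrite mulr_ge0 ?ler0n// exprn_ge0// mulr_ge0 ?invr_ge0 ?mulr_ge0//.
  - exact: le_trans marstrand_const_ge1.
  - exact: ltW.
  - exact/ltW/(rr_gt0 sd).
have [<-|vv'] := eqVneq v v'.
  apply: (@le_trans _ _ (E * 1)).
    by rewrite mulr1 /E -sumr_const; apply: ler_sum => e _; case: near.
  rewrite ler_wpM2l// (bigD1 ord_max)//= eqxx mul1r.
  rewrite -hv take_size mulfK ?gt_eqF//.
  rewrite -[leLHS]addr0 lerD ?exprn_ege1 ?marstrand_const_ge1// sumr_ge0// => n _.
  rewrite mulr_ge0 ?ler0n// exprn_ge0// mulr_ge0 ?invr_ge0 ?mulr_ge0//.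
  - exact: le_trans marstrand_const_ge1.
  - exact: ltW.
  - exact/ltW/(rr_gt0 sd).
have [|u [us uv uv' [l hl]]] := separated_words _ vv'; first by rewrite hv.
have ru := rr_gt0 sd u.
have [l' hl'] := orthogonal_entry_ge hO' hl.
set y := O' *m _ in hl'.
have d0 : 0 < d%:R :> R by rewrite ltr0n (leq_ltn_trans _ (ltn_ord l)).
have Y0 : 0 < `|y l' 0| by apply: lt_le_trans hl'; rewrite !(mulr_gt0, invr_gt0).
have us' : (size u < L.+1)%N by rewrite ltnS -hv ltnW.
apply: (@le_trans _ _ (E * ((4 * k%:R + 1) * (2 * rr v) / `|y l' 0|) ^+ k)); last first.
  rewrite ler_wpM2l// (bigD1 (Ordinal us'))//= uv uv' eqxx mul1r.
  rewrite -[leLHS]addr0 lerD ?sumr_ge0//.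
  have P1 : 0 <= (4 * k%:R + 1) * (2 * rr v) :> R.
    by rewrite !mulr_ge0 ?addr_ge0 ?mulr_ge0 ?ler0n// ltW.
  rewrite lerXn2r ?nnegrE ?divr_ge0 ?(ltW ru)//.
    by rewrite ltW// mulr_gt0// (lt_le_trans _ marstrand_const_ge1).
  apply: (@le_trans _ _ ((4 * k%:R + 1) * (2 * rr v) / (c / d%:R * rr u / d%:R))).
    by rewrite ler_wpM2l// lef_pV2 ?posrE// !(mulr_gt0, invr_gt0).
  rewrite [leRHS](_ : _ = 2 * (4 * k%:R + 1) * d%:R ^+ 2 / c * rr v / rr u
    + rr v / rr u); last by rewrite /marstrand_const; ring.
  rewrite -[leLHS]addr0 lerD//.
    by rewrite le_eqVlt; apply/orP; left; apply/eqP; field; rewrite !gt_eqF.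
  by rewrite divr_ge0 ?(ltW ru) ?(ltW rv).
have yd : `|y l' 0| <= Q.+1%:R * (2 * rr v).
  have /(_ l' 0) := orthogonal_mulmx_mle hO' (ttB_mle sd v v').
  rewrite mulr1 => /le_trans; apply; apply: (le_trans hQ).
  rewrite ler_wpM2l ?ler0n// (le_trans (_ : _ <= rr v)) -?hv ?(rr_ge sd)//.
  by rewrite ler_peMl ?ler1n// ltW.
have := grid_transversal k0 _ _ yd; rewrite -normr_eq0 gt_eqF// => /(_ _ isT).
move=> T; apply: le_trans (T _); last by rewrite mulr_ge0// ltW.
apply: ler_sum => e _; rewrite /near.
by under eq_forallb do rewrite -mulmxA -/y.
Qed.

Lemma sum_prefix u : (size u <= L)%N ->
  \sum_(v <- words L | take (size u) v == u) g v = g u.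
Proof.
move=> hu; rewrite -{1}(subnKC hu) big_mkcond sum_words_cat.
rewrite (big_rem u) ?mem_words//= -[RHS]addr0 -(qb_sum qb u (L - size u)); congr (_ + _).
  by apply: eq_bigr => v _; rewrite take_size_cat// eqxx.
rewrite big1_seq// => w; rewrite mem_rem_uniq ?words_uniq// inE mem_words.
move=> /andP[_ /andP[wu /eqP hw]]; rewrite big1// => v _.
by rewrite take_size_cat ?hw// (negbTE wu).
Qed.

(** For a long prefix [u] the Frostman bound gives [rr u ^ s], and [s <= k] lowers the power of
    [rr v / rr u] to [s], so that [rr u] cancels. For a short prefix [rr u] is bounded below by
    [rm ^ n0]. *)
Lemma good_term v n : size v = L -> good_word v -> (n <= L)%N ->
  0 <= sigma <= s -> s <= k%:R ->
  g (take n v) * (rr v `^ (- sigma) * (marstrand_const * rr v / rr (take n v)) ^+ k)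
  <= marstrand_const ^+ k * rm^-1 ^+ (n0 * k) * (rM ^+ L) `^ (s - sigma).
Proof.
move=> hv /allP gv nL /andP[s0 ss] sk.
set u := take n v; have rv := rr_gt0 sd v; have ru := rr_gt0 sd u.
have rm0 := sd_rm sd; have rm1 : rm <= 1.
  by rewrite (le_trans (sd_rmM sd))// ltW// (sd_rM sd).
have M1 := marstrand_const_ge1; have M0 : 0 <= marstrand_const by apply: le_trans M1.
have vu : rr v <= rr u by rewrite -(cat_take_drop n v) (rr_cat_le sd).
have xr : 0 < rr v / rr u <= 1 by rewrite divr_gt0// ler_pdivrMr// mul1r.
have vs : rr v `^ (s - sigma) <= (rM ^+ L) `^ (s - sigma).
  rewrite ge0_ler_powR ?nnegrE ?subr_ge0 ?(ltW rv) ?exprn_ge0 ?(ltW (sd_rM0 sd))//.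
  by rewrite -hv (rr_le sd).
have e1 : rr v `^ (- sigma) * rr v `^ s = rr v `^ (s - sigma).
  by rewrite -powRD ?(addrC _ s)// (gt_eqF rv) implybT.
have kp (a : R) : 0 < a -> a <= 1 -> a ^+ k <= a `^ s.
  by move=> a0 a1; rewrite -powR_mulrn ?(ltW a0)// ger_powR// a0.
rewrite (_ : _ * (_ * _) = marstrand_const ^+ k *
  (g u * (rr v `^ (- sigma) * (rr v / rr u) ^+ k))); last first.
  by rewrite -(mulrA marstrand_const) exprMn; ring.
rewrite -[leRHS]mulrA ler_wpM2l ?exprn_ge0//.
have q1 : 1 <= rm^-1 ^+ (n0 * k) by rewrite exprn_ege1// invf_ge1.
have [nn0|nn0] := ltnP n n0; last first.
  have gu : g u <= rr u `^ s.
    by have := gv n; rewrite mem_iota /= add0n ltnS nL ltnNge nn0 => /(_ isT).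
  apply: (@le_trans _ _ (rr v `^ (s - sigma))); last first.
    by apply: (le_trans vs); rewrite ler_peMl ?powR_ge0.
  rewrite -e1 mulrCA ler_wpM2l ?powR_ge0//.
  apply: (@le_trans _ _ (rr u `^ s * (rr v / rr u) `^ s)).
    rewrite ler_pM ?(qb_ge0 qb) ?exprn_ge0// ?(ltW (andP xr).1)//.
    by case/andP: xr => x0 x1; apply: kp.
  by rewrite -powRM ?(ltW ru) ?(ltW (andP xr).1)// mulrC divfK// gt_eqF.
apply: (@le_trans _ _ (rr v `^ (- sigma) * (rm^-1 ^+ (n0 * k) * rr v `^ s))).
  rewrite mulrCA ler_wpM2l ?powR_ge0//.
  apply: (@le_trans _ _ ((rr v / rr u) ^+ k)).
    by rewrite ler_piMl ?(qb_le1 qb)// exprn_ge0// ltW// (andP xr).1.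
  rewrite expr_div_n mulrC ler_pM ?invr_ge0 ?exprn_ge0 ?(ltW ru) ?(ltW rv)//; last first.
    by rewrite kp// (rr_le1 sd).
  rewrite -exprVn exprM lerXn2r ?nnegrE ?exprn_ge0 ?invr_ge0 ?(ltW rm0) ?(ltW ru)//.
  rewrite exprVn lef_pV2 ?posrE ?exprn_gt0//; apply: le_trans (rr_ge sd u).
  by rewrite ler_wiXn2l ?(ltW rm0)// size_takel ?hv// ltnW.
by rewrite mulrCA e1; apply: ler_wpM2l => //; exact: le_trans ler01 q1.
Qed.

(* The averaged discretised form of Marstrand's projection theorem. *)
Lemma Phi_average Q (O' : 'M[R]_d) : orthogonal_mx O' ->
  d%:R <= Q.+1%:R * rm ^+ L -> 0 <= sigma <= s -> s <= k%:R ->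
  \sum_(e : {ffun 'I_k -> {ffun 'I_d -> 'I_Q.+1}})
     Phi r O t g L good_word sigma 2 (grid_mx e *m O')
  <= #|{ffun 'I_k -> {ffun 'I_d -> 'I_Q.+1}}|%:R * average_bound.
Proof.
move=> hO' hQ ss sk; set E := #|_|%:R; have E0 : 0 <= E by rewrite ler0n.
have g0 := qb_ge0 qb.
rewrite /Phi exchange_big /=.
apply: (@le_trans _ _ (\sum_(v <- words L) g v * (E * average_bound))); last first.
  by rewrite -mulr_suml (qb_sum1 qb) mul1r.
rewrite big_mkcond; apply: ler_sum_words => v hv.
have ab0 : 0 <= average_bound.
  rewrite !mulr_ge0 ?ler0n ?exprn_ge0 ?invr_ge0 ?powR_ge0 ?(ltW (sd_rm sd))//.
  exact: le_trans marstrand_const_ge1.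
case: ifPn => gv; last by rewrite mulr_ge0// mulr_ge0.
set P := fun n : nat => rr v `^ (- sigma) * (marstrand_const * rr v / rr (take n v)) ^+ k.
have P0 n : 0 <= P n.
  rewrite mulr_ge0 ?powR_ge0// exprn_ge0// ltW// mulr_gt0 ?invr_gt0 ?(rr_gt0 sd)//.
  by rewrite mulr_gt0 ?(rr_gt0 sd)// (lt_le_trans _ marstrand_const_ge1).
apply: (@le_trans _ _ (\sum_(v' <- words L) g v * g v' *
   (E * \sum_(n < L.+1) (take n v' == take n v)%:R * P n))).
  under eq_bigr do rewrite big_mkcond.
  rewrite exchange_big; apply: ler_sum_words => v' hv'.
  apply: (@le_trans _ _ (g v * g v' * rr v `^ (- sigma) * \sum_e (near 2 (grid_mx e *m O') v v')%:R)).
    rewrite mulr_sumr; apply: ler_sum => e _.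
    case: (good_word v'); case: (rr v == rr v') => /=; rewrite ?mulr_ge0 ?powR_ge0 ?ler0n//.
    by case: near; rewrite ?mulr1 ?mulr0.
  rewrite -mulrA ler_wpM2l ?mulr_ge0//.
  apply: (le_trans (ler_wpM2l (powR_ge0 _ _) (near_average hv hv' hO' hQ))).
  rewrite mulrCA ler_wpM2l// mulr_sumr; apply: ler_sum => n _.
  by rewrite eq_sym mulrCA.
under eq_bigr do rewrite -mulrA; rewrite -mulr_sumr ler_wpM2l//.
under eq_bigr do rewrite mulrCA; rewrite -mulr_sumr ler_wpM2l//.
under eq_bigr do rewrite mulr_sumr; rewrite exchange_big /=.
rewrite /average_bound -2!mulrA -[L.+1 in leRHS]card_ord mulr_natl -sumr_const.
apply: ler_sum => n _.
rewrite (_ : \sum_(v' <- _) _ = g (take n v) * P n); last first.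
  have nL : (n <= L)%N by rewrite -ltnS.
  have sz : size (take n v) = n by rewrite size_takel ?hv.
  rewrite -[in RHS]sum_prefix ?sz// mulr_suml [RHS]big_mkcond.
  by apply: eq_bigr => v' _; case: eqP => _; rewrite ?mul1r// mul0r mulr0.
by rewrite mulrA; apply: good_term => //; rewrite -ltnS.
Qed.

End Marstrand.

(** * Typical directions *)

Section RisingSun.
Context {R : realFieldType}.
Implicit Types f : nat -> nat.

Lemma sum_ord_cat (a b : nat) f :
  (\sum_(i < a + b) f i = \sum_(i < a) f i + \sum_(i < b) f (a + i))%N.
Proof. by rewrite big_split_ord. Qed.

Definition bad_start (kappa : R) K f n : bool :=
  [exists N : 'I_K.+1, kappa * N%:R < (\sum_(i < N) f (n + i)%N)%:R].

(* Greedy covering of the bad starting points by disjoint bad runs. *)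
Lemma maximal_inequality (kappa : R) K f n : 0 <= kappa ->
  kappa * (\sum_(i < n) bad_start kappa K f i)%:R <= (\sum_(i < n + K) f i)%:R.
Proof.
move=> k0; have [N] := ubnP n; elim: N n f => // N IH [|n] f nN.
  by rewrite big_ord0 mulr0 ler0n.
have shift a j : bad_start kappa K f (a + j) = bad_start kappa K (fun i => f (a + i)%N) j.
  by apply: eq_existsb => M; congr (_ < _%:R); apply: eq_bigr => i _; rewrite addnA.
have step a b : (0 < a)%N -> (a + b = n.+1)%N ->
  kappa * (\sum_(i < a) bad_start kappa K f i)%:R <= (\sum_(i < a) f i)%:R ->
  kappa * (\sum_(i < n.+1) bad_start kappa K f i)%:R <= (\sum_(i < n.+1 + K) f i)%:R.
  move=> a0 ab h; rewrite -ab -addnA (sum_ord_cat a b (fun i => bad_start kappa K f i)).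
  rewrite sum_ord_cat !natrD mulrDr lerD//.
  have := IH b (fun i => f (a + i)%N).
  have bN : (b < N)%N by move: nN a0 ab; clear; lia.
  move=> /(_ bN); apply: le_trans.
  by rewrite ler_wpM2l// ler_nat leq_sum// => i _; rewrite shift.
have [/existsP[M /= hM]|nb] := boolP (bad_start kappa K f 0); last first.
  by apply: (step 1 n)%N; rewrite ?add1n// !big_ord1 (negbTE nb) mulr0 ler0n.
have M0 : (0 < M)%N.
  by rewrite lt0n; apply/eqP => M0; move: hM; rewrite M0 big_ord0 mulr0 ltxx.
have bM a : (\sum_(i < a) bad_start kappa K f i <= a)%N.
  by rewrite -[leqRHS]card_ord -sum1_card leq_sum// => i _; case: bad_start.
(* A bad run inside the window is removed and the induction continues after it; a run that
   overshoots ends within the [K] extra places and outweighs all starting points of the window. *)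
have [h|h] := leqP M n.+1.
  apply: (step M (n.+1 - M)%N); rewrite ?subnKC//.
  by apply: le_trans (ltW hM); rewrite ler_wpM2l// ler_nat.
apply: (@le_trans _ _ (kappa * M%:R)).
  by rewrite ler_wpM2l// ler_nat (leq_trans (bM _))// ltnW.
apply: (le_trans (ltW hM)); rewrite ler_nat -(subnKC (_ : M <= n.+1 + K)%N).
  by rewrite sum_ord_cat leq_addr.
by rewrite (leq_trans (_ : M <= K)%N) ?leq_addl// -ltnS.
Qed.

Lemma exists_le_average (I : finType) (i0 : I) (F : I -> R) (c : R) :
  \sum_i F i <= #|I|%:R * c -> exists i, F i <= c.
Proof.
move=> h; case: (@arg_minP _ R I i0 predT F isT) => i _ imin; exists i.
have I0 : 0 < #|I|%:R :> R by rewrite ltr0n; apply/card_gt0P; exists i0.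
rewrite -(ler_pM2l I0) (le_trans _ h)// mulr_natl -sumr_const.
by apply: ler_sum => j _; exact: imin.
Qed.

Lemma exists_ge_average (I : finType) (i0 : I) (F : I -> R) (c : R) :
  #|I|%:R * c <= \sum_i F i -> exists i, c <= F i.
Proof.
move=> h; have [|i] := @exists_le_average I i0 (fun i => - F i) (- c).
  by rewrite sumrN mulrN lerN2.
by rewrite lerN2; exists i.
Qed.

End RisingSun.

Lemma infinite_pigeonhole (T : finType) (c : nat -> T) :
  exists x, forall n, exists2 l, (n <= l)%N & c l = x.
Proof.
apply: contrapT => /forallNP h.
have H x : exists n, forall l, (n <= l)%N -> c l <> x.
  have := h x; move=> /existsNP[n hn]; exists n => l nl e; apply: hn.
  by exists l.
have [f hf] := choice H.
pose n := \max_x f x; apply: (hf (c n) n) => //.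
exact: (leq_bigmax (c n)).
Qed.

(** Total boundedness of bounded matrices. Pigeonhole on colours does the work of extracting
    convergent subsequences of rotations. *)
Lemma finite_colouring (R : realType) a b (B eps : R) : 0 < eps ->
  exists (T : finType) (f : 'M[R]_(a, b) -> T),
    forall X Y, mle X B -> mle Y B -> f X = f Y -> mle (X - Y) eps.
Proof.
move=> e0; pose N := `|Num.floor (2 * B / eps)|%N.
pose F (x : R) : 'I_N.+1 := inord `|Num.floor ((x + B) / eps)|%N.
exists 'M['I_N.+1]_(a, b), (map_mx F) => X Y hX hY /matrixP h i j.
have := h i j; rewrite !mxE => /(congr1 (@nat_of_ord _)).
have key (Z : 'M[R]_(a, b)) : mle Z B ->
    0 <= (Z i j + B) / eps <= 2 * B / eps.
  move=> /(_ i j); rewrite ler_norml => /andP[h1 h2].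
  rewrite divr_ge0 ?ler_pM2r ?invr_gt0//=; lra.
have fl (Z : 'M[R]_(a, b)) : mle Z B ->
    (`|Num.floor ((Z i j + B) / eps)| < N.+1)%N.
  move=> /key /andP[h1 h2]; rewrite ltnS -lez_nat !gez0_abs ?floor_ge0//.
    exact: le_floor.
  exact: le_trans h2.
rewrite !inordK ?fl// => e.
have /floor_eq_dist : Num.floor ((X i j + B) / eps) = Num.floor ((Y i j + B) / eps).
  rewrite -[LHS]gez0_abs ?floor_ge0 ?(andP (key _ hX)).1// e gez0_abs//.
  by rewrite floor_ge0; case/andP: (key _ hY).
rewrite -mulrBl opprD addrACA subrr addr0 normrM normfV (gtr0_norm e0).
by rewrite ler_pdivrMr// mul1r.
Qed.

Section Directions.
Context {R : realType} {d m k : nat}.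
Local Notation I := 'I_m.+1.
Context (r : I -> R) (O : I -> 'M[R]_d) (t : I -> 'cV[R]_d) (g : seq I -> R).
Context (L : nat) (good : pred (seq I)) (sigma phi0 kappa : R) {rm rM : R}.
Local Notation rr := (rr r).
Local Notation OO := (OO O).
Local Notation tt := (tt r O t).
Local Notation near := (near r O t).
Local Notation Phi := (Phi r O t g L good sigma).
Local Notation good_dir := (good_dir r O t g L good sigma phi0).
Local Notation heavy := (heavy r O t g L good sigma phi0).
Local Notation num_heavy := (num_heavy r O t g L good sigma phi0).
Local Notation num_bad_dir := (num_bad_dir r O t g L good sigma phi0).
Implicit Types (p : 'M[R]_(k, d)) (u v w y : seq I).
Context (sd : system_data r O t rm rM) {C : R} (qb : quasi_bernoulli g C).

Lemma num_bad_dir_catl p N n y z : (N <= n)%N -> size y = (n * L)%N ->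
  num_bad_dir p N (y ++ z) = num_bad_dir p N y.
Proof.
move=> Nn hy; apply: eq_bigr => i _; rewrite (@take_catl _ L i n)//.
by rewrite (leq_trans (ltnW (ltn_ord i))).
Qed.

Lemma num_heavy_catl p N n y z : (N <= n)%N -> size y = (n * L)%N ->
  num_heavy p N (y ++ z) = num_heavy p N y.
Proof.
move=> Nn hy; apply: eq_bigr => i _.
have iN := leq_trans (ltn_ord i) Nn.
by rewrite (@take_catl _ L i n) ?(@block_catl _ L i n)// ltnW.
Qed.

(** Differences of the points [tt] have entries at most 1, so the perturbation moves their
    projections by at most [d^2 eta], hence by at most [rr v] for a block [v] of length [L]. *)
Lemma Phi_perturb p p' (O' : 'M[R]_d) eta : 0 <= eta -> orthogonal_mx O' ->
  d%:R ^+ 2 * eta <= rm ^+ L -> mle (p - p') eta ->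
  Phi 1 (p *m O') <= Phi 2 (p' *m O').
Proof.
move=> e0 hO' he hp; have g0 := qb_ge0 qb.
rewrite /Phi big_mkcond [leRHS]big_mkcond; apply: ler_sum_words => v hv.
case: ifP => // _; rewrite big_mkcond [leRHS]big_mkcond; apply: ler_sum => v' _.
have T0 : 0 <= g v * g v' * rr v `^ (- sigma) by rewrite !mulr_ge0 ?powR_ge0.
case: ifP => [/and3P[-> ->] /= /forallP h|_]; last by case: ifP.
rewrite ifT//; apply/forallP => i.
have := h i; rewrite mul1r.
have -> : p' *m O' *m (tt v - tt v') = p *m O' *m (tt v - tt v')
    - (p - p') *m (O' *m (tt v - tt v')).
  by rewrite mulmxBl !mulmxA subKr.
have D := mleM e0 hp (orthogonal_mulmx_mle hO' (ttB_mle sd v v')).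
have {D} := D i 0; rewrite mulr1 => D h1.
rewrite [X in `|X|]mxE (le_trans (ler_normD _ _))//
  [X in _ + `|X|]mxE normrN.
apply: (le_trans (lerD h1 D)); rewrite mulrCA -expr2 mulrC.
by have := rr_ge sd v; rewrite hv => h2; lra.
Qed.

(** Words of [2 K] blocks leave [K] blocks ahead of each of the [K] starting times. By the maximal
    inequality the mean proportion of bad starting times is at most
    [2 K (kappa / 4) / (kappa K) = 1 / 2]; the blocks before a favourable time become the prefix
    [u]. *)
Lemma exists_good_direction Q K : (0 < K)%N -> 0 < kappa ->
  let E := {ffun 'I_k -> {ffun 'I_d -> 'I_Q.+1}} in
  (forall O', orthogonal_mx O' ->
    \sum_(e : E) (phi0 < Phi 2 (grid_mx e *m O'))%R%:R <= #|E|%:R * (kappa / 4)) ->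
  exists (e : E) u, 0 < g u /\
    (4 * C)^-1 <= \sum_(y <- words (K * L) | [forall N : 'I_K.+1,
      (\sum_(i < N) (phi0 < Phi 2 (grid_mx e *m OO u *m OO (take (i * L) y)))%R)%:R
        <= kappa * N%:R]) g y.
Proof.
move=> K0 kappa0 E H; have g0 := qb_ge0 qb.
have C0 : 0 < C by apply: lt_le_trans (qb_C1 qb).
pose f (e : E) y (n : nat) : nat := (phi0 < Phi 2 (grid_mx e *m OO (take (n * L) y)))%R.
pose W : seq (seq I) := words ((K + K) * L).
have e0 : E by exact: [ffun=> [ffun=> ord0]].
have [[e n] /= hen] : exists x : E * 'I_K,
    \sum_(y <- W) g y * (bad_start kappa K (f x.1 y) x.2)%:R <= 2^-1.
  apply: (exists_le_average (e0, Ordinal K0)).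
  rewrite card_prod card_ord -(pair_big predT predT (fun e (n : 'I_K) =>
    \sum_(y <- W) g y * (bad_start kappa K (f e y) n)%:R)) /=.
  under eq_bigr do rewrite exchange_big; rewrite exchange_big /=.
  apply: (@le_trans _ _ (\sum_(y <- W) g y * ((#|E| * K)%:R / 2))); last first.
    by rewrite -mulr_suml (qb_sum1 qb) mul1r.
  apply: ler_sum_words => y hy; under eq_bigr do rewrite -mulr_sumr.
  rewrite -mulr_sumr ler_wpM2l// -(ler_pM2l kappa0).
  apply: (@le_trans _ _ (\sum_(e : E) (\sum_(i < K + K) f e y i)%:R)).
    rewrite mulr_sumr; apply: ler_sum => e _; rewrite -natr_sum.
    exact/maximal_inequality/ltW.
  under eq_bigr do rewrite natr_sum; rewrite exchange_big /=.
  apply: (@le_trans _ _ (\sum_(i < K + K) #|E|%:R * (kappa / 4))).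
    by apply: ler_sum => i _; apply: H; apply: OO_orth sd _.
  rewrite sumr_const card_ord -[_ *+ (K + K)]mulr_natl natrD natrM.
  by rewrite le_eqVlt; apply/orP; left; apply/eqP; field.
exists e; apply: contrapT => /forallNP hu.
set S := fun u => \sum_(y <- words (K * L) | [forall N : 'I_K.+1,
      (\sum_(i < N) (phi0 < Phi 2 (grid_mx e *m OO u *m OO (take (i * L) y)))%R)%:R
        <= kappa * N%:R]) g y.
have S0 u : 0 <= S u by apply: sumr_ge0.
have hS u : g u * S u <= g u * (4 * C)^-1.
  have := g0 u; rewrite le_eqVlt => /orP[/eqP <-|u0]; first by rewrite !mul0r.
  rewrite ler_wpM2l// leNgt; apply/negP => h; apply: (hu u); split => //.
  exact: ltW.
have nK : (n <= K)%N by apply: ltnW.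
have eW : ((K + K) * L = n * L + (K * L + (K - n) * L))%N.
  by rewrite -!mulnDl addnCA subnKC.
have good_sum : 2^-1 <= \sum_(y <- W) g y * (~~ bad_start kappa K (f e y) n)%:R.
  have : \sum_(y <- W) g y * (bad_start kappa K (f e y) n)%:R
      + \sum_(y <- W) g y * (~~ bad_start kappa K (f e y) n)%:R = 1.
    rewrite -big_split /= -[RHS](qb_sum1 qb ((K + K) * L)); apply: eq_bigr => y _.
    by case: (bad_start _ _ _ _) => /=; rewrite ?mulr1n ?mulr0n ?mulr1 ?mulr0 ?addr0 ?add0r.
  by move: hen; set a := \sum_(y <- W) _; set b := \sum_(y <- W) _; lra.
have : 2^-1 <= C * \sum_(u <- words (n * L)) g u * S u.
  apply: (le_trans good_sum); rewrite /W eW sum_words_cat mulr_sumr.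
  apply: ler_sum_words => u hU; rewrite sum_words_cat mulrA /S mulr_sumr [leRHS]big_mkcond.
  apply: ler_sum_words => y hy.
  have eb z : ~~ bad_start kappa K (f e (u ++ y ++ z)) n = [forall N : 'I_K.+1,
      (\sum_(i < N) (phi0 < Phi 2 (grid_mx e *m OO u *m OO (take (i * L) y)))%R)%:R
        <= kappa * N%:R].
    rewrite /bad_start negb_exists; apply: eq_forallb => N; rewrite -leNgt.
    congr (_%:R <= _); apply: eq_bigr => i _; rewrite /f mulnDl.
    rewrite takeD -hU take_size_cat// drop_size_cat// OO_cat mulmxA.
    by rewrite (@take_catl _ L i K) ?hy// ltnW// (leq_trans (ltn_ord i))// -ltnS.
  under eq_bigr do rewrite eb catA; rewrite -mulr_suml (qb_sum qb).
  by case: [forall _, _]; rewrite ?mulr1 ?(qb_le qb)// mulr0.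
have : C * \sum_(u <- words (n * L)) g u * S u <= 4^-1.
  apply: (@le_trans _ _ (C * \sum_(u <- words (n * L)) g u * (4 * C)^-1)).
    by rewrite ler_wpM2l ?(ltW C0)// ler_sum.
  rewrite -mulr_suml (qb_sum1 qb) mul1r invfM mulrCA divff ?mulr1//.
  by rewrite gt_eqF.
by move=> h1 h2; have := le_trans h2 h1; lra.
Qed.

(** Bad directions are controlled at all times, heavy labels only from [N0] on: the exceptional
    masses [2^-N] sum to little only over large [N]. *)
Definition typical N0 p K y : bool := [forall N : 'I_K.+1,
  ((num_bad_dir p N y)%:R <= kappa * N%:R) &&
  ((N0 <= N)%N ==> ((num_heavy p N y)%:R <= kappa * N%:R))].

Lemma typical_catl N0 p K K' y z : (K <= K')%N -> size y = (K * L)%N ->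
  typical N0 p K' (y ++ z) -> typical N0 p K y.
Proof.
move=> KK' hy /forallP h; apply/forallP => N.
have NK : (N <= K)%N by rewrite -ltnS.
have := h (widen_ord (KK' : (K.+1 <= K'.+1)%N) N).
by rewrite /= (@num_bad_dir_catl p N K)// (@num_heavy_catl p N K).
Qed.

Lemma sum_geometric_half (N0 K : nat) :
  \sum_(N < K.+1 | (N0 <= N)%N) 2^-1 ^+ N <= 2 * 2^-1 ^+ N0 :> R.
Proof.
have P n : 0 <= 2 * 2^-1 ^+ n :> R by rewrite mulr_ge0 ?exprn_ge0 ?invr_ge0.
suff : \sum_(N < K.+1 | (N0 <= N)%N) 2^-1 ^+ N <=
    if (N0 <= K.+1)%N then 2 * 2^-1 ^+ N0 - 2 * 2^-1 ^+ K.+1 else 0 :> R.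
  move=> /le_trans; apply; case: ifP => // _; by rewrite gerBl.
elim: K.+1 => {K} [|K IH].
  by rewrite big_ord0 leqn0; case: eqP => [->|_]; rewrite ?subrr.
rewrite big_mkcond big_ord_recr -big_mkcond /=.
apply: (le_trans (lerD IH (lexx _))).
have E : 2 * 2^-1 ^+ K.+1 = 2^-1 ^+ K :> R by rewrite exprS mulrA divff// mul1r.
have [h|h] := leqP N0 K; first by rewrite (leqW h) E; lra.
rewrite addr0; case: leqP => // h'.
have -> : N0 = K.+1 by apply/eqP; rewrite eqn_leq h h'.
by rewrite subrr.
Qed.

Lemma exists_half_pow (e : R) : 0 < e -> exists N0 : nat, 2 * 2^-1 ^+ N0 <= e.
Proof.
move=> e0; exists (Num.trunc (2 / e)).+1; set N := _.+1.
rewrite exprVn ler_pdivrMr ?exprn_gt0// -ler_pdivrMl// mulrC.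
apply: (le_trans (ltW (truncnS_gt _))); rewrite -/N -natrX ler_nat.
exact/ltnW/ltn_expl.
Qed.

Lemma grid_mx_mle Q (e : {ffun 'I_k -> {ffun 'I_d -> 'I_Q.+1}}) :
  mle (grid_mx e : 'M[R]_(k, d)) 2.
Proof.
move=> i j; rewrite mxE.
have k0 : 1 <= k%:R :> R by rewrite ler1n (leq_ltn_trans _ (ltn_ord i)).
have Q0 : 0 < Q.+1%:R :> R by rewrite ltr0n.
have eQ : (e i j)%:R <= Q.+1%:R :> R by rewrite ler_nat ltnW.
have e0 : 0 <= (e i j)%:R :> R by rewrite ler0n.
have kQ : 0 < 2 * k%:R * Q.+1%:R :> R by rewrite !mulr_gt0// (lt_le_trans ltr01).
have h1 : (2 * k%:R * Q.+1%:R)^-1 * (e i j)%:R <= 1 :> R.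
  rewrite mulrC ler_pdivrMr// mul1r (le_trans eQ)// ler_peMl ?(ltW Q0)//.
  by lra.
have h2 : 0 <= (2 * k%:R * Q.+1%:R)^-1 * (e i j)%:R :> R.
  by rewrite mulr_ge0// invr_ge0 ltW.
move: h1 h2; set z := _^-1 * _ => h1 h2.
by case: (i == j :> nat) => /=; rewrite ger0_norm ?mulr1n ?mulr0n; lra.
Qed.

Definition starts (a : I) y : bool := ohead y == Some a.

(** For each [K], [exists_good_direction] yields its own family member and prefix, and then a first
    letter is singled out. Pigeonhole on the member, the letter and the colour of the rotation fixes
    one choice that nearly recurs for arbitrarily large lengths, and truncation passes to every
    smaller [K]. *)
Lemma typical_directions Q (b theta : R) : (0 < L)%N -> 0 < kappa ->
  let E := {ffun 'I_k -> {ffun 'I_d -> 'I_Q.+1}} in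
  (forall O', orthogonal_mx O' ->
    \sum_(e : E) (phi0 < Phi 2 (grid_mx e *m O'))%R%:R <= #|E|%:R * (kappa / 4)) ->
  1 <= b -> b * theta <= 1 -> 4 <= b `^ kappa ->
  (forall p n u, size u = (n * L)%N ->
    \sum_(v <- words L | heavy p n u v) g (u ++ v) <= theta * g u) ->
  exists N0 (e : E) u a eta, 0 < eta /\
    forall p, mle (p - grid_mx e *m OO u) eta -> forall K, (0 < K)%N ->
    (8 * C * m.+1%:R)^-1 <=
      \sum_(y <- words (K * L) | typical N0 p K y && starts a y) g y.
Proof.
move=> L0 kappa0 E H b1 bt b4 Hh; have g0 := qb_ge0 qb.
have C0 : 0 < C by apply: lt_le_trans (qb_C1 qb).
have rmL : 0 < rm ^+ L by rewrite exprn_gt0// (sd_rm sd).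
pose G (e : E) u K y := [forall N : 'I_K.+1,
      (\sum_(i < N) (phi0 < Phi 2 (grid_mx e *m OO u *m OO (take (i * L) y)))%R)%:R
        <= kappa * N%:R].
have HK K : exists x : E * seq I * I, 0 < g x.1.2 /\
   (4 * C * m.+1%:R)^-1 <= \sum_(y <- words (K.+1 * L) | G x.1.1 x.1.2 K.+1 y && starts x.2 y) g y.
  have [e [u [u0 hu]]] := exists_good_direction (ltn0Sn K) kappa0 H.
  have [|a ha] := @exists_ge_average R I ord0
     (fun a => \sum_(y <- words (K.+1 * L) | G e u K.+1 y && starts a y) g y)
     (4 * C * m.+1%:R)^-1; last by exists (e, u, a).
  rewrite card_ord invfM mulrCA divff ?mulr1 ?pnatr_eq0//; apply: (le_trans hu).
  under [leRHS]eq_bigr do rewrite big_mkcond; rewrite exchange_big /= big_mkcond.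
  apply: ler_sum_words => -[|a y] hy.
    by move/eqP: hy; rewrite eq_sym muln_eq0 /= => /eqP L00; rewrite L00 in L0.
  rewrite (bigD1 a)//= /starts /= eqxx andbT -/(G e u K.+1 (a :: y)).
  case: (G _ _ _ _) => /=.
    by rewrite lerDl sumr_ge0// => i _; case: ifP.
  by rewrite add0r sumr_ge0// => i _; case: ifP.
have [x hx] := choice HK.
(* Twice [eta] must satisfy the hypothesis of [Phi_perturb]: one [eta] for the distance of [p] to
   the fixed direction, one for replacing the rotation of [u] by that of [ul]. *)
pose eta := rm ^+ L / (4 * (d%:R + 1) ^+ 2).
have d1 : 1 <= d%:R + 1 :> R by rewrite lerDr.
have eta0 : 0 < eta by rewrite divr_gt0// mulr_gt0// exprn_gt0// (lt_le_trans ltr01).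
have ec0 : 0 < eta / (2 * (d%:R + 1)).
  by rewrite divr_gt0// mulr_gt0// (lt_le_trans ltr01).
have [T [col hcol]] := @finite_colouring R d d 1 _ ec0.
have [[[e a] c] hinf] :=
  infinite_pigeonhole (fun K => ((x K).1.1, (x K).2, col (OO (x K).1.2))).
have [l0 _ [ee ea ec]] := hinf 0%N; pose u := (x l0).1.2.
have ce0 : 0 < (8 * C * m.+1%:R)^-1 by rewrite invr_gt0 !mulr_gt0.
have [N0 hN0] := exists_half_pow ce0.
exists N0, e, u, a, eta; split => // p hp K K0.
have [l Kl [ee' ea' ec']] := hinf K.
have {}hx := (hx l).2; rewrite ee' ea' in hx.
set ul := (x l).1.2 in hx ec'; set M := l.+1 in hx.
have KM : (K <= M)%N by rewrite ltnW.
have pp' : mle (p - grid_mx e *m OO ul) (2 * eta).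
  apply: (@mle_le _ _ _ _ (eta + d%:R * (2 * (eta / (2 * (d%:R + 1)))))).
    rewrite (_ : 2 * eta = eta + eta); last by ring.
    rewrite lerD2l (_ : _ * (2 * _) = eta * (d%:R / (d%:R + 1))); last first.
      by field; rewrite gt_eqF// (lt_le_trans ltr01).
    by rewrite ler_piMr ?(ltW eta0)// ler_pdivrMr ?(lt_le_trans ltr01)// mul1r lerDl.
  apply: (mle_tri hp); rewrite -mulmxBr; apply: mleM => //; first exact: grid_mx_mle.
  apply: hcol; rewrite ?ec ?ec'//; apply: orthogonal_mle; exact: OO_orth sd _.
have e20 : 0 <= 2 * eta by rewrite mulr_ge0// ltW.
have he : d%:R ^+ 2 * (2 * eta) <= rm ^+ L.
  rewrite /eta.
  rewrite (_ : d%:R ^+ 2 * _ = rm ^+ L * (2^-1 * (d%:R / (d%:R + 1)) ^+ 2)); last first.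
    by field; rewrite gt_eqF// (lt_le_trans ltr01).
  rewrite ler_piMr ?(ltW rmL)//.
  have : (d%:R / (d%:R + 1)) ^+ 2 <= 1 :> R.
    rewrite expr_le1// ?divr_ge0 ?addr_ge0//.
    by rewrite ler_pdivrMr ?(lt_le_trans ltr01)// mul1r lerDl.
  by lra.
have bad_le N y : (num_bad_dir p N y <= \sum_(i < N)
    (phi0 < Phi 2 (grid_mx e *m OO ul *m OO (take (i * L) y)))%R)%N.
  apply: leq_sum => i _; rewrite /good_dir -ltNge.
  case: ltP => // h; rewrite lt0b; apply: (lt_le_trans h).
  exact: (Phi_perturb e20 (OO_orth sd _) he pp').
(* Half of the mass in [hx] is given up for words with too many heavy labels. *)
pose viol y := [exists N : 'I_M.+1, (N0 <= N)%N && (kappa * N%:R < (num_heavy p N y)%:R)].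
have viol_le : \sum_(y <- words (M * L) | viol y) g y <= (8 * C * m.+1%:R)^-1.
  apply: le_trans hN0; apply: (le_trans _ (sum_geometric_half N0 M)).
  apply: (@le_trans _ _ (\sum_(N < M.+1 | (N0 <= N)%N)
    \sum_(y <- words (M * L) | kappa * N%:R < (num_heavy p N y)%:R) g y)).
    under [leRHS]eq_bigr do rewrite big_mkcond; rewrite exchange_big /= big_mkcond.
    apply: ler_sum => y _; case: ifP => [/existsP[N /andP[h1 h2]]|_].
      by rewrite (bigD1 N)//= h2 lerDl sumr_ge0// => i _; case: ifP.
    by rewrite sumr_ge0// => i _; case: ifP.
  apply: ler_sum => N _; apply: le_trans (heavy_tail qb N b1 bt b4 (Hh p)).
  have NM : (N <= M)%N by rewrite -ltnS.
  rewrite -{1}(subnKC NM) mulnDl big_mkcond sum_words_cat [leRHS]big_mkcond.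
  apply: ler_sum_words => y hy; under eq_bigr do rewrite (@num_heavy_catl p N N)//.
  by case: ifP => _; rewrite ?(qb_sum qb)// big1.
have typM : (8 * C * m.+1%:R)^-1 <=
    \sum_(y <- words (M * L) | typical N0 p M y && starts a y) g y.
  have : (4 * C * m.+1%:R)^-1 <=
      \sum_(y <- words (M * L) | typical N0 p M y && starts a y) g y
      + \sum_(y <- words (M * L) | viol y) g y.
    apply: (le_trans hx); rewrite big_mkcond [X in _ <= X + _]big_mkcond.
    rewrite [X in _ <= _ + X]big_mkcond -big_split /=; apply: ler_sum => y _.
    have P1 b' : 0 <= (if b' then g y else 0) by case: b'.
    case: ifPn => [/andP[/forallP hG ->]|_]; last by rewrite addr_ge0.
    rewrite andbT; case: (boolP (viol y)) => [_|]; first by rewrite lerDr.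
    rewrite negb_exists => /forallP hv; rewrite addr0 ifT//.
    apply/forallP => N; apply/andP; split.
      by apply: le_trans (hG N); rewrite ler_nat bad_le.
    by apply/implyP => h; have := hv N; rewrite h /= -leNgt.
  have -> : (4 * C * m.+1%:R)^-1 = 2 * (8 * C * m.+1%:R)^-1.
    by field; rewrite !gt_eqF.
  move: viol_le; set z := (8 * _ * _)^-1; set a1 := \sum_(_ <- _ | viol _) _.
  by set a2 := \sum_(_ <- _ | _) _; lra.
apply: (le_trans typM); rewrite -{1}(subnKC KM) mulnDl big_mkcond sum_words_cat.
rewrite [leRHS]big_mkcond; apply: ler_sum_words => y hy.
have st z : starts a (y ++ z) = starts a y.
  case: y hy => // /eqP; rewrite eq_sym muln_eq0 => /orP[] /eqP e00.
    by rewrite e00 in K0.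
  by rewrite e00 in L0.
case: ifPn => [_|h].
  by rewrite -[leRHS](qb_sum qb y ((M - K) * L)) ler_sum// => z _; case: ifP.
rewrite big1// => z _; rewrite ifF//; apply: contraNF h.
by rewrite st => /andP[/(typical_catl KM hy) -> ->].
Qed.

End Directions.

(** * Mass of the points projecting near a given point *)

Section MassBound.
Context {R : realType} {d m k : nat}.
Local Notation I := 'I_m.+1.
Context (r : I -> R) (O : I -> 'M[R]_d) (t : I -> 'cV[R]_d) (g : seq I -> R).
Context (L : nat) (good : pred (seq I)) (phi0 kappa e s : R) (beta : nat) {rm rM : R}.
Local Notation rr := (rr r).
Local Notation OO := (OO O).
Local Notation tt := (tt r O t).
Local Notation sigma := (s + 3 * e).
Local Notation path_of := (path_of r O t L).
Local Notation path_mass := (path_mass r O t g L).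
Local Notation num_heavy := (num_heavy r O t g L good sigma phi0).
Local Notation num_bad_dir := (num_bad_dir r O t g L good sigma phi0).
Implicit Types (p : 'M[R]_(k, d)) (u v w y : seq I).
Context (sd : system_data r O t rm rM) {C : R} (qb : quasi_bernoulli g C).
Context (s0 : 0 < s) (e0 : 0 < e) (kappa0 : 0 < kappa) (rmM : rM ^+ beta <= rm).
Context (kappaE : 2 * sigma * kappa * beta%:R = e).

(** At most [2 kappa N] blocks are penalised. Through [rM ^ beta <= rm] and [kappaE] the total
    penalty is at most [(rM ^ (N L)) ^ (- e)], which [rr y ^ (- e)] dominates; so only [e] is lost
    in the exponent. *)
Lemma path_mass_typical p N y : size y = (N * L)%N ->
  (num_bad_dir p N y)%:R <= kappa * N%:R -> (num_heavy p N y)%:R <= kappa * N%:R ->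
  path_mass p N y <= rr y `^ (s + 2 * e).
Proof.
move=> hy hb hh; have sig0 : 0 <= sigma by rewrite addr_ge0 ?mulr_ge0 ?(ltW s0) ?(ltW e0).
apply: (le_trans (path_mass_bound good phi0 sd qb p sig0 hy)).
have ry := rr_gt0 sd y; have rm0 := sd_rm sd; have rM0 := sd_rM0 sd.
have q1 : 1 <= (rm ^+ L) `^ (- sigma).
  rewrite powRN invf_ge1 ?powR_gt0 ?exprn_gt0//.
  apply: (@le_trans _ _ (1 `^ sigma)); last by rewrite powR1.
  rewrite ge0_ler_powR ?nnegrE ?exprn_ge0 ?(ltW rm0)//.
  by rewrite exprn_ile1 ?(ltW rm0)// (le_trans (sd_rmM sd))// ltW// (sd_rM sd).
apply: (@le_trans _ _ (rr y `^ sigma * rr y `^ (- e))); last first.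
  rewrite -powRD ?(gt_eqF ry) ?implybT//.
  by rewrite (_ : sigma - e = s + 2 * e)//; ring.
rewrite ler_wpM2l ?powR_ge0//.
rewrite -powR_mulrn ?powR_ge0//.
apply: (@le_trans _ _ ((rm ^+ L) `^ (- sigma) `^ (2 * kappa * N%:R))).
  by rewrite ler_powR// natrD; lra.
rewrite -powRrM.
have L1 : (rm ^+ L) `^ (- (2 * sigma * kappa * N%:R))
    <= (rM ^+ (beta * L)) `^ (- (2 * sigma * kappa * N%:R)).
  rewrite !powRN lef_pV2 ?posrE ?powR_gt0 ?exprn_gt0//.
  rewrite ge0_ler_powR ?nnegrE ?exprn_ge0 ?(ltW rm0) ?(ltW rM0)//.
    by rewrite mulr_ge0// mulr_ge0 ?(ltW kappa0)// mulr_ge0.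
  by rewrite exprM lerXn2r ?nnegrE ?exprn_ge0 ?(ltW rm0) ?(ltW rM0).
rewrite (_ : - sigma * _ = - (2 * sigma * kappa * N%:R)); last by ring.
apply: (le_trans L1).
rewrite -powR_mulrn ?(ltW rM0)// -powRrM.
rewrite (_ : (beta * L)%:R * _ = (N * L)%:R * (- e)); last first.
  by rewrite -[in RHS]kappaE !natrM; ring.
rewrite powRrM powR_mulrn ?(ltW rM0)// -hy.
rewrite !powRN lef_pV2 ?posrE ?powR_gt0 ?exprn_gt0//.
by rewrite ge0_ler_powR ?nnegrE ?exprn_ge0 ?(ltW ry) ?(ltW rM0) ?(ltW e0)// (rr_le sd).
Qed.

End MassBound.

(** * Counting the label sequences that stay near a point *)

Section NearPaths.
Context {R : realType} {d m k : nat}.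
Local Notation I := 'I_m.+1.
Context (r : I -> R) (O : I -> 'M[R]_d) (t : I -> 'cV[R]_d) (L : nat) {rm rM : R}.
Local Notation rr := (rr r).
Local Notation tt := (tt r O t).
Local Notation path_of := (path_of r O t L).
Implicit Types (p : 'M[R]_(k, d)) (u v w y : seq I).
Context (sd : system_data r O t rm rM).

Definition count_rr (c : {ffun I -> 'I_L.+1}) : R := \prod_i r i ^+ c i.

Lemma count_rrE v : size v = L -> count_rr (letter_count L v) = rr v.
Proof.
move=> hv; rewrite /count_rr /rr.
have E i : (letter_count L v i : nat) = count_mem i v.
  by rewrite ffunE inordK// ltnS -hv count_size.
under eq_bigr do rewrite E.
elim: v {hv E} => [|j v IH]; first by rewrite big_nil big1.
rewrite big_cons -IH (bigD1 j)//= eqxx add1n exprS -mulrA; congr (_ * _).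
rewrite [RHS](bigD1 j)//=; congr (_ * _); apply: eq_bigr => i ij.
by rewrite eq_sym (negbTE ij).
Qed.

Definition path_rr (q : seq ({ffun I -> 'I_L.+1} * {ffun 'I_k -> int})) : R :=
  \prod_(l <- q) count_rr l.1.

(** The cell of a nearby point is stored as an offset from the cell of [z] at the same scale.
    Offsets range over a bounded set, although the cells themselves do not. *)
Definition extend_path D (z : 'cV[R]_k) q
    (c : {ffun I -> 'I_L.+1} * {ffun 'I_k -> 'I_(2 * D).+1}) :=
  rcons q (c.1, [ffun i => (Num.floor (z i 0 / (path_rr q * count_rr c.1))
                            + (c.2 i)%:Z - D%:Z)%R]).

Fixpoint near_paths D (z : 'cV[R]_k) N :
    seq (seq ({ffun I -> 'I_L.+1} * {ffun 'I_k -> int})) :=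
  if N is N'.+1 then
    [seq @extend_path D z q c | q <- near_paths D z N', c <- enum predT]
  else [:: [::]].

Lemma size_near_paths D z N :
  size (near_paths D z N) = ((L.+1 ^ m.+1 * (2 * D).+1 ^ k) ^ N)%N.
Proof.
elim: N => //= N IH.
rewrite size_allpairs IH -cardE card_prod.
by rewrite !card_ffun !card_ord [RHS]expnSr.
Qed.

Lemma path_rr_path_of p N w : (N * L <= size w)%N ->
  path_rr (path_of p N w) = rr (take (N * L) w).
Proof.
elim: N => [|N IH] hw; first by rewrite mul0n take0 rr_nil /path_rr big_nil.
rewrite /= /path_rr -cats1 big_cat big_seq1 -/(path_rr _) IH; last first.
  by apply: leq_trans hw; rewrite leq_mul2r leqnSn orbT.
rewrite count_rrE -?rr_cat; last first.
  by rewrite size_takel// size_drop -(leq_add2l (N * L)) subnKC -?mulSnr// (leq_trans _ hw)// leq_mul2r leqnSn orbT.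
by rewrite [in RHS]mulSnr takeD rr_cat.
Qed.

(** Rounding both coordinates by floors can enlarge a distance by one cell, hence [D.+1]. *)
Lemma mem_near_paths D (z : 'cV[R]_k) p N w : (N * L <= size w)%N ->
  (forall n, (1 <= n <= N)%N -> forall i,
    `|(p *m tt (take (n * L) w)) i 0 - z i 0| <= D%:R * rr (take (n * L) w)) ->
  path_of p N w \in near_paths D.+1 z N.
Proof.
elim: N => [|N IH] hw h; first by rewrite inE.
have hw' : (N * L <= size w)%N by apply: leq_trans hw; rewrite leq_mul2r leqnSn orbT.
have hq : path_of p N w \in near_paths D.+1 z N.
  by apply: IH => // n /andP[n1 nN]; apply: h; rewrite n1 leqW.
have hs : size (block L N w) = L.
  by rewrite size_takel// size_drop -(leq_add2l (N * L)) subnKC -?mulSnr.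
have eW : take (N * L) w ++ block L N w = take (N.+1 * L) w.
  by rewrite mulSnr takeD.
have rw := rr_gt0 sd (take (N.+1 * L) w).
have eR : path_rr (path_of p N w) * count_rr (letter_count L (block L N w))
    = rr (take (N.+1 * L) w).
  by rewrite path_rr_path_of// count_rrE// -rr_cat eW.
pose a i := (p *m tt (take (N.+1 * L) w)) i 0 / rr (take (N.+1 * L) w).
pose b i := z i 0 / rr (take (N.+1 * L) w).
have ab i : `|a i - b i| <= D%:R.
  rewrite /a /b -mulrBl normrM normfV (gtr0_norm rw) ler_pdivrMr//.
  by apply: h; rewrite ltn0Sn leqnn.
have fl i : (0 <= Num.floor (a i) - Num.floor (b i) + D.+1%:Z <= (2 * D.+1)%:Z)%R.
  have /andP[a1 a2] := floor_itv (a i); have /andP[b1 b2] := floor_itv (b i).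
  have := ab i; rewrite ler_norml => /andP[c1 c2].
  have eD : (D.+1%:Z)%:~R = D%:R + 1 :> R by rewrite -pmulrn -natr1.
  rewrite !intrD in a2 b2.
  have h1 : Num.floor (b i) - Num.floor (a i) < D.+1%:Z.
    by rewrite -(ltr_int R) rmorphB /= eD; lra.
  have h2 : Num.floor (a i) - Num.floor (b i) < D.+1%:Z.
    by rewrite -(ltr_int R) rmorphB /= eD; lra.
  by move: h1 h2; clear; lia.
pose o : {ffun 'I_k -> 'I_(2 * D.+1).+1} :=
  [ffun i => inord `|(Num.floor (a i) - Num.floor (b i) + D.+1%:Z)%R|%N].
apply/allpairsP; exists (path_of p N w, (letter_count L (block L N w), o)).
split => //=; first by rewrite mem_enum.
rewrite /extend_path /= eR; congr rcons; congr pair; apply/ffunP => i; rewrite !ffunE eW.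
have /andP[f1 f2] := fl i.
rewrite inordK; last by rewrite ltnS -lez_nat gez0_abs.
rewrite gez0_abs// -/(a i) -/(b i); lia.
Qed.

End NearPaths.

(** * Measures on the full shift *)

Section Cylinders.
Context {m : nat}.
Local Notation I := 'I_m.+1.
Implicit Types (x y : Sigma m) (w : seq I).

Definition cyl w : set (Sigma m) := [set x | word x (size w) = w].

Definition sft n x : Sigma m := fun l => x (n + l)%N.

Lemma size_word x n : size (word x n) = n.
Proof. exact: size_mkseq. Qed.

Lemma word_cat x n p : word x (n + p) = word x n ++ word (sft n x) p.
Proof.
rewrite /word /mkseq iotaD map_cat; congr cat.
by rewrite add0n -{1}[n]addn0 iotaDl -map_comp.
Qed.

Lemma take_word x n p : (n <= p)%N -> take n (word x p) = word x n.
Proof. by move=> np; rewrite -(subnKC np) word_cat take_size_cat ?size_word. Qed.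

Lemma wordS x n : word x n.+1 = rcons (word x n) (x n).
Proof. exact: mkseqS. Qed.

Lemma open_cyl w : open (cyl w).
Proof.
elim/last_ind: w => [|w i IH].
  have -> : cyl [::] = setT by apply/seteqP; split.
  exact: openT.
have -> : cyl (rcons w i) = cyl w `&` (fun x : Sigma m => x (size w)) @^-1` [set i].
  apply/seteqP; split=> x; rewrite /cyl /= size_rcons wordS.
    by move/eqP; rewrite eqseq_rcons => /andP[/eqP h /eqP ->].
  by case=> -> ->.
apply: openI => //; apply: open_comp => [x _|]; last exact: discrete_open.
exact: (@proj_continuous nat (fun _ => discrete_topology I) (size w)).
Qed.

Lemma cyl_nbhs (U : set (Sigma m)) x : open U -> U x ->
  exists n, cyl (word x n) `<=` U.
Proof.
move=> oU Ux; pose F := filter_from setT (fun n => cyl (word x n)).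
have FF : Filter F.
  apply: filter_from_filter => [|n p _ _]; first by exists 0%N.
  exists (maxn n p) => //= y; rewrite /cyl /= !size_word => h.
  have hn q : (q <= maxn n p)%N -> word y q = word x q.
    by move=> hq; rewrite -(take_word y hq) h take_word.
  by split; apply: hn; rewrite ?leq_maxl ?leq_maxr.
suff : F --> x.
  have := open_nbhs_nbhs (conj oU Ux) => nU /(_ _ nU)[n _ h]; by exists n.
apply/cvg_sup => i; apply/cvg_image.
  by apply/seteqP; split => // a _; exists (fun=> a).
move=> V /nbhs_singleton Vx.
exists ((fun z : Sigma m => z i) @^-1` V); last first.
  apply/seteqP; split=> [a [z /= + <-]//|a Va]; exists (fun=> a) => //.
exists i.+1 => // y hy.
have h : word y i.+1 = word x i.+1 by rewrite -[RHS]hy size_word.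
have : nth ord0 (word y i.+1) i = nth ord0 (word x i.+1) i by rewrite h.
by rewrite !nth_mkseq// => e; rewrite /preimage /mkset e.
Qed.

(** Turns a union over words into one over natural numbers, to which countable additivity applies;
    numbers coding no word contribute the empty set. *)
Lemma bigcup_words (P : seq I -> Prop) :
  \bigcup_(w in P) cyl w = \bigcup_i
    (if @pickle_inv (seq I) i is Some w then if `[< P w >] then cyl w else set0
     else set0).
Proof.
apply/seteqP; split=> x.
  move=> [w Pw cw]; exists (pickle w) => //.
  by rewrite pickleK_inv; case: asboolP.
by move=> [i _]; case: pickle_inv => // w; case: asboolP => // Pw cw; exists w.
Qed.

Lemma open_bigcup_cyl (U : set (Sigma m)) : open U ->
  U = \bigcup_(w in [set w | cyl w `<=` U]) cyl w.
Proof.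
move=> oU; apply/seteqP; split => [x Ux|x [w /= h cw]]; last exact: h.
have [n hn] := cyl_nbhs oU Ux; exists (word x n) => //.
by rewrite /cyl /= size_word.
Qed.

End Cylinders.

Section CylinderMeasure.
Context {R : realType} {m : nat} (nu : probability (borelType (Sigma m)) R).
Local Notation I := 'I_m.+1.
Implicit Types (x y : Sigma m) (w : seq I) (Y : set (borelType (Sigma m))).

Definition Pr Y : R := fine (nu Y).
Definition gw w : R := Pr (cyl w).

Lemma PrE Y : measurable Y -> nu Y = (Pr Y)%:E.
Proof. by move=> mY; rewrite /Pr fineK// fin_num_measure. Qed.

Lemma Pr_ge0 Y : 0 <= Pr Y.
Proof. by rewrite fine_ge0. Qed.

Lemma PrT : Pr setT = 1.
Proof. by rewrite /Pr probability_setT. Qed.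

Lemma Pr0 : Pr set0 = 0.
Proof. by rewrite /Pr measure0. Qed.

Lemma Pr_le A B : measurable A -> measurable B -> A `<=` B -> Pr A <= Pr B.
Proof.
move=> mA mB AB; rewrite -lee_fin -!PrE//; apply: le_measure => //; by rewrite inE.
Qed.

Lemma PrU A B : measurable A -> measurable B -> A `&` B = set0 ->
  Pr (A `|` B) = Pr A + Pr B.
Proof.
move=> mA mB AB; apply: EFin_inj; rewrite EFinD -!PrE//; first exact: measureU.
exact: measurableU.
Qed.

Lemma PrU_le A B : measurable A -> measurable B -> Pr (A `|` B) <= Pr A + Pr B.
Proof.
move=> mA mB; rewrite -lee_fin EFinD -!PrE//; first exact: measureU2.
exact: measurableU.
Qed.

Lemma Pr_split A B : measurable A -> measurable B ->
  Pr A = Pr (A `&` B) + Pr (A `\` B).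
Proof.
move=> mA mB; rewrite -PrU.
- by rewrite setUIDK.
- exact: measurableI.
- exact: measurableD.
- by apply/seteqP; split => // z [[_ h] [_ h']].
Qed.

Lemma measurable_open (U : set (Sigma m)) : open U ->
  measurable (U : set (borelType (Sigma m))).
Proof. exact: sub_sigma_algebra. Qed.

Lemma measurable_cyl w : measurable (cyl w : set (borelType (Sigma m))).
Proof. by apply: measurable_open; exact: open_cyl. Qed.

Definition level n (P : pred (seq I)) : set (borelType (Sigma m)) :=
  [set x | P (word x n)].

Lemma level_bigcup n (P : pred (seq I)) (s : seq (seq I)) :
  (forall w, w \in s -> size w = n) ->
  \big[setU/set0]_(w <- s | P w) cyl w
    = [set x | P (word x n) && (word x n \in s)].
Proof.
elim: s => [|w s IH] hs; first by rewrite big_nil; apply/seteqP; split => // x /=; rewrite andbF.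
have hw : size w = n by apply: hs; rewrite inE eqxx.
rewrite big_cons IH => [|v vs]; last by apply: hs; rewrite inE vs orbT.
apply/seteqP; split=> x; case: ifPn => Pw /=; rewrite inE /cyl /= ?hw.
- case=> [->|/andP[-> ->]]; last by rewrite orbT.
  by rewrite Pw eqxx.
- by move=> /andP[-> ->]; rewrite orbT.
- by move=> /andP[-> /orP[/eqP ->|->]]; [left|right].
- move=> /andP[h /orP[/eqP e|->]]; last by rewrite h.
  by rewrite e (negbTE Pw) in h.
Qed.

Lemma levelE n P : level n P = \big[setU/set0]_(w <- words n | P w) cyl w.
Proof.
rewrite (@level_bigcup n) => [|w]; last by rewrite mem_words => /eqP.
by apply/seteqP; split=> x /=; rewrite mem_words size_word eqxx andbT.
Qed.

Lemma measurable_level n P : measurable (level n P).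
Proof. by rewrite levelE; apply: bigsetU_measurable => w _; exact: measurable_cyl. Qed.

Lemma Pr_levelI n P Y : measurable Y ->
  Pr (level n P `&` Y) = \sum_(w <- words n | P w) Pr (cyl w `&` Y).
Proof.
move=> mY; rewrite levelE.
have : uniq (words n) := @words_uniq m n.
have : forall w, w \in words n -> size w = n by move=> w; rewrite mem_words => /eqP.
elim: (words n) => [|w s IH] hs /=; first by rewrite !big_nil set0I Pr0.
move=> /andP[ws us].
have hs' v : v \in s -> size v = n by move=> vs; apply: hs; rewrite inE vs orbT.
rewrite !big_cons; case: ifP => _; last exact: IH.
rewrite setIUl PrU.
- by rewrite IH.
- by apply: measurableI => //; exact: measurable_cyl.
- apply: measurableI => //; apply: bigsetU_measurable => v _; exact: measurable_cyl.
- apply/seteqP; split => // x /= [[cw _] []]; rewrite (@level_bigcup n)//= => /andP[_ h] _.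
  by move: h ws; rewrite -(hs w) ?inE ?eqxx// cw => ->.
Qed.

Lemma Pr_level n P : Pr (level n P) = \sum_(w <- words n | P w) gw w.
Proof.
rewrite -[level n P]setIT Pr_levelI; last exact: measurableT.
by apply: eq_bigr => w _; rewrite setIT.
Qed.

Lemma gw_ge0 w : 0 <= gw w.
Proof. exact: Pr_ge0. Qed.

Lemma gw_nil : gw [::] = 1.
Proof. by rewrite /gw (_ : cyl _ = setT) ?PrT//; apply/seteqP; split. Qed.

Lemma gw_rcons w : \sum_i gw (rcons w i) = gw w.
Proof.
have h : forall i : I, cyl (rcons w i) = level (size w).+1 (pred1 (rcons w i)).
  by move=> i; apply/seteqP; split=> x; rewrite /cyl /level /= size_rcons => /eqP.
have : gw w = Pr (level (size w).+1 (fun v => take (size w) v == w)).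
  congr Pr; apply/seteqP; split=> x; rewrite /cyl /level /= take_word// => /eqP//.
rewrite Pr_level => ->; rewrite -[(size w).+1]addn1 [in RHS]big_mkcond sum_words_cat.
rewrite (big_rem w) ?mem_words// [X in _ = _ + X]big1_seq ?addr0; last first.
  move=> v; rewrite mem_rem_uniq ?words_uniq// inE mem_words /=.
  move=> /andP[vw /eqP hv]; rewrite big1// => z _.
  by rewrite take_size_cat// (negbTE vw).
rewrite sum_wordsS; apply: eq_bigr => i _.
by rewrite sum_words0 take_size_cat// eqxx cats1.
Qed.

End CylinderMeasure.

(** * Approximation of Borel sets by cylinders *)

Section Approximation.
Context {R : realType} {m : nat} (nu : probability (borelType (Sigma m)) R).
Local Notation I := 'I_m.+1.
Implicit Types (x y : Sigma m) (w : seq I) (Y Z : set (borelType (Sigma m))).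
Local Notation Pr := (Pr nu).
Local Notation gw := (gw nu).

Lemma Pr_bigsetU_gt (F : nat -> set (borelType (Sigma m))) e :
  (forall n, measurable (F n)) -> 0 < e ->
  exists N, Pr (\bigcup_n F n) - e < Pr (\big[setU/set0]_(i < N) F i).
Proof.
move=> mF e0; pose G n := \big[setU/set0]_(i < n.+1) F i.
have mG n : measurable (G n) by apply: bigsetU_measurable.
have UG : \bigcup_n G n = \bigcup_n F n := bigcup_bigsetU_bigcup F.
have mU : measurable (\bigcup_n G n) by apply: bigcupT_measurable.
have hom : {homo G : n p / (n <= p)%N >-> (n <= p)%O}.
  by move=> n p np; apply/subsetPset/subset_bigsetU; rewrite ltnS.
have : nu (G x) @[x --> \oo] --> (Pr (\bigcup_n F n))%:E.
  by rewrite -UG -PrE//; exact: nondecreasing_cvg_mu.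
move=> /fine_cvg/cvgrPdist_lt/(_ _ e0)[N _ /(_ N (leqnn N))] /= h.
exists N.+1; move: h; rewrite -/(Pr (G N)) ltr_norml => /andP[_].
by rewrite ltrBlDr -ltrBlDl.
Qed.

Lemma Pr_bigcap_ge (F : nat -> set (borelType (Sigma m))) (c : R) :
  (forall n, measurable (F n)) -> (forall n, F n.+1 `<=` F n) ->
  (forall n, c <= Pr (F n)) -> c <= Pr (\bigcap_n F n).
Proof.
move=> mF dF cF; have mI : measurable (\bigcap_n F n) by apply: bigcapT_measurable.
have hom : {homo F : n p / (n <= p)%N >-> (p <= n)%O}.
  by apply/nonincreasing_seqP => n; apply/subsetPset.
have : nu (F x) @[x --> \oo] --> (Pr (\bigcap_n F n))%:E.
  rewrite -PrE//; apply: nonincreasing_cvg_mu => //.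
  by rewrite -ge0_fin_numE ?fin_num_measure.
move=> /fine_cvg h.
rewrite -(cvg_lim _ h)//; apply: limr_ge; first by apply: cvgP; exact: h.
by apply: nearW => n; exact: cF.
Qed.

Definition symdiff Y Z := (Y `\` Z) `|` (Z `\` Y).

Lemma measurable_symdiff Y Z : measurable Y -> measurable Z ->
  measurable (symdiff Y Z).
Proof. by move=> mY mZ; apply: measurableU; apply: measurableD. Qed.

(** This property passes to complements and countable unions, hence holds on the whole
    sigma-algebra; it stands in for a density theorem. *)
Definition approximable Y := measurable Y /\
  forall e : R, 0 < e -> exists n P, Pr (symdiff Y (level n P)) < e.

Lemma level_widen n p P : level n P = level (n + p) (fun w => P (take n w)).
Proof. by apply/seteqP; split=> x; rewrite /level /= take_word// leq_addr. Qed.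

Lemma approximable_level n P : approximable (level n P).
Proof.
split; first exact: measurable_level.
move=> e e0; exists n, P; rewrite (_ : symdiff _ _ = set0) ?Pr0//.
by rewrite /symdiff setDv setU0.
Qed.

Lemma approximableC Y : approximable Y -> approximable (~` Y).
Proof.
move=> [mY h]; split; first exact: measurableC.
move=> e /h[n [P hP]]; exists n, (predC P).
rewrite (_ : symdiff _ _ = symdiff Y (level n P))//.
rewrite /symdiff (_ : level n _ = ~` level n P); last first.
  by apply/seteqP; split=> x; rewrite /level /= => /negP.
by rewrite !setDE !setCK setUC; congr (_ `|` _); rewrite setIC.
Qed.

Lemma approximableU Y Z : approximable Y -> approximable Z -> approximable (Y `|` Z).
Proof.
move=> [mY hY] [mZ hZ]; split; first exact: measurableU.
move=> e e0; have e2 : 0 < e / 2 by rewrite divr_gt0.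
have [n [P hP]] := hY _ e2; have [p [Q hQ]] := hZ _ e2.
exists (n + p)%N, (fun w => P (take n w) || Q (take p w)).
have mP := measurable_level n P; have mQ := measurable_level p Q.
have -> : level (n + p) (fun w => P (take n w) || Q (take p w)) = level n P `|` level p Q.
  apply/seteqP; split=> x; rewrite /level /= !take_word ?leq_addr ?leq_addl// => /orP//.
have m1 := measurable_symdiff mY mP; have m2 := measurable_symdiff mZ mQ.
have m3 : measurable (symdiff (Y `|` Z) (level n P `|` level p Q)).
  by apply: measurable_symdiff; apply: measurableU.
apply: (@le_lt_trans _ _ (Pr (symdiff Y (level n P) `|` symdiff Z (level p Q)))).
  apply: Pr_le => //; first exact: measurableU.
  move=> x; rewrite /symdiff /= => -[[[h|h] /not_orP[h1 h2]]|[[h|h] /not_orP[h1 h2]]].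
  - by left; left.
  - by right; left.
  - by left; right.
  - by right; right.
apply: (le_lt_trans (PrU_le nu m1 m2)).
by rewrite [ltRHS](splitr e) ltrD.
Qed.

Lemma approximable_bigsetU (F : nat -> set (borelType (Sigma m))) N :
  (forall n, approximable (F n)) -> approximable (\big[setU/set0]_(i < N) F i).
Proof.
move=> hF; elim: N => [|N IH]; last by rewrite big_ord_recr; apply: approximableU.
rewrite big_ord0 (_ : set0 = level 0 pred0); first exact: approximable_level.
by apply/seteqP; split.
Qed.

Lemma approximable_bigcup (F : nat -> set (borelType (Sigma m))) :
  (forall n, approximable (F n)) -> approximable (\bigcup_n F n).
Proof.
move=> hF; have mF n : measurable (F n) by case: (hF n).
have mU : measurable (\bigcup_n F n) by apply: bigcupT_measurable.
split => // e e0; have e2 : 0 < e / 2 by rewrite divr_gt0.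
have [N hN] := Pr_bigsetU_gt mF e2.
have [mG /(_ _ e2)[n [P hP]]] := approximable_bigsetU N hF.
set G := \big[setU/set0]_(i < N) F i in hN mG hP.
have GU : G `<=` \bigcup_n F n by rewrite /G -bigcup_mkord => x [i _ Fx]; exists i.
exists n, P; have mP := measurable_level n P.
have m1 := measurable_symdiff mG mP.
apply: (@le_lt_trans _ _ (Pr (symdiff G (level n P) `|` (\bigcup_n F n `\` G)))).
  apply: Pr_le => //; first exact: measurable_symdiff.
    by apply: measurableU => //; apply: measurableD.
  move=> x; rewrite /symdiff /= => -[[h h']|[h h']].
    by have [Gx|Gx] := pselect (G x); [left; left|right].
  by left; right; split => // /GU.
have mD : measurable (\bigcup_n F n `\` G) by apply: measurableD.
apply: (le_lt_trans (PrU_le nu m1 mD)).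
have := Pr_split nu mU mG; rewrite (setIidr GU) => E.
by rewrite [ltRHS](splitr e) ltrD//; move: hN; rewrite E; lra.
Qed.

Lemma measurable_approximable Y : measurable Y -> approximable Y.
Proof.
apply: smallest_sub.
  split.
  - by rewrite (_ : set0 = level 0 pred0); [exact: approximable_level|apply/seteqP; split].
  - by move=> A hA; rewrite setTD; exact: approximableC.
  - exact: approximable_bigcup.
move=> U oU; rewrite (open_bigcup_cyl oU) bigcup_words.
apply: approximable_bigcup => i.
have h0 : approximable set0.
  by rewrite (_ : set0 = level 0 pred0); [exact: approximable_level|apply/seteqP; split].
case: pickle_inv => // w; case: asboolP => // _.
rewrite (_ : cyl w = level (size w) (pred1 w)); first exact: approximable_level.
by apply/seteqP; split=> x; rewrite /cyl /level /= => /eqP.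
Qed.

(** If every cylinder of a good approximation lost the proportion [eta] outside [Y], the
    approximation error would be too large. *)
Lemma density_cylinder Y eta : measurable Y -> 0 < Pr Y -> 0 < eta <= 1 ->
  exists w, (0 < size w)%N /\ Pr (cyl w `\` Y) < eta * gw w.
Proof.
move=> mY Y0 /andP[eta0 eta1].
have e0 : 0 < eta * Pr Y / 4 by rewrite divr_gt0// mulr_gt0.
have [_ /(_ _ e0)[n [P hP]]] := measurable_approximable mY.
(* One more letter ensures that the words of the level are nonempty. *)
rewrite (level_widen n 1) in hP; set Q := level _ _ in hP.
have mQ : measurable Q by apply: measurable_level.
apply: contrapT => /forallNP h.
have h1 : Pr (Q `\` Y) < eta * Pr Y / 4.
  apply: le_lt_trans hP; apply: Pr_le; [exact: measurableD|exact: measurable_symdiff|].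
  by move=> x; right.
have h2 : Pr (Y `\` Q) < eta * Pr Y / 4.
  apply: le_lt_trans hP; apply: Pr_le; [exact: measurableD|exact: measurable_symdiff|].
  by move=> x; left.
have : eta * Pr Q <= Pr (Q `\` Y).
  rewrite setDE Pr_levelI; last exact: measurableC.
  rewrite /Q Pr_level mulr_sumr big_mkcond [leRHS]big_mkcond.
  apply: ler_sum_words => w hw; case: ifP => // _.
  rewrite leNgt; apply/negP => hh; apply: (h w); split => //.
  by rewrite hw addn1.
have : Pr Y <= Pr Q + Pr (Y `\` Q).
  rewrite (Pr_split nu mY mQ) lerD2r; apply: Pr_le => //; exact: measurableI.
have : Pr (Y `\` Q) * eta <= eta * Pr Y / 4 * 1.
  by rewrite ler_pM ?Pr_ge0 ?(ltW eta0) ?(ltW h2).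
move: h1 h2; set a := Pr _; set b := Pr (Y `\` Q); set c := Pr Q => h1 h2 h3 h4 h5.
have : eta * Pr Y <= eta * (c + b) by rewrite ler_wpM2l// ltW.
by rewrite mulrDr; move: h3; rewrite [b * _]mulrC; lra.
Qed.

End Approximation.

Section Decay.
Context {R : realType}.

Lemma expr_succ_le (x : R) n : 0 < x < 1 -> n.+1%:R * x ^+ n <= (1 - x)^-1.
Proof.
move=> /andP[x0 x1]; have h : 0 < 1 - x by rewrite subr_gt0.
rewrite -(ler_pM2r h) mulVf ?gt_eqF//.
have E : (1 - x) * \sum_(i < n.+1) x ^+ i = 1 - x ^+ n.+1.
  by rewrite -[1 in RHS](expr1n R n.+1) subrXX; congr (_ * _); apply: eq_bigr => i _; rewrite expr1n mul1r.
apply: (@le_trans _ _ ((1 - x) * \sum_(i < n.+1) x ^+ i)); last first.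
  by rewrite E gerBl exprn_ge0// ltW.
rewrite mulrC ler_wpM2l ?(ltW h)// -[n.+1 in leLHS]card_ord mulr_natl -sumr_const.
by apply: ler_sum => i _; rewrite ler_wiXn2l ?(ltW x0) ?(ltW x1)// -ltnS.
Qed.

(** Write [q ^ L] as [j + 1] equal factors: [j] of them absorb the powers of [L + 1], and the last
    decays like [1 / (L + 1)]. *)
Lemma poly_expr_decay (A q : R) (j : nat) : 0 < q < 1 ->
  exists L0, forall L, (L0 <= L)%N -> A * L.+1%:R ^+ j * q ^+ L <= 1.
Proof.
move=> /andP[q0 q1]; pose x := q `^ (j.+1%:R^-1).
have x0 : 0 < x by rewrite powR_gt0.
have xj : x ^+ j.+1 = q.
  by rewrite -powR_mulrn ?(ltW x0)// -powRrM mulVf ?pnatr_eq0// powRr1// ltW.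
have x1 : x < 1.
  by rewrite -(@expr_lt1 _ j.+1) ?(ltW x0)// xj.
pose B := (1 - x)^-1; have B0 : 0 <= B by rewrite invr_ge0 subr_ge0 ltW.
exists (Num.trunc (`|A| * B ^+ j.+1)) => L hL.
have E : L.+1%:R ^+ j * q ^+ L = (L.+1%:R * x ^+ L) ^+ j * x ^+ L.
  by rewrite -xj -exprM mulSn exprD exprMn -exprM mulrA [(j * L)%N]mulnC mulrAC.
have hx : L.+1%:R * x ^+ L <= B by apply: expr_succ_le; rewrite x0.
have L1 : 0 < L.+1%:R :> R by rewrite ltr0n.
apply: (@le_trans _ _ (`|A| * (B ^+ j * (B / L.+1%:R)))).
  rewrite -mulrA E; apply: (@le_trans _ _ (`|A| * ((L.+1%:R * x ^+ L) ^+ j * x ^+ L))).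
    rewrite ler_wpM2r ?ler_norm// mulr_ge0 ?exprn_ge0 ?mulr_ge0 ?exprn_ge0 ?(ltW x0)//.
  rewrite ler_wpM2l// ler_pM ?exprn_ge0 ?mulr_ge0 ?exprn_ge0 ?(ltW x0)//.
    by rewrite lerXn2r ?nnegrE// mulr_ge0 ?exprn_ge0 ?(ltW x0).
  by rewrite ler_pdivlMr// mulrC.
rewrite (_ : _ * _ = `|A| * B ^+ j.+1 / L.+1%:R); last first.
  by rewrite exprSr !mulrA.
rewrite ler_pdivrMr// mul1r (le_trans (ltW (truncnS_gt _)))//.
by rewrite ler_nat ltnS.
Qed.

Lemma powR_expr_decay (A x e : R) (j : nat) : 0 < x < 1 -> 0 < e ->
  exists L0, forall L, (L0 <= L)%N -> A * L.+1%:R ^+ j * (x ^+ L) `^ e <= 1.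
Proof.
move=> /andP[x0 x1] e0.
have [|L0 h] := @poly_expr_decay A (x `^ e) j.
  rewrite powR_gt0//=; have <- : 1 `^ e = 1 :> R by rewrite powR1.
  by rewrite gt0_ltr_powR ?nnegrE// ltW.
exists L0 => L /h; congr (_ * _ <= 1).
by rewrite -!powR_mulrn ?powR_ge0 ?(ltW x0)// -!powRrM mulrC.
Qed.

End Decay.

Lemma Pr_bigsetU_le (R : realType) m (nu : probability (borelType (Sigma m)) R)
    (F : nat -> set (borelType (Sigma m))) N : (forall n, measurable (F n)) ->
  Pr nu (\big[setU/set0]_(i < N) F i) <= \sum_(i < N) Pr nu (F i).
Proof.
move=> mF; elim: N => [|N IH]; first by rewrite !big_ord0 Pr0.
rewrite !big_ord_recr /=; apply: (@le_trans _ _ _ _ _ (PrU_le nu _ _)) => //.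
  by apply: bigsetU_measurable.
by rewrite lerD2r.
Qed.

Lemma Pr_bigcup_le (R : realType) m (nu : probability (borelType (Sigma m)) R)
    (F : nat -> set (borelType (Sigma m))) (B : R) : (forall n, measurable (F n)) ->
  (forall N, \sum_(i < N) Pr nu (F i) <= B) -> Pr nu (\bigcup_n F n) <= B.
Proof.
move=> mF h; apply/ler_addgt0Pl => e e0.
have [N hN] := Pr_bigsetU_gt nu mF e0.
rewrite -lerBlDl (le_trans (ltW hN))// (le_trans (Pr_bigsetU_le nu N mF))//.
Qed.

(** * The Frostman bound for projections *)

Section NearCover.
Context {R : realType} {d m k : nat}.
Local Notation I := 'I_m.+1.
Context (r : I -> R) (O : I -> 'M[R]_d) (t : I -> 'cV[R]_d)
  (nu : probability (borelType (Sigma m)) R).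
Local Notation g := (gw nu).
Context (L : nat) (good : pred (seq I)) (phi0 kappa e s : R) (beta : nat) {rm rM : R}.
Local Notation rr := (rr r).
Local Notation OO := (OO O).
Local Notation tt := (tt r O t).
Local Notation sigma := (s + 3 * e).
Local Notation path_of := (path_of r O t L).
Local Notation path_mass := (path_mass r O t g L).
Local Notation num_heavy := (num_heavy r O t g L good sigma phi0).
Local Notation num_bad_dir := (num_bad_dir r O t g L good sigma phi0).
Local Notation typical := (typical r O t g L good sigma phi0 kappa).
Local Notation near_paths := (near_paths r L).
Implicit Types (p : 'M[R]_(k, d)) (u v w y : seq I) (x : Sigma m).
Context (sd : system_data r O t rm rM) {C : R} (qb : quasi_bernoulli g C).
Context (s0 : 0 < s) (e0 : 0 < e) (kappa0 : 0 < kappa) (rmM : rM ^+ beta <= rm).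
Context (kappaE : 2 * sigma * kappa * beta%:R = e) (L0 : (0 < L)%N).
Context (Pi : Sigma m -> 'cV[R]_d)
  (HPi : forall x n, mle (Pi x - tt (word x n)) (d%:R * rr (word x n))).
Context (D : nat) (Pb : R) (DPb : d%:R ^+ 2 * Pb + 1 <= D%:R) (Pb0 : 0 <= Pb)
  (hT : ((L.+1 ^ m.+1 * (2 * D.+1).+1 ^ k)%N%:R * (rM ^+ L) `^ (2 * e)) <= 2^-1).

Lemma last_large_scale x rho : 0 < rho -> rho < 1 ->
  exists N, rho < rr (word x (N * L)) /\ rr (word x (N.+1 * L)) <= rho.
Proof.
move=> rho0 rho1.
have ex : exists n, rr (word x (n * L)) <= rho.
  have [|n0 h] := @poly_expr_decay R rho^-1 rM 0; first by rewrite (sd_rM0 sd) (sd_rM sd).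
  exists n0; apply: (le_trans (rr_le sd _)); rewrite size_word.
  have := h (n0 * L)%N; rewrite leq_pmulr// => /(_ isT).
  by rewrite expr0 mulr1 mulrC ler_pdivrMr// mul1r.
case: (ex_minnP ex) => -[|N] hN Nmin.
  by move: hN; rewrite mul0n rr_nil leNgt rho1.
exists N; split=> //; rewrite ltNge; apply/negP => /Nmin.
by rewrite ltnn.
Qed.

Lemma near_cover N0 (p : 'M[R]_(k, d)) w z rho : mle p Pb ->
  0 < rho -> rho < 1 -> rho < rm ^+ (N0 * L) ->
  exists Q : set (borelType (Sigma m)), [/\ measurable Q,
    (forall x, cyl w x -> 
      (forall K, typical N0 p K (word (sft (size w) x) (K * L))) ->
      mle (p *m Pi (sft (size w) x) - z) rho -> Q x) &
    Pr nu Q <= 2 * C * ((rm ^+ L)^-1 * rho) `^ s].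
Proof.
move=> hp rho0 rho1 rhoN; set n := size w.
have g0 := qb_ge0 qb; have C0 : 0 < C by apply: lt_le_trans (qb_C1 qb).
have rm0 := sd_rm sd; have rM0 := sd_rM0 sd.
have rmL : 0 < rm ^+ L by rewrite exprn_gt0.
pose B := ((rm ^+ L)^-1 * rho) `^ s; have B0 : 0 <= B by apply: powR_ge0.
(* The estimate of [path_mass_typical] concerns the whole path, so a single typical word on it
   suffices. *)
pose valid N q := `[< exists y, [/\ size y = (N * L)%N, path_of p N y = q,
   (num_bad_dir p N y)%:R <= kappa * N%:R, (num_heavy p N y)%:R <= kappa * N%:R
   & rr y <= (rm ^+ L)^-1 * rho] >].
pose P N v := let q := path_of p N (drop n v) in
   [&& take n v == w, q \in near_paths D.+1 z N & valid N q].
pose G N : set (borelType (Sigma m)) := level (n + N * L) (P N).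
exists (\bigcup_N G N); split.
- by apply: bigcupT_measurable => N; exact: measurable_level.
- move=> x cw ht hz; set x' := sft n x.
  have [N [hN1 hN2]] := last_large_scale x' rho0 rho1.
  (* The smallness of [rho] forces the time past [N0], where the heavy labels are controlled. *)
  have N0N : (N0 <= N)%N.
    rewrite leqNgt; apply/negP => NN0; move: hN2; apply/negP; rewrite -ltNge.
    apply: (lt_le_trans rhoN); apply: le_trans (rr_ge sd _); rewrite size_word.
    rewrite ler_wiXn2l ?(ltW rm0)//; last by rewrite leq_mul2r NN0 orbT.
    by rewrite (le_trans (sd_rmM sd))// ltW// (sd_rM sd).
  exists N => //; change (is_true (P N (word x (n + N * L)))).
  have wx : word x n = w by exact: cw.
  rewrite word_cat /P. rewrite take_size_cat ?size_word// drop_size_cat ?size_word// wx eqxx.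
  rewrite -/x' andTb; apply/andP; split.
    have hs : (N * L <= size (word x' (N * L)))%N by rewrite size_word.
    apply: (mem_near_paths sd hs).
    move=> j /andP[j1 jN] i.
    rewrite take_word; last by rewrite leq_mul2r jN orbT.
    set v := word x' (j * L).
    have rv : rho <= rr v.
      apply: (le_trans (ltW hN1)).
      have jNL : (j * L <= N * L)%N by rewrite leq_mul2r jN orbT.
      by rewrite -(subnKC jNL) word_cat (rr_cat_le sd).
    have h1 := mleM Pb0 hp (mleBC (HPi x' (j * L))).
    rewrite mulmxBr in h1.
    have := mle_tri h1 hz => /(_ i 0); rewrite [X in `|X|]mxE [X in _ + X]mxE.
    move=> /le_trans; apply; rewrite -/v.
    have rv0 := rr_gt0 sd v.
    apply: (@le_trans _ _ ((d%:R ^+ 2 * Pb + 1) * rr v)); last first.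
      by rewrite ler_wpM2r// ltW.
    by rewrite mulrDl mul1r lerD// le_eqVlt; apply/orP; left; apply/eqP; ring.
  apply/asboolP; exists (word x' (N * L)).
  have /forallP/(_ ord_max)/andP[hb hh] := ht N.
  rewrite size_word; split => //.
    by move: hh; rewrite N0N.
  rewrite mulrC ler_pdivlMr//; apply: le_trans hN2.
  rewrite mulSnr word_cat rr_cat ler_wpM2l ?(ltW (rr_gt0 sd _))//.
  by rewrite -[L in rm ^+ L](size_word (sft (N * L) x') L) (rr_ge sd).
apply: Pr_bigcup_le => [N|N]; first exact: measurable_level.
have PG j : Pr nu (G j) <= C * B * 2^-1 ^+ j.
  rewrite Pr_level.
  apply: (@le_trans _ _ (\sum_(y <- words (j * L) |
      (path_of p j y \in near_paths D.+1 z j) && valid j (path_of p j y)) C * g y)).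
    rewrite big_mkcond sum_words_cat (big_rem w) ?mem_words//= [X in _ + X]big1_seq ?addr0.
      rewrite [leRHS]big_mkcond; apply: ler_sum_words => y hy.
      rewrite /P take_size_cat// drop_size_cat// eqxx /=; case: ifP => // _.
      apply: (le_trans (qb_le qb _ _)); rewrite ler_wpM2r// ler_piMr ?(ltW C0)//.
      exact: qb_le1 qb _.
    move=> u; rewrite mem_rem_uniq ?words_uniq// inE mem_words => /andP[_ /andP[uw /eqP hu]].
    by rewrite big1// => y _; rewrite /P take_size_cat// (negbTE uw).
  rewrite -mulr_sumr -mulrA ler_wpM2l ?(ltW C0)//.
  pose b := B * ((rM ^+ L) `^ (2 * e)) ^+ j.
  apply: (@le_trans _ _ (\sum_(q <- near_paths D.+1 z j | valid j q)
      \sum_(y <- words (j * L) | path_of p j y == q) g y)).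
    under [leRHS]eq_bigr do rewrite big_mkcond; rewrite exchange_big /= big_mkcond.
    apply: ler_sum_words => y hy; case: ifP => [/andP[hq hv]|_].
      by rewrite big_mkcond (big_rem (path_of p j y))//= hv eqxx lerDl sumr_ge0// => q _;
        do 2 case: ifP => // _.
    by rewrite sumr_ge0// => q _; case: ifP.
  apply: (@le_trans _ _ (\sum_(q <- near_paths D.+1 z j) b)).
    rewrite big_mkcond; apply: ler_sum => q _; case: ifPn => [|_]; last first.
      by rewrite mulr_ge0 ?exprn_ge0 ?powR_ge0.
    move=> /asboolP[y [hy <- hb hh ry]].
    have := path_mass_typical sd qb s0 e0 kappa0 rmM kappaE hy hb hh.
    have ry0 := rr_gt0 sd y.
    rewrite powRD ?(gt_eqF ry0) ?implybT// => /le_trans; apply.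
    rewrite ler_pM ?powR_ge0//.
      by rewrite ge0_ler_powR ?nnegrE ?(ltW s0) ?(ltW ry0) ?mulr_ge0 ?invr_ge0 ?(ltW rmL) ?(ltW rho0).
    have -> : ((rM ^+ L) `^ (2 * e)) ^+ j = (rM ^+ (j * L)) `^ (2 * e).
      rewrite -[LHS]powR_mulrn ?powR_ge0// -powRrM [2 * e * _]mulrC [LHS]powRrM.
      by rewrite powR_mulrn ?exprn_ge0 ?(ltW rM0)// -exprM mulnC.
    have e2 : 0 <= 2 * e by rewrite mulr_ge0// ltW.
    rewrite ge0_ler_powR ?nnegrE ?exprn_ge0 ?(ltW ry0) ?(ltW rM0)//.
    by rewrite -hy (rr_le sd).
  rewrite big_const_seq count_predT iter_addr_0 size_near_paths -[b *+ _]mulr_natl natrX /b mulrCA.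
  rewrite ler_wpM2l// -exprMn lerXn2r ?nnegrE ?mulr_ge0 ?powR_ge0 ?invr_ge0//.
apply: (@le_trans _ _ (\sum_(i < N) C * B * 2^-1 ^+ i)); first by apply: ler_sum.
rewrite -mulr_sumr (_ : 2 * C * _ = C * B * 2); last by rewrite -/B; ring.
rewrite ler_wpM2l ?mulr_ge0 ?(ltW C0)//.
case: N => [|N]; first by rewrite big_ord0.
by have := @sum_geometric_half R 0 N; rewrite expr0 mulr1.
Qed.

End NearCover.

Lemma exists_mle (R : realFieldType) a b (M : 'M[R]_(a, b)) : exists e, 0 < e /\ mle M e.
Proof.
exists (1 + \sum_i \sum_j `|M i j|); split.
  by rewrite ltr_pwDl// sumr_ge0// => i _; rewrite sumr_ge0.
move=> i j; rewrite (bigD1 i)//= (bigD1 j)//=.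
have h1 : 0 <= \sum_(j0 | j0 != j) `|M i j0| by rewrite sumr_ge0.
have h2 : 0 <= \sum_(i0 | i0 != i) \sum_j `|M i0 j| by rewrite sumr_ge0// => ? _; rewrite sumr_ge0.
by lra.
Qed.

(** * A Frostman bound on a subset of positive mass *)

Section CoreMass.
Context {R : realType} {d m k : nat}.
Local Notation I := 'I_m.+1.
Context (r : I -> R) (O : I -> 'M[R]_d) (t : I -> 'cV[R]_d)
  (nu : probability (borelType (Sigma m)) R).
Local Notation g := (gw nu).
Context {rm rM c C : R}.
Local Notation rr := (rr r).
Local Notation OO := (OO O).
Local Notation tt := (tt r O t).
Implicit Types (p : 'M[R]_(k, d)) (u v w y : seq I) (x : Sigma m).
Context (sd : system_data r O t rm rM) (qb : quasi_bernoulli g C).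
Context (c0 : 0 < c) (sep : separated r O t c) (k0 : (0 < k)%N).
Context (Pi : Sigma m -> 'cV[R]_d)
  (HPi : forall x n, mle (Pi x - tt (word x n)) (d%:R * rr (word x n)))
  (PiE : forall x n, Pi x = tt (word x n) + rr (word x n) *: (OO (word x n) *m Pi (sft n x))).
Context (g_glue : forall u a y, 0 < g (rcons u a) -> 0 < g (a :: y) -> 0 < g (u ++ a :: y)).

(* Up to mass [delta], cylinders of generation at least [n0] obey
   [g w <= rr w `^ s]. *)
Definition frostman (s : R) := forall delta, 0 < delta -> exists n0, forall L,
  \sum_(v <- words L | ~~ good_word r g n0 L s v) g v <= delta.

(* The finite list [Us] bounds the length of the prefix needed to bring any
   [p *m OO w] close to [q], up to a change of basis [M] of the target space. *)
Definition reachable (q : 'M[R]_(k, d)) a := forall eta, 0 < eta ->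
  exists Us : seq (seq I), forall p, orth_projection p -> forall w, (0 < size w)%N ->
    0 < g w -> exists v M, [/\ v \in Us, M \in unitmx,
      mle (M *m p *m OO (w ++ v) - q) eta & 0 < g (w ++ rcons v a)].

Context (hit : forall Q (e : {ffun 'I_k -> {ffun 'I_d -> 'I_Q.+1}}) u a,
  reachable (grid_mx e *m OO u) a).

Lemma exists_contraction_power : exists beta : nat, (0 < beta)%N /\ rM ^+ beta <= rm.
Proof.
have [|n h] := @poly_expr_decay R rm^-1 rM 0; first by rewrite (sd_rM0 sd) (sd_rM sd).
exists n.+1; split => //; have := h n.+1 (leqnSn n).
by rewrite expr0 mulr1 mulrC ler_pdivrMr ?(sd_rm sd)// mul1r.
Qed.

Lemma exists_pos_lower_bound (Us : seq (seq I)) :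
  exists gam : R, 0 < gam <= 1 /\ forall v, v \in Us -> 0 < g v -> gam <= g v.
Proof.
elim: Us => [|v Us [gam [/andP[g0 g1] h]]]; first by exists 1; rewrite ltr01 lexx.
have [gv|gv] := ltrP 0 (g v).
  exists (Num.min gam (g v)); rewrite lt_min g0 gv ge_min g1; split => // v'.
  by rewrite inE ge_min => /orP[/eqP ->|/h hv' /hv' ->//]; rewrite lexx orbT.
exists gam; rewrite g0 g1; split => // v'; rewrite inE => /orP[/eqP -> gv'|/h//].
by rewrite ltNge gv in gv'.
Qed.

(** The set is a decreasing intersection over block counts. Prescribing the first letter [a] of the
    tail makes it compatible with [w ++ v], and the quasi-Bernoulli inequality then bounds every
    finite stage below by one constant. *)
Lemma Pr_typical_ge L good sigma phi0 kappa N0 (p : 'M[R]_(k, d)) w v a c1 :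
  (0 < L)%N -> 0 < c1 -> 0 < g (w ++ rcons v a) ->
  let Ty := typical r O t g L good sigma phi0 kappa N0 p in
  (forall K, (0 < K)%N ->
    c1 <= \sum_(y <- words (K * L) | Ty K y && starts a y) g y) ->
  let n := size (w ++ v) in
  let T := [set x | cyl (w ++ v) x /\ forall K, Ty K (word (sft n x) (K * L))] in
  measurable (T : set (borelType (Sigma m))) /\ g w * g v * c1 / C ^+ 2 <= Pr nu T.
Proof.
move=> L0 c10 gwva Ty hc n T; have g0 := qb_ge0 qb.
have C0 : 0 < C by apply: lt_le_trans (qb_C1 qb).
pose P K z := [&& take n z == w ++ v, Ty K (drop n z) & starts a (drop n z)].
(* Stages start at one block, since the empty word has no first letter to test. *)
pose F K : set (borelType (Sigma m)) := level (n + K.+1 * L) (P K.+1).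
pose F' K : set (borelType (Sigma m)) :=
  level (n + K * L) (fun z => (take n z == w ++ v) && Ty K (drop n z)).
have mF K : measurable (F K) by apply: measurable_level.
have E' : T = \bigcap_K F' K.
  apply/seteqP; split=> x.
    move=> [cx hx] K _; change (is_true ((take n (word x (n + K * L)) == w ++ v) &&
      Ty K (drop n (word x (n + K * L))))).
    rewrite word_cat take_size_cat ?size_word// drop_size_cat ?size_word// hx andbT.
    by apply/eqP.
  move=> h; have hK K : (word x n == w ++ v) && Ty K (word (sft n x) (K * L)).
    have : is_true ((take n (word x (n + K * L)) == w ++ v) &&
      Ty K (drop n (word x (n + K * L)))) := h K Logic.I.
    by rewrite word_cat take_size_cat ?size_word// drop_size_cat ?size_word.
  split=> [|K]; last by case/andP: (hK K).
  by case/andP: (hK 0%N) => /eqP.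
have mT : measurable (T : set (borelType (Sigma m))).
  by rewrite E'; apply: bigcapT_measurable => K; exact: measurable_level.
split => //.
have gwv : 0 < g (w ++ v).
  by apply: (lt_le_trans gwva); rewrite -cats1 catA (qb_cat_le qb).
have PrF K : g w * g v * c1 / C ^+ 2 <= Pr nu (F K).
  rewrite Pr_level big_mkcond sum_words_cat (big_rem (w ++ v)) ?mem_words//= -[leLHS]addr0.
  apply: lerD; last by rewrite sumr_ge0// => u _; rewrite sumr_ge0// => y _; case: ifP.
  apply: (@le_trans _ _ (\sum_(y <- words (K.+1 * L) | Ty K.+1 y && starts a y)
     C^-1 * g (w ++ v) * g y)).
    rewrite -mulr_sumr; apply: (@le_trans _ _ (C^-1 * g (w ++ v) * c1)); last first.
      by rewrite ler_wpM2l ?hc// mulr_ge0// invr_ge0 ltW.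
    rewrite mulrAC ler_wpM2r ?(ltW c10)// expr2 invfM mulrA [leLHS]mulrC.
    rewrite ler_wpM2l ?invr_ge0 ?(ltW C0)// ler_pdivrMr// [leRHS]mulrC.
    exact: (qb_ge qb gwv).
  rewrite big_mkcond; apply: ler_sum_words => y hy.
  rewrite /P take_size_cat// drop_size_cat// eqxx andTb.
  case: ifPn => // /andP[_ sa]; rewrite -mulrA mulrC ler_pdivrMr// mulrC [leRHS]mulrC.
  have := g0 y; rewrite le_eqVlt => /orP[/eqP <-|gy]; first by rewrite mul0r mulr_ge0// ltW.
  rewrite mulrC; apply: (qb_ge qb).
  case: y sa gy {hy} => // b y; rewrite /starts /= => /eqP [->] gy.
  by apply: g_glue gy; rewrite -cats1 -catA cats1.
have := Pr_bigcap_ge mF _ PrF; move=> h; apply: (le_trans (h _)).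
  move=> K x; rewrite /F /level /P /mkset => /and3P[h1 h2 h3].
  have e1 j : take n (word x (n + j)) = word x n by rewrite take_word// leq_addr.
  have e2 j : drop n (word x (n + j)) = word (sft n x) j.
    by rewrite word_cat drop_size_cat ?size_word.
  rewrite !e1 !e2 in h1 h2 h3 *.
  have le : (K.+1 * L <= K.+2 * L)%N by rewrite leq_mul2r leqnSn orbT.
  rewrite -(subnKC le) word_cat in h2 h3.
  have {}h2 : Ty K.+1 (word (sft n x) (K.+1 * L)) := typical_catl (leqnSn _) (size_word _ _) h2.
  rewrite h1 h2 /=.
  have lK : (0 < K.+1 * L)%N by rewrite muln_gt0.
  by move: h3; case: (K.+1 * L)%N lK.
apply: Pr_le => //; first exact: bigcapT_measurable.
rewrite E' => x hx K _.
have : F K x := hx K Logic.I.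
rewrite /F /F' /level /P /mkset => /and3P[h1 h2 h3].
have e1 j : take n (word x (n + j)) = word x n by rewrite take_word// leq_addr.
have e2 j : drop n (word x (n + j)) = word (sft n x) j.
  by rewrite word_cat drop_size_cat ?size_word.
rewrite !e1 !e2 in h1 h2 *; rewrite h1 /=.
have le : (K * L <= K.+1 * L)%N by rewrite leq_mul2r leqnSn orbT.
rewrite -(subnKC le) word_cat in h2.
exact: typical_catl (leqnSn _) (size_word _ _) h2.
Qed.

(* [D] consists of points of [Y] whose tail, after a prefix that turns [p] into
   nearly the typical direction [q] of [typical_directions], is typical for [q];
   density of [Y] in a cylinder makes such points a set of positive mass. The
   bound on [Q] is the Frostman condition for the projection of [nu] on [D]. *)
Lemma core_mass (s s1 : R) : 0 < s -> s < s1 -> s1 <= k%:R -> frostman s1 ->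
  forall p, orth_projection p -> forall Y : set (borelType (Sigma m)),
  measurable Y -> 0 < Pr nu Y ->
  exists (D : set (borelType (Sigma m))) K rho0, [/\ measurable D /\ D `<=` Y,
    0 < Pr nu D, 0 < rho0, 0 <= K & forall z rho, 0 < rho < rho0 ->
    exists Q : set (borelType (Sigma m)), [/\ measurable Q,
      (forall x, D x -> mle (p *m Pi x - z) rho -> Q x) & Pr nu Q <= K * rho `^ s]].
Proof.
move=> s0 ss1 s1k Hf p hp Y mY Y0.
have g0 := qb_ge0 qb; have C1 := qb_C1 qb.
have C0 : 0 < C by apply: lt_le_trans C1.
have rm0 := sd_rm sd; have rM0 := sd_rM0 sd; have rM1 := sd_rM sd.
have rm1 : rm < 1 by apply: le_lt_trans (sd_rmM sd) rM1.
have rM01 : 0 < rM < 1 by rewrite rM0.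
(* The gap is cut in four: one [e] makes the average energy small, one pays for penalised blocks,
   and two beat the number of label sequences. *)
pose e := (s1 - s) / 4; have e0 : 0 < e by rewrite divr_gt0// subr_gt0.
pose sigma := s + 3 * e; have sigma0 : 0 < sigma by rewrite addr_gt0// mulr_gt0.
have sigE : s1 - sigma = e by rewrite /sigma /e; field.
have [beta [beta0 rmM]] := exists_contraction_power.
have betaR : 0 < beta%:R :> R by rewrite ltr0n.
pose kappa := e / (2 * sigma * beta%:R).
have kappa0 : 0 < kappa by rewrite divr_gt0// !mulr_gt0.
have kappaE : 2 * sigma * kappa * beta%:R = e.
  by rewrite /kappa; field; rewrite !gt_eqF.
pose b := 4 `^ (kappa^-1).
have b1 : 1 <= b.
  rewrite /b -[leLHS](powRr0 4) ler_powR ?invr_ge0 ?(ltW kappa0)//.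
  by rewrite ler1n.
have b0 : 0 < b by apply: lt_le_trans b1.
have b4 : 4 <= b `^ kappa by rewrite -powRrM mulVf ?gt_eqF// powRr1.
(* Makes the contribution of bad blocks to [b * theta] equal to [1/2]; the bound [L2] handles the
   other half. *)
pose delta := (2 * b * C)^-1; have delta0 : 0 < delta by rewrite invr_gt0 !mulr_gt0.
have [n0 hn0] := Hf _ delta0.
pose Pb : R := d%:R * 2 + 1; have Pb0 : 0 <= Pb by rewrite addr_ge0// mulr_ge0.
pose D := (d ^ 2 * (d * 2 + 1) + 1)%N.
have DPb : d%:R ^+ 2 * Pb + 1 <= D%:R by rewrite /D !(natrD, natrM, natrX).
pose A1 := marstrand_const (k := k) (d := d) c ^+ k * rm^-1 ^+ (n0 * k) * 4 / kappa.
have e2 : 0 < e / 2 by rewrite divr_gt0.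
have e4 : 0 < e / 4 by rewrite divr_gt0.
have e22 : 0 < 2 * e by rewrite mulr_gt0.
(* Three demands on [L]: most members of the family have small energy, heavy labels are rare, and
   labels are few compared with the decay. *)
have [L1 hL1] := powR_expr_decay A1 1 rM01 e2.
have [L2 hL2] := powR_expr_decay ((1 + C ^+ 2 / 4) * (2 * b)) 0 rM01 e4.
have [L3 hL3] := powR_expr_decay (((2 * D.+1).+1 ^ k)%N%:R * 2) m.+1 rM01 e22.
pose L := (maxn (maxn L1 L2) L3).+1.
have hL n : (n <= maxn (maxn L1 L2) L3)%N -> (n <= L)%N by move=> h; rewrite leqW.
have {}hL1 := hL1 L (hL _ (leq_trans (leq_maxl _ _) (leq_maxl _ _))).
have {}hL2 := hL2 L (hL _ (leq_trans (leq_maxr _ _) (leq_maxl _ _))).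
have {}hL3 := hL3 L (hL _ (leq_maxr _ _)).
have L0 : (0 < L)%N by [].
pose x := rM ^+ L; have x0 : 0 < x by rewrite exprn_gt0.
(* A square root of the decay [x ^ e] of the mean energy: one factor serves as threshold, the other
   remains for Markov's inequality. *)
pose phi0 := x `^ (e / 2); have phi00 : 0 < phi0 by rewrite powR_gt0.
pose good := good_word r g n0 L s1.
have rmL0 : 0 < rm ^+ L by rewrite exprn_gt0.
pose Q := Num.trunc (d%:R / rm ^+ L).
have hQ : d%:R <= Q.+1%:R * rm ^+ L.
  by rewrite -ler_pdivrMr// ltW// truncnS_gt.
have hLambda : forall O', orthogonal_mx O' ->
    \sum_(E : {ffun 'I_k -> {ffun 'I_d -> 'I_Q.+1}})
       (phi0 < Phi r O t g L good sigma 2 (grid_mx E *m O'))%R%:R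
    <= #|{ffun 'I_k -> {ffun 'I_d -> 'I_Q.+1}}|%:R * (kappa / 4).
  move=> O' hO'; rewrite -(ler_pM2l phi00).
  have sg : 0 <= sigma <= s1 by rewrite (ltW sigma0) -subr_ge0 sigE ltW.
  apply: (@le_trans _ _ (\sum_(E : {ffun 'I_k -> {ffun 'I_d -> 'I_Q.+1}})
     Phi r O t g L good sigma 2 (grid_mx E *m O'))).
    rewrite mulr_sumr; apply: ler_sum => E _; case: ltP => [h|_].
      by rewrite mulr1 ltW.
    rewrite mulr0 /Phi sumr_ge0// => v _; rewrite sumr_ge0// => v' _.
    by rewrite !mulr_ge0// powR_ge0.
  apply: (le_trans (Phi_average n0 sd qb c0 sep k0 hO' hQ sg s1k)).
  rewrite [leRHS]mulrCA ler_wpM2l// /average_bound sigE -/x.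
  have -> : x `^ e = phi0 * phi0 by rewrite /phi0 -powRD ?(gt_eqF x0) ?implybT// -splitr.
  move: hL1; rewrite expr1 -/x -/phi0 /A1 => hL1.
  have pk : 0 <= phi0 * (kappa / 4) by apply: mulr_ge0; [exact: ltW|rewrite divr_ge0// ltW].
  rewrite -[leRHS]mulr1; apply: le_trans (ler_wpM2l pk hL1).
  rewrite le_eqVlt; apply/orP; left; apply/eqP.
  set M := marstrand_const c; set Mk := M ^+ k; set rk := rm^-1 ^+ _.
  by field; rewrite !gt_eqF.
pose theta := C * delta + Num.sqrt phi0 * (1 + C ^+ 2 / 4).
have sqphi : Num.sqrt phi0 = x `^ (e / 4).
  have -> : phi0 = (x `^ (e / 4)) ^+ 2.
    by rewrite expr2 -powRD ?(gt_eqF x0) ?implybT//; congr (_ `^ _); field.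
  by rewrite sqrtr_sqr ger0_norm// powR_ge0.
have bt : b * theta <= 1.
  have h1 : b * (C * delta) = 2^-1 by rewrite /delta; field; rewrite !gt_eqF.
  have h2 : b * (Num.sqrt phi0 * (1 + C ^+ 2 / 4)) <= 2^-1.
    rewrite sqphi; move: hL2; rewrite expr0 mulr1 -/x.
    set a := x `^ _; set a' := 1 + _; have -> : a' * (2 * b) * a = 2 * (b * (a * a')) by ring.
    by lra.
  by rewrite mulrDr h1; lra.
have Hh (p' : 'M[R]_(k, d)) n u : size u = (n * L)%N ->
   \sum_(v <- words L | heavy r O t g L good sigma phi0 p' n u v) g (u ++ v) <= theta * g u.
  move=> hu; exact: (heavy_le sigma sd qb p' hu phi00 (hn0 L)).
have [N0 [E [u [a [eta [eta0 hdir]]]]]] :=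
  typical_directions sd qb L0 kappa0 hLambda b1 bt b4 Hh.
pose c1 := (8 * C * m.+1%:R)^-1; have c10 : 0 < c1 by rewrite invr_gt0 !mulr_gt0.
pose eta' := Num.min eta 1; have eta'0 : 0 < eta' by rewrite lt_min eta0 ltr01.
(* The list [Us], and with it [gam] and [c2], must be fixed before the cylinder [w], because they
   determine how dense [Y] has to be in [w]. *)
have [Us hUs] := hit E u a eta'0.
have [gam [/andP[gam0 gam1] hgam]] := exists_pos_lower_bound Us.
pose c2 := gam * c1 / C ^+ 2.
have c20 : 0 < c2 by rewrite divr_gt0 ?mulr_gt0 ?exprn_gt0.
have c11 : c1 <= 1.
  rewrite invf_le1 ?mulr_gt0//; have m1 : 1 <= m.+1%:R :> R by rewrite ler1n.
  apply: (@le_trans _ _ (8 * C * 1)); last by rewrite ler_wpM2l// mulr_ge0// ltW.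
  by lra.
have c21 : 0 < c2 <= 1.
  rewrite c20 ler_pdivrMr ?exprn_gt0// mul1r.
  by rewrite (@le_trans _ _ 1)// ?exprn_ege1// mulr_ile1// ltW.
have [w [w0 hw]] := density_cylinder mY Y0 c21.
have gw0 : 0 < g w.
  by rewrite -(pmulr_rgt0 _ c20); apply: le_lt_trans hw; exact: Pr_ge0.
have [v [M [vUs uM hM gwva]]] := hUs _ hp _ w0 gw0.
set p' := M *m p *m OO (w ++ v) in hM.
have gv : 0 < g v.
  have gwv : 0 < g (w ++ v).
    by apply: (lt_le_trans gwva); rewrite -cats1 catA (qb_cat_le qb).
  have := lt_le_trans gwv (qb_le qb w v); rewrite -mulrA pmulr_rgt0// pmulr_rgt0//.
have hM' : mle (p' - grid_mx E *m OO u) eta by apply: mle_le hM; rewrite ge_min lexx.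
pose n := size (w ++ v).
pose T : set (borelType (Sigma m)) := [set y | cyl (w ++ v) y /\ forall K,
  typical r O t g L good sigma phi0 kappa N0 p' K (word (sft n y) (K * L))].
have [mT PT] : measurable T /\ g w * g v * c1 / C ^+ 2 <= Pr nu T :=
  Pr_typical_ge L0 c10 gwva (hdir p' hM').
have PT' : c2 * g w <= Pr nu T.
  apply: le_trans PT; rewrite /c2 mulrAC ler_wpM2r ?invr_ge0 ?exprn_ge0 ?(ltW C0)//.
  by rewrite mulrAC ler_wpM2r ?(ltW c10)// mulrC ler_wpM2l// hgam.
have hp' : mle p' Pb.
  have h1 : mle (grid_mx E *m OO u) (d%:R * (2 * 1)).
    apply: mleM => //; [exact: grid_mx_mle|].
    by apply: orthogonal_mle; exact: OO_orth sd _.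
  have h2 : mle (p' - grid_mx E *m OO u) 1 by apply: mle_le hM; rewrite ge_min lexx orbT.
  by have := mleD h2 h1; rewrite subrK; apply: mle_le; rewrite /Pb; lra.
have [Mb [Mb0 hMb]] := exists_mle M.
have mD : measurable (Y `&` T : set (borelType (Sigma m))) by apply: measurableI.
have rwv := rr_gt0 sd (w ++ v); set rw := rr (w ++ v) in rwv.
have kR : 0 < k%:R :> R by rewrite ltr0n.
(* The factor by which [rho] grows when the tail is rescaled by [rw] and the target is transformed
   by [M]. *)
pose c3 := k%:R * (Mb / rw); have c30 : 0 < c3 by rewrite mulr_gt0// divr_gt0.
have TT : (L.+1 ^ m.+1 * (2 * D.+1).+1 ^ k)%N%:R * (rM ^+ L) `^ (2 * e) <= 2^-1.
  move: hL3; rewrite -/x natrM !natrX; set y := _ `^ _.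
  by set a1 := _ ^+ k; set a2 := _ ^+ m.+1; lra.
pose rho0 := Num.min 1 (rm ^+ (N0 * L)) / c3.
have rho00 : 0 < rho0 by rewrite divr_gt0// lt_min ltr01 exprn_gt0.
exists (Y `&` T), (2 * C * ((rm ^+ L)^-1 * c3) `^ s), rho0; split => //.
- have E1 := Pr_split nu mT mY.
  have E2 : Pr nu (T `\` Y) <= Pr nu (cyl w `\` Y).
    apply: Pr_le; [exact: measurableD|apply: measurableD => //; exact: measurable_cyl|].
    move=> z [[cz _] nz]; split => //; rewrite /cyl /mkset.
    have : word z (size (w ++ v)) = w ++ v := cz.
    by rewrite size_cat word_cat => /eqP; rewrite eqseq_cat ?size_word// => /andP[/eqP].
  by rewrite setIC; move: E1 PT' E2 hw; lra.
- by rewrite mulr_ge0 ?powR_ge0// mulr_ge0// ltW.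
move=> z rho /andP[rho_gt0 rho_lt].
pose z' := M *m (rw^-1 *: (z - p *m tt (w ++ v))).
have rc0 : 0 < c3 * rho by rewrite mulr_gt0.
have rc1 : c3 * rho < Num.min 1 (rm ^+ (N0 * L)) by rewrite mulrC -ltr_pdivlMr.
have rc1' : c3 * rho < 1 by apply: (lt_le_trans rc1); rewrite ge_min lexx.
have rc2 : c3 * rho < rm ^+ (N0 * L) by apply: (lt_le_trans rc1); rewrite ge_min lexx orbT.
have [Qs [mQ hQs PQ]] := near_cover good phi0 sd qb s0 e0 kappa0 rmM kappaE L0 HPi DPb Pb0 TT
  (N0 := N0) (w ++ v) z' hp' rc0 rc1' rc2.
exists Qs; split => //; last first.
  have q0 : 0 <= (rm ^+ L)^-1 * c3.
    by apply: mulr_ge0; [rewrite invr_ge0 ltW|exact: ltW].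
  apply: (le_trans PQ); rewrite mulrA powRM ?(ltW rho_gt0)//.
  by rewrite mulrA.
move=> y [_ [cy hy]] hz; apply: hQs => //.
have wy : word y n = w ++ v := cy.
have -> : p' *m Pi (sft n y) - z' = M *m (rw^-1 *: (p *m Pi y - z)).
  rewrite (PiE y n) wy -/rw /z' /p' -!mulmxA -mulmxBr; congr (M *m _).
  rewrite mulmxDr -scalemxAr; set a1 := p *m tt _; set a2 := p *m (_ *m _).
  rewrite !scalerBr scalerDr scalerA mulVf ?gt_eqF// scale1r opprB.
  by rewrite addrA [a2 + _]addrC.
have hz' : mle (rw^-1 *: (p *m Pi y - z)) (rw^-1 * rho).
  by apply: mleZ hz; rewrite invr_ge0 ltW.
have := mleM (ltW Mb0) hMb hz'; apply: mle_le.
by rewrite le_eqVlt; apply/orP; left; apply/eqP; rewrite /c3; ring.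
Qed.

End CoreMass.

(** * Hausdorff dimension *)

Section NullCover.
Context {R : realType} {n : nat}.
Implicit Types (E U : set 'cV[R]_n) (s : R).

Definition set_mle U (b : R) := forall x y, U x -> U y -> mle (x - y) b.

(* Covers by sets of bounded sup-norm diameter, with real summands: equivalent
   to [hausdorff_measure s E = 0] for [0 < s], without extended reals. *)
Definition null_cover s E := forall eps : R, 0 < eps ->
  exists (U : nat -> set 'cV[R]_n) (b : nat -> R),
    [/\ E `<=` \bigcup_i U i, forall i, 0 <= b i, forall i, set_mle (U i) (b i) &
        forall N, \sum_(i < N) b i `^ s <= eps].

Lemma euclidean_norm_ge (x : 'cV[R]_n) i : `|x i 0| <= euclidean_norm x.
Proof.
rewrite /euclidean_norm -sqrtr_sqr ler_sqrt; last first.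
  by rewrite sumr_ge0// => j _; rewrite sqr_ge0.
by rewrite (bigD1 i)//= lerDl sumr_ge0// => j _; rewrite sqr_ge0.
Qed.

Lemma euclidean_norm_le (x : 'cV[R]_n) b : 0 <= b -> mle x b ->
  euclidean_norm x <= n%:R * b.
Proof.
move=> b0 hx; rewrite /euclidean_norm -[leRHS]ger0_norm ?mulr_ge0// -sqrtr_sqr.
rewrite ler_sqrt ?sqr_ge0//.
apply: (@le_trans _ _ (\sum_(i < n) b ^+ 2)).
  apply: ler_sum => i _; rewrite -[leLHS]real_normK ?num_real//.
  by rewrite lerXn2r ?nnegrE.
rewrite sumr_const card_ord -[leLHS]mulr_natl exprMn ler_wpM2r ?sqr_ge0//.
by rewrite -natrX ler_nat; case: (n) => // n'; rewrite expnS expn1 leq_pmulr.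
Qed.

Lemma diam_le U b : 0 <= b -> set_mle U b -> (diam U <= (n%:R * b)%:E)%E.
Proof.
move=> b0 hU; apply: ge_ereal_sup => _ [->|[[x y] /= [Ux Uy] <-]].
  by rewrite lee_fin mulr_ge0.
by rewrite lee_fin euclidean_norm_le//; exact: hU.
Qed.

Lemma diam_ge0 U : (0 <= diam U)%E.
Proof. by apply: ereal_sup_ubound; left. Qed.

Lemma le_diam U x y : U x -> U y -> ((euclidean_norm (x - y))%:E <= diam U)%E.
Proof. by move=> Ux Uy; apply: ereal_sup_ubound; right; exists (x, y). Qed.

Lemma nneseries_le_fin (u : nat -> \bar R) (v : nat -> R) e :
  (forall i, (0 <= u i <= (v i)%:E)%E) -> (forall N, \sum_(i < N) v i <= e) ->
  (\sum_(0 <= i <oo) u i <= e%:E)%E.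
Proof.
move=> uv hv; apply: lime_le.
  by apply: is_cvg_nneseries => i _ _; case/andP: (uv i).
apply: nearW => N; rewrite big_mkord.
apply: (@le_trans _ _ (\sum_(i < N) (v i)%:E)%E).
  by apply: lee_sum => i _; case/andP: (uv i).
by rewrite sumEFin lee_fin.
Qed.

Lemma null_cover_hausdorff s E : 0 < s -> null_cover s E -> hausdorff_measure s E = 0%E.
Proof.
move=> s0 hE; apply/eqP; rewrite eq_le; apply/andP; split; last first.
  apply: (@le_trans _ _ (hausdorff_premeasure s 1 E)); last first.
    by apply: ereal_sup_ubound; exists 1 => //=; exact: ltr01.
  apply: le_ereal_inf_tmp => _ [U _ <-]; apply: nneseries_ge0 => i _ _.
  exact: poweR_ge0.
apply: ge_ereal_sup => _ [delta /= d0 <-].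
apply/lee_addgt0Pr => eps eps0; rewrite add0e.
(* The second bound controls each single term of the sum, and thereby keeps every diameter below
   [delta]. *)
pose e1 := Num.min (eps / (n.+1%:R `^ s)) ((delta / n.+1%:R) `^ s).
have n0 : 0 < n.+1%:R :> R by rewrite ltr0n.
have e10 : 0 < e1 by rewrite lt_min divr_gt0 ?powR_gt0// divr_gt0.
have [U [b [EU b0 hU hb]]] := hE _ e10.
have bi i : b i `^ s <= e1.
  apply: le_trans (hb i.+1); rewrite big_ord_recr /= lerDr sumr_ge0// => j _.
  exact: powR_ge0.
have bd i : b i <= delta / n.+1%:R.
  rewrite leNgt; apply/negP => h.
  have : (delta / n.+1%:R) `^ s < b i `^ s.
    by rewrite gt0_ltr_powR// nnegrE// divr_ge0// ltW.
  by rewrite ltNge (le_trans (bi i))// ge_min lexx orbT.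
have nb i : n%:R * b i <= n.+1%:R * b i by rewrite ler_wpM2r// ler_nat.
apply: (@le_trans _ _ (\sum_(0 <= i <oo) poweR (diam (U i)) s)%E).
  apply: ereal_inf_lbound; exists U => //; split => // i.
  apply: (le_trans (diam_le (b0 i) (hU i))); rewrite lee_fin (le_trans (nb i))//.
  by rewrite mulrC -ler_pdivlMr.
apply: (@nneseries_le_fin _ (fun i => (n.+1%:R * b i) `^ s)) => [i|N].
  rewrite poweR_ge0 andTb; have := diam_le (b0 i) (hU i); have := diam_ge0 (U i).
  case: (diam (U i)) => [x| |] //; rewrite !lee_fin => x0 hx.
  rewrite ge0_ler_powR ?nnegrE ?(ltW s0) ?mulr_ge0//.
  exact: le_trans (nb i).
under eq_bigr do rewrite powRM ?b0//.
rewrite -mulr_sumr mulrC -ler_pdivlMr ?powR_gt0//.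
by apply: (le_trans (hb N)); rewrite ge_min lexx.
Qed.

Lemma hausdorff_null_cover s E : 0 < s -> hausdorff_measure s E = 0%E -> null_cover s E.
Proof.
move=> s0 hE eps eps0.
have : (hausdorff_premeasure s 1 E < eps%:E)%E.
  apply: (@le_lt_trans _ _ 0%E); last by rewrite lte_fin.
  by rewrite -hE; apply: ereal_sup_ubound; exists 1 => //=; exact: ltr01.
move=> /ereal_inf_lt[_ [U [EU Ud] <-] hU].
have Ufin i : diam (U i) = (fine (diam (U i)))%:E.
  rewrite fineK// ge0_fin_numE ?diam_ge0//; apply: (le_lt_trans (Ud i)).
  by rewrite ltry.
exists U, (fun i => fine (diam (U i))); split => //.
- by move=> i; rewrite fine_ge0// diam_ge0.
- move=> i x y Ux Uy j j'; rewrite ord1; apply: (le_trans (euclidean_norm_ge _ _)).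
  by rewrite -lee_fin -Ufin; exact: le_diam.
- move=> N; rewrite -lee_fin -sumEFin; apply: le_trans (ltW hU).
  rewrite (eq_bigr (fun i : 'I_N => poweR (diam (U i)) s)); last first.
    by move=> i _; rewrite -poweR_EFin -Ufin.
  rewrite -(big_mkord xpredT (fun i => poweR (diam (U i)) s)).
  by apply: nneseries_lim_ge => *; exact: poweR_ge0.
Qed.

End NullCover.

Section NullCoverTheory.
Context {R : realType}.

Lemma null_cover_sub n s (E F : set 'cV[R]_n) :
  E `<=` F -> null_cover s F -> null_cover s E.
Proof.
move=> EF h e /h[U [b [FU b0 hU hb]]]; exists U, b; split => //.
exact: subset_trans FU.
Qed.

Definition box n (y : 'cV[R]_n) (b : R) : set 'cV[R]_n := [set x | mle (x - y) b].

Lemma mx_nbhs_mle a b (X : 'M[R]_(a, b)) (U : set 'M[R]_(a, b)) : nbhs X U ->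
  exists e, 0 < e /\ forall Y, mle (Y - X) e -> U Y.
Proof.
move=> /nbhs_ballP[e /= e0 he]; exists (e / 2); split; first by rewrite divr_gt0.
move=> Y hY; apply: he; split => // i j; rewrite /ball /= distrC.
have := hY i j; rewrite !mxE => /le_lt_trans; apply.
by rewrite ltr_pdivrMr// ltr_pMr// ltr1n.
Qed.

Lemma mle_nbhs_mx a b (X : 'M[R]_(a, b)) (U : set 'M[R]_(a, b)) (e : R) : 0 < e ->
  (forall Y, mle (Y - X) e -> U Y) -> nbhs X U.
Proof.
move=> e0 h; apply/nbhs_ballP; exists e => //= Y [_ hY]; apply: h => i j.
by rewrite !mxE distrC ltW//; exact: hY.
Qed.

Lemma closed_box n (y : 'cV[R]_n) b : closed (box y b).
Proof.
rewrite -[box y b]setCK; apply: open_closedC; rewrite openE => x /= /existsNP[i /existsNP[j h]].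
have hb : 0 < `|(x - y) i j| - b by rewrite subr_gt0 ltNge; apply/negP.
have hb2 : 0 < (`|(x - y) i j| - b) / 2 by rewrite divr_gt0.
apply: (mle_nbhs_mx hb2) => z hz hzb; have := hz i j; have := hzb i j.
rewrite !mxE in hb hb2 * => h1 h2.
have := ler_distD (z i j) (x i j) (y i j); rewrite [`|x i j - z i j|]distrC; lra.
Qed.

Lemma measurable_box n (y : 'cV[R]_n) b :
  measurable (box y b : set (borelType 'cV[R]_n)).
Proof.
rewrite -[box y b]setCK; apply: measurableC; apply: sub_sigma_algebra.
exact/closed_openC/closed_box.
Qed.

(** Each covering set is enlarged to a closed box centred at one of its points, which at most
    doubles the diameter bound; intersecting over covers with sums tending to 0 gives a Borel
    set. *)
Lemma null_cover_hull n s (E : set 'cV[R]_n) : 0 < s -> null_cover s E ->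
  exists G : set (borelType 'cV[R]_n), [/\ measurable G, E `<=` G & null_cover s G].
Proof.
move=> s0 h.
have h' (j : nat) : exists Ub : (nat -> set 'cV[R]_n) * (nat -> R),
    [/\ E `<=` \bigcup_i Ub.1 i, forall i, 0 <= Ub.2 i,
        forall i, set_mle (Ub.1 i) (Ub.2 i) &
        forall N, \sum_(i < N) Ub.2 i `^ s <= j.+1%:R^-1].
  have /h[U [b hUb]] : 0 < j.+1%:R^-1 :> R by rewrite invr_gt0.
  by exists (U, b).
have [Ub hUb] := choice h'.
pose V j i : set 'cV[R]_n := if pselect (exists y, (Ub j).1 i y) is left e
  then box (projT1 (cid e)) ((Ub j).2 i) else set0.
have UV j i : (Ub j).1 i `<=` V j i.
  move=> x Ux; rewrite /V; case: pselect => [e|[]]; last by exists x.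
  by have [_ _ hU _] := hUb j; apply: hU => //; exact: projT2 (cid e).
exists (\bigcap_j \bigcup_i V j i); split.
- apply: bigcapT_measurable => j; apply: bigcupT_measurable => i; rewrite /V.
  by case: pselect => [e|_]; [exact: measurable_box|exact: measurable0].
- move=> x Ex j _; have [EU _ _ _] := hUb j; have [i _ Ux] := EU _ Ex.
  by exists i => //; exact: UV.
move=> e e0; pose j := Num.trunc (2 `^ s / e).
have [EU b0 hU hb] := hUb j.
exists (V j), (fun i => 2 * (Ub j).2 i); split.
- by move=> x /(_ j Logic.I).
- by move=> i; rewrite mulr_ge0.
- move=> i x y; rewrite /V; case: pselect => // e1 hx /mleBC hy.
  by rewrite (_ : 2 * _ = (Ub j).2 i + (Ub j).2 i); [exact: mle_tri hx hy|ring].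
move=> N; under eq_bigr do rewrite powRM ?b0//.
rewrite -mulr_sumr mulrC -ler_pdivlMr ?powR_gt0//; apply: (le_trans (hb N)).
rewrite -[leRHS]invrK lef_pV2 ?posrE ?invr_gt0 ?divr_gt0 ?powR_gt0// invf_div.
exact/ltW/truncnS_gt.
Qed.

Lemma null_cover_lipschitz n p s K (f : 'cV[R]_n -> 'cV[R]_p) E : 0 < s -> 0 < K ->
  (forall x y e, mle (x - y) e -> mle (f x - f y) (K * e)) ->
  null_cover s E -> null_cover s (f @` E).
Proof.
move=> s0 K0 hf h e e0; have e1 : 0 < e / K `^ s by rewrite divr_gt0// powR_gt0.
have [U [b [EU b0 hU hb]]] := h _ e1.
exists (fun i => f @` U i), (fun i => K * b i); split.
- by move=> _ [x Ex <-]; have [i _ Ux] := EU _ Ex; exists i => //; exists x.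
- by move=> i; rewrite mulr_ge0// ltW.
- by move=> i _ _ [x Ux <-] [y Uy <-]; apply: hf; exact: hU.
move=> N; under eq_bigr do rewrite powRM ?b0 ?(ltW K0)//.
by rewrite -mulr_sumr mulrC -ler_pdivlMr ?powR_gt0.
Qed.

(** Indices coding no element receive the empty set and the bound 0, which contributes nothing
    because [0 < s]. *)
Lemma countable_cover n s (T : countType) (E : set 'cV[R]_n) e : 0 < s ->
  (exists (U : T -> set 'cV[R]_n) (b : T -> R),
    [/\ E `<=` \bigcup_i U i, forall i, 0 <= b i, forall i, set_mle (U i) (b i) &
        forall l : seq T, uniq l -> \sum_(i <- l) b i `^ s <= e]) ->
  exists (U : nat -> set 'cV[R]_n) (b : nat -> R),
    [/\ E `<=` \bigcup_i U i, forall i, 0 <= b i, forall i, set_mle (U i) (b i) &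
        forall N, \sum_(i < N) b i `^ s <= e].
Proof.
move=> s0 [U [b [EU b0 hU hb]]].
exists (fun i => oapp U set0 (pickle_inv i)), (fun i => oapp b 0 (pickle_inv i)).
split.
- by move=> x /EU[i _ Ux]; exists (pickle i) => //=; rewrite pickleK_inv.
- by move=> i; case: pickle_inv => /=.
- by move=> i; case: pickle_inv => [j|] /=; [exact: hU|move=> x y []].
move=> N; pose l := pmap (@pickle_inv T) (iota 0 N).
have -> : \sum_(i < N) (oapp b 0 (pickle_inv i)) `^ s = \sum_(i <- l) b i `^ s.
  rewrite /l -(big_mkord xpredT (fun i => (oapp b 0 (pickle_inv i)) `^ s)) /index_iota subn0.
  elim: (iota 0 N) => [|i r IH]; first by rewrite !big_nil.
  rewrite big_cons IH /=; case: pickle_inv => [j|] /=; first by rewrite big_cons.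
  by rewrite powR0 ?gt_eqF// add0r.
apply: hb; rewrite /l; apply: (@map_uniq _ _ (Some \o id)) => /=.
have -> : [seq (Some \o id) i | i <- pmap (@pickle_inv T) (iota 0 N)]
   = [seq x <- map (@pickle_inv T) (iota 0 N) | isSome x].
  by elim: (iota 0 N) => //= i r IH; case: pickle_inv => [j|] //=; rewrite IH.
rewrite filter_map map_inj_in_uniq ?filter_uniq ?iota_uniq// => i j.
rewrite !mem_filter /= => /andP[hi _] /andP[hj _] hij.
have := @pickle_invK T i; have := @pickle_invK T j; rewrite hij.
by move: hj; case: pickle_inv => //= t _ <- <-.
Qed.

(** A grid of [(N + 1)^k] boxes of side of order [1 / N] has total [s]-size of order
    [N ^ (k - s)]. *)
Lemma null_cover_cube k s B (E : set 'cV[R]_k) : 0 < s -> k%:R < s ->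
  (forall x, E x -> mle x B) -> null_cover s E.
Proof.
move=> s0 ks hE e e0; pose B' := Num.max B 1.
have B0 : 0 < B' by rewrite lt_max ltr01 orbT.
have sk : 0 < s - k%:R by rewrite subr_gt0.
pose c := 2 `^ k%:R * (2 * B') `^ s.
have c0 : 0 < c by rewrite mulr_gt0 ?powR_gt0 ?mulr_gt0.
pose N := (Num.trunc ((c / e) `^ (s - k%:R)^-1)).+1.
have N0 : 0 < N%:R :> R by rewrite ltr0n.
have hN : c * N%:R `^ (k%:R - s) <= e.
  rewrite -opprB powRN ler_pdivrMr ?powR_gt0// mulrC -ler_pdivrMr//.
  have ce : 0 <= c / e by rewrite divr_ge0 ?ltW.
  apply: (@le_trans _ _ (((c / e) `^ (s - k%:R)^-1) `^ (s - k%:R))).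
    by rewrite -powRrM mulVf ?gt_eqF// powRr1.
  by rewrite ge0_ler_powR ?nnegrE ?powR_ge0 ?(ltW sk) ?(ltW N0)// ltW// truncnS_gt.
pose h x : R := (x + B') * (N%:R / (2 * B')).
pose col (x : 'cV[R]_k) : {ffun 'I_k -> 'I_N.+1} := [ffun i => inord (Num.trunc (h (x i 0)))].
pose b := 2 * B' / N%:R.
have b0 : 0 < b by rewrite divr_gt0// mulr_gt0.
have hx x i : E x -> 0 <= h (x i 0) /\ h (x i 0) <= N%:R.
  move=> /hE/(_ i 0); rewrite ler_norml => /andP[h1 h2].
  have BB : B <= B' by rewrite le_max lexx.
  split; first by rewrite mulr_ge0 ?divr_ge0 ?mulr_ge0 ?(ltW B0)//; lra.
  rewrite /h mulrA ler_pdivrMr ?mulr_gt0// mulrC ler_wpM2l//; lra.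
apply: (countable_cover (T := {ffun 'I_k -> 'I_N.+1})) => //.
exists (fun f => [set x | E x /\ col x = f]), (fun=> b); split => //.
- by move=> x Ex; exists (col x).
- by move=> f; exact: ltW.
- move=> f x y [Ex <-] [Ey exy] i j; rewrite ord1 !mxE.
  have [x1 x2] := hx x i Ex; have [y1 y2] := hx y i Ey.
  have ti z : 0 <= h z -> h z <= N%:R -> (Num.trunc (h z) < N.+1)%N.
    by move=> z1 z2; rewrite truncn_lt_nat// (le_lt_trans z2)// ltr_nat.
  have := congr1 (fun f : {ffun 'I_k -> 'I_N.+1} => f i : nat) exy.
  rewrite !ffunE !inordK ?ti// => et.
  have /andP[a1 a2] := truncn_itv x1; have /andP[a3 a4] := truncn_itv y1.
  rewrite et in a3 a4; rewrite -natr1 in a2 a4.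
  have : `|h (x i 0) - h (y i 0)| <= 1 by rewrite ler_norml; lra.
  rewrite /h -mulrBl opprD addrACA subrr addr0 normrM.
  have q0 : 0 < N%:R / (2 * B') by rewrite divr_gt0// mulr_gt0.
  by rewrite (gtr0_norm q0) -ler_pdivlMr// mul1r invf_div.
move=> l ul; rewrite big_const_seq count_predT iter_addr_0.
have sl : (size l <= N.+1 ^ k)%N.
  have := max_card (mem l); rewrite (card_uniqP ul) card_ffun !card_ord; exact.
apply: le_trans hN; apply: (@le_trans _ _ (b `^ s *+ (N.+1 ^ k))).
  by rewrite ler_wpMn2l// powR_ge0.
rewrite -[leLHS]mulr_natl natrX /b powRM ?invr_ge0 ?mulr_ge0 ?(ltW B0) ?(ltW N0)//.
have -> : (N%:R^-1 : R) `^ s = N%:R `^ (- s).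
  by rewrite -powR_inv1 ?(ltW N0)// -powRrM mulN1r.
rewrite /c powRD ?(gt_eqF N0) ?implybT// [leRHS]mulrACA.
rewrite ler_wpM2r ?mulr_ge0 ?powR_ge0// -powRM ?(ltW N0)// powR_mulrn ?mulr_ge0 ?(ltW N0)//.
rewrite lerXn2r ?nnegrE ?mulr_ge0 ?(ltW N0)// -natr1 (_ : 2 * _ = N%:R + N%:R); last by ring.
by rewrite lerD2l ler1n.
Qed.

Lemma mass_distribution m (nu : probability (borelType (Sigma m)) R) k s K rho0
    (F : Sigma m -> 'cV[R]_k) (D : set (borelType (Sigma m))) : 0 < s ->
  measurable D -> 0 < Pr nu D -> 0 < rho0 -> 0 <= K ->
  (forall z rho, 0 < rho < rho0 -> exists Q : set (borelType (Sigma m)),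
    [/\ measurable Q, (forall x, D x -> mle (F x - z) rho -> Q x) &
        Pr nu Q <= K * rho `^ s]) ->
  ~ null_cover s (F @` D).
Proof.
move=> s0 mD D0 rho00 K0 hQ hnull.
have K1 : 0 < K + 1 by rewrite ltr_wpDl.
have r2 : 0 < rho0 / 2 by rewrite divr_gt0.
(* Small enough that the cover carries less than the mass of [D] and that all radii stay below
   [rho0]. *)
pose e := Num.min (Pr nu D / (4 * (K + 1))) ((rho0 / 2) `^ s).
have e0 : 0 < e by rewrite lt_min divr_gt0 ?mulr_gt0 ?powR_gt0.
have [U [b [EU b0 hU hb]]] := hnull _ e0.
have bs i : b i `^ s <= e.
  apply: le_trans (hb i.+1); rewrite big_ord_recr /= lerDr sumr_ge0// => j _.
  exact: powR_ge0.
have b2 i : b i <= rho0 / 2.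
  rewrite leNgt; apply/negP => h; have : (rho0 / 2) `^ s < b i `^ s.
    by rewrite gt0_ltr_powR// nnegrE ?(ltW r2).
  by rewrite ltNge (le_trans (bs i))// ge_min lexx orbT.
(* The mass bound requires a positive radius; sets with diameter bound 0 get one at a cost summable
   to [e]. *)
have hrho i : exists rho, [/\ 0 < rho, rho < rho0, b i <= rho &
    rho `^ s <= b i `^ s + e * 2^-1 ^+ i.+1].
  have q0 : 0 < e * 2^-1 ^+ i.+1 by rewrite mulr_gt0// exprn_gt0// invr_gt0.
  have := b0 i; rewrite le_eqVlt => /orP[/eqP bi|bi]; last first.
    exists (b i); split => //; last by rewrite lerDl ltW.
    by rewrite (le_lt_trans (b2 i))// ltr_pdivrMr// ltr_pMr// ltr1n.
  exists (Num.min (rho0 / 2) ((e * 2^-1 ^+ i.+1) `^ s^-1)); split.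
  - by rewrite lt_min r2 powR_gt0.
  - by rewrite gt_min ltr_pdivrMr// ltr_pMr// ltr1n.
  - by rewrite -bi le_min (ltW r2) powR_ge0.
  apply: (@le_trans _ _ (((e * 2^-1 ^+ i.+1) `^ s^-1) `^ s)).
    by rewrite ge0_ler_powR ?nnegrE ?(ltW s0) ?powR_ge0 ?le_min ?(ltW r2) ?powR_ge0// ge_min lexx orbT.
  by rewrite -powRrM mulVf ?gt_eqF// powRr1 ?(ltW q0)// lerDr powR_ge0.
have [rho hr] := choice hrho.
have hq i : exists Q : set (borelType (Sigma m)), [/\ measurable Q,
    (forall x, D x -> U i (F x) -> Q x) & Pr nu Q <= K * rho i `^ s].
  have [r0 r1 r2' r3] := hr i.
  have [[y Uy]|nU] := pselect (exists y, U i y).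
    have [|Q [mQ Qx PQ]] := hQ y (rho i); first by rewrite r0.
    exists Q; split => // x Dx Ux; apply: Qx => //; apply: mle_le r2' _; exact: hU.
  exists set0; split; [exact: measurable0|by move=> x _ Ux; apply: nU; exists (F x)|].
  by rewrite Pr0 mulr_ge0 ?powR_ge0.
have [Q hQi] := choice hq.
have mQ i : measurable (Q i) by have [] := hQi i.
have : Pr nu D <= K * (2 * e).
  apply: (@le_trans _ _ (Pr nu (\bigcup_i Q i))).
    apply: Pr_le => //; first exact: bigcupT_measurable.
    move=> x Dx; have [i _ Ux] := EU (F x) (ex_intro2 _ _ x Dx erefl).
    by exists i => //; have [_ h _] := hQi i; exact: h.
  apply: Pr_bigcup_le => // N.
  apply: (@le_trans _ _ (\sum_(i < N) K * (b i `^ s + e * 2^-1 ^+ i.+1))).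
    apply: ler_sum => i _; have [_ _ h] := hQi i; apply: (le_trans h).
    by rewrite ler_wpM2l//; have [] := hr i.
  rewrite -mulr_sumr ler_wpM2l// big_split /= (_ : 2 * e = e + e); last by ring.
  rewrite lerD ?hb// -mulr_sumr ler_piMr ?(ltW e0)//.
  case: N => [|N]; first by rewrite big_ord0.
  under eq_bigr do rewrite exprS; rewrite -mulr_sumr.
  rewrite -[leRHS](@mulVf _ (2 : R)) ?pnatr_eq0// ler_wpM2l ?invr_ge0//.
  by have := @sum_geometric_half R 0 N; rewrite expr0 mulr1.
apply/negP; rewrite -ltNge.
apply: (@le_lt_trans _ _ (K * (2 * (Pr nu D / (4 * (K + 1)))))).
  by rewrite ler_wpM2l// ler_wpM2l// ge_min lexx.
rewrite (_ : K * _ = Pr nu D * (K / (2 * (K + 1)))); last by field; rewrite gt_eqF.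
rewrite gtr_pMr// ltr_pdivrMr ?mulr_gt0// mul1r; lra.
Qed.

Lemma le_dimH n (E : set 'cV[R]_n) (c : \bar R) :
  (forall s, 0 < s -> null_cover s E -> (c <= s%:E)%E) -> (c <= dimH E)%E.
Proof.
move=> h; apply: le_ereal_inf_tmp => _ [s [s0 hs] <-]; apply: h => //.
exact: hausdorff_null_cover.
Qed.

Lemma dimH_le n (E : set 'cV[R]_n) s : 0 < s -> null_cover s E -> (dimH E <= s%:E)%E.
Proof.
by move=> s0 h; apply: ereal_inf_lbound; exists s => //; split => //; exact: null_cover_hausdorff.
Qed.

End NullCoverTheory.

(** * The Grassmannian *)

Section LinearAlgebra.
Context {R : realType}.

(** A vector killed by [X] is fixed by [1 - X], which strictly decreases its largest entry. *)
Lemma near_id_unit k (X : 'M[R]_k) delta : mle (X - 1%:M) delta ->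
  k%:R * delta < 1 -> X \in unitmx.
Proof.
move=> hX kd; rewrite -row_free_unit -kermx_eq0; apply/negPn/negP => /rowV0Pn[v].
move=> /sub_kermxP vX v0.
have vE : v = - (v *m (X - 1%:M)) by rewrite mulmxBr vX mulmx1 sub0r opprK.
have [j vj] : exists j, v 0 j != 0.
  apply: contrapT => /forallNP h; move/eqP: v0; apply; apply/rowP => j.
  by rewrite mxE; apply: contrapT => /eqP; exact: h.
case: (@arg_maxP _ R _ j predT (fun i => `|v 0 i|) isT) => j' _ j'max.
have v0' : 0 < `|v 0 j'| by apply: lt_le_trans (j'max j isT); rewrite normr_gt0.
have hv : mle v `|v 0 j'| by move=> i l; rewrite ord1; exact: j'max.
have e : v 0 j' = - (v *m (X - 1%:M)) 0 j' by rewrite [in LHS]vE [LHS]mxE.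
have := mleM (ltW v0') hv hX => /(_ 0 j'); rewrite -normrN -e.
by rewrite mulrCA; apply/negP; rewrite -ltNge gtr_pMr.
Qed.

Lemma row_dot_gt0 d (v : 'rV[R]_d) : v != 0 -> 0 < (v *m v^T) 0 0.
Proof.
move=> v0; rewrite mxE lt_neqAle sumr_ge0 => [|i _]; last by rewrite mxE -expr2 sqr_ge0.
rewrite andbT eq_sym psumr_eq0 => [|i _]; last by rewrite mxE -expr2 sqr_ge0.
apply: contra v0 => /allP h; apply/eqP/rowP => i; rewrite mxE.
by have := h i (mem_index_enum i); rewrite mxE -expr2 sqrf_eq0 => /eqP.
Qed.

Lemma gram_schmidt k d (q : 'M[R]_(k, d)) : row_free q ->
  exists p : 'M[R]_(k, d), p *m p^T = 1%:M /\ (q <= p)%MS.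
Proof.
elim: k q => [|k IH] q hq.
  by exists 0; split; [apply/matrixP => -[]|rewrite flatmx0 sub0mx].
rewrite -[k.+1]/(1 + k)%N in q hq *.
pose q1 := usubmx q; pose q2 := dsubmx q.
have qE : q = col_mx q1 q2 by rewrite vsubmxK.
have inj (v1 : 'M[R]_1) (v2 : 'rV[R]_k) : v1 *m q1 + v2 *m q2 = 0 -> v1 = 0 /\ v2 = 0.
  rewrite -mul_row_col -qE => h; have : row_mx v1 v2 = 0.
    by apply: (row_free_inj hq); rewrite h mul0mx.
  by rewrite -[0 in RHS]row_mx0 => /eq_row_mx.
have hq2 : row_free q2.
  rewrite -kermx_eq0; apply/negPn/negP => /rowV0Pn[v /sub_kermxP vq v0].
  have [|_ /eqP] := inj 0 v; first by rewrite mul0mx add0r.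
  by apply/negP.
have [p2 [hp2 q2p2]] := IH _ hq2.
pose v := q1 - q1 *m p2^T *m p2.
have vp2 : v *m p2^T = 0 by rewrite mulmxBl -(mulmxA (q1 *m p2^T)) hp2 mulmx1 subrr.
have v0 : v != 0.
  apply/eqP => v0; have q1p2 : (q1 <= p2)%MS.
    by move/eqP: v0; rewrite subr_eq0 => /eqP ->; exact: submxMl.
  have qp2 : (q <= p2)%MS by rewrite qE col_mx_sub q1p2.
  have := mxrankS qp2; move: hq; rewrite /row_free => /eqP ->.
  by move=> /leq_trans/(_ (rank_leq_row _)); rewrite ltnn.
have vv := row_dot_gt0 v0; pose n := (v *m v^T) 0 0; rewrite -/n in vv.
have vvE : v *m v^T = n%:M by rewrite {1}[v *m _]mx11_scalar.
pose p1 := (Num.sqrt n)^-1 *: v.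
have sn : Num.sqrt n != 0 by rewrite gt_eqF// sqrtr_gt0.
have p11 : p1 *m p1^T = 1%:M.
  rewrite /p1 linearZ /= -scalemxAl -scalemxAr scalerA vvE scale_scalar_mx -invfM -expr2.
  by rewrite sqr_sqrtr ?ltW// mulVf ?gt_eqF.
have p12 : p1 *m p2^T = 0 by rewrite /p1 -scalemxAl vp2 scaler0.
exists (col_mx p1 p2); split.
  rewrite tr_col_mx mul_col_row p11 p12 hp2.
  have -> : p2 *m p1^T = 0 by rewrite -[LHS]trmxK trmx_mul trmxK p12 trmx0.
  by rewrite -scalar_mx_block.
have p1s : (p1 <= col_mx p1 p2)%MS by rewrite -addsmxE addsmxSl.
have p2s : (p2 <= col_mx p1 p2)%MS by rewrite -addsmxE addsmxSr.
rewrite {1}qE col_mx_sub (submx_trans q2p2 p2s) andbT.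
have -> : q1 = Num.sqrt n *: p1 + q1 *m p2^T *m p2.
  by rewrite /p1 scalerA divff// scale1r /v subrK.
by apply: addmx_sub; [exact: scalemx_sub|exact: submx_trans (submxMl _ _) p2s].
Qed.

Lemma orthonormal_factor k d (q : 'M[R]_(k, d)) : row_free q ->
  exists (M : 'M[R]_k) (p : 'M[R]_(k, d)),
    [/\ M \in unitmx, orth_projection p & q = M *m p].
Proof.
move=> hq; have [p [hp /submxP[M qM]]] := gram_schmidt hq.
exists M, p; split => //; rewrite -row_free_unit -kermx_eq0.
apply/negPn/negP => /rowV0Pn[v /sub_kermxP vM]; apply/negP/negPn/eqP.
by apply: (row_free_inj hq); rewrite mul0mx qM mulmxA vM mul0mx.
Qed.

End LinearAlgebra.

Section GrassmannMetric.
Context {R : realType} {k d : nat}.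
Implicit Types (p q : 'M[R]_(k, d)) (O : 'M[R]_d).

Definition near_gr e p q := mle (grassmann_pt p - grassmann_pt q) e.

Lemma near_gr_sym e p q : near_gr e p q -> near_gr e q p.
Proof. exact: mleBC. Qed.

Lemma near_gr_tri e f p q s : near_gr e p q -> near_gr f q s -> near_gr (e + f) p s.
Proof. exact: mle_tri. Qed.

Lemma near_gr_le e f p q : e <= f -> near_gr e p q -> near_gr f p q.
Proof. exact: mle_le. Qed.

Lemma grassmann_ptM p O : grassmann_pt (p *m O) = O^T *m grassmann_pt p *m O.
Proof. by rewrite /grassmann_pt trmx_mul !mulmxA. Qed.

Lemma near_grM e p q O : orthogonal_mx O -> near_gr e p q ->
  near_gr (d%:R ^+ 2 * e) (p *m O) (q *m O).
Proof.
move=> hO h; rewrite /near_gr !grassmann_ptM -mulmxBl -mulmxBr.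
have h1 := orthogonal_mulmx_mle (orthogonal_mxT hO) h.
have := orthogonal_mulmx_mle (orthogonal_mxT hO) (mleT h1).
rewrite -trmx_mul => /mleT; rewrite trmxK; apply: mle_le.
by rewrite mulrA expr2.
Qed.

Lemma orth_projection_mle p : orth_projection p -> mle p 1.
Proof. exact: orthogonal_rows_mle. Qed.

Lemma orth_projectionM p O : orth_projection p -> orthogonal_mx O ->
  orth_projection (p *m O).
Proof.
move=> hp hO; rewrite /orth_projection trmx_mul mulmxA -(mulmxA p).
by rewrite orthogonal_mxV// mulmx1.
Qed.

Lemma near_gr_mle p q e : 0 <= e -> orth_projection p -> orth_projection q ->
  mle (p - q) e -> near_gr (2 * k%:R * e) p q.
Proof.
move=> e0 hp hq h.
have -> : 2 * k%:R * e = k%:R * (e * 1) + k%:R * (1 * e) by ring.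
rewrite /near_gr /grassmann_pt.
have -> : p^T *m p - q^T *m q = (p - q)^T *m p + q^T *m (p - q).
  by rewrite linearB /= mulmxBl mulmxBr addrA subrK.
apply: mleD; apply: mleM => //; first exact: mleT.
- exact: orth_projection_mle.
- exact/mleT/orth_projection_mle.
Qed.

End GrassmannMetric.

Section Reflections.
Context {R : realType} {d : nat}.
Implicit Types (u v w : 'rV[R]_d).

Definition dot u v : R := (u *m v^T) 0 0.

Lemma dotC u v : dot u v = dot v u.
Proof. by rewrite /dot -[u in LHS]trmxK -trmx_mul mxE. Qed.

Lemma dotDl u v w : dot (u + v) w = dot u w + dot v w.
Proof. by rewrite /dot mulmxDl mxE. Qed.

Lemma dotZl a u v : dot (a *: u) v = a * dot u v.
Proof. by rewrite /dot -scalemxAl mxE. Qed.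

Lemma dotNl u v : dot (- u) v = - dot u v.
Proof. by rewrite /dot mulNmx mxE. Qed.

Lemma dotDr u v w : dot w (u + v) = dot w u + dot w v.
Proof. by rewrite dotC dotDl !(dotC _ w). Qed.

Lemma dotZr a u v : dot v (a *: u) = a * dot v u.
Proof. by rewrite dotC dotZl dotC. Qed.

Lemma dotNr u v : dot v (- u) = - dot v u.
Proof. by rewrite dotC dotNl dotC. Qed.

Lemma dotE u v : dot u v = \sum_i u 0 i * v 0 i.
Proof. by rewrite /dot mxE; apply: eq_bigr => i _; rewrite mxE. Qed.

Lemma mulmx_dot u v : u *m v^T = (dot u v)%:M.
Proof. exact: mx11_scalar. Qed.

Lemma unit_row_mle v : dot v v = 1 -> mle v 1.
Proof.
move=> hv; apply: orthogonal_rows_mle; by rewrite mulmx_dot hv.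
Qed.

Lemma normalize v : v != 0 -> exists2 c : R, c != 0 & dot (c *: v) (c *: v) = 1.
Proof.
move=> /row_dot_gt0; rewrite -/(dot v v) => n0; exists (Num.sqrt (dot v v))^-1.
  by rewrite invr_eq0 gt_eqF// sqrtr_gt0.
by rewrite dotZl dotZr mulrA -invfM -expr2 sqr_sqrtr ?(ltW n0)// mulVf ?gt_eqF.
Qed.

Definition reflection v : 'M[R]_d := 1%:M - (2 / dot v v) *: (v^T *m v).

Lemma reflectionZ c v : c != 0 -> reflection (c *: v) = reflection v.
Proof.
move=> c0; rewrite /reflection dotZl dotZr [(c *: v)^T]linearZ /= -[(_ *: _) *m _]scalemxAl -scalemxAr !scalerA.
congr (_ - _ *: _); have [->|n0] := eqVneq (dot v v) 0; first by rewrite !mulr0 invr0 mulr0 !mul0r.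
by field; rewrite n0 c0.
Qed.

Lemma reflection_orth v : v != 0 -> orthogonal_mx (reflection v).
Proof.
move=> /row_dot_gt0; rewrite -/(dot v v) => n0; rewrite /orthogonal_mx /reflection.
have E : (v^T *m v) *m (v^T *m v) = dot v v *: (v^T *m v).
  by rewrite -mulmxA (mulmxA v) mulmx_dot mul_scalar_mx scalemxAr.
have -> : (1%:M - (2 / dot v v) *: (v^T *m v))^T = 1%:M - (2 / dot v v) *: (v^T *m v).
  by rewrite linearB /= trmx1 linearZ /= trmx_mul trmxK.
rewrite mulmxBl mul1mx mulmxBr mulmx1 -scalemxAl -scalemxAr E !scalerA.
have -> : 2 / dot v v * (2 / dot v v) * dot v v = 2 / dot v v + 2 / dot v v.
  by field; rewrite gt_eqF.
by rewrite scalerDl opprB addrK subrK.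
Qed.

Lemma mulmx_reflection k (p : 'M[R]_(k, d)) v :
  p *m reflection v = p - (2 / dot v v) *: (p *m v^T *m v).
Proof. by rewrite /reflection mulmxBr mulmx1 -scalemxAr mulmxA. Qed.

Lemma reflection_lip v w e : 0 <= e -> mle v 1 -> mle w 1 ->
  2^-1 <= dot v v -> 2^-1 <= dot w w -> mle (v - w) e ->
  mle (reflection v - reflection w) ((8 + 16 * d%:R) * e).
Proof.
move=> e0 hv hw nv nw h.
have pr i j : `|v 0 i * v 0 j - w 0 i * w 0 j| <= 2 * e.
  have -> : v 0 i * v 0 j - w 0 i * w 0 j =
     (v - w) 0 i * v 0 j + w 0 i * (v - w) 0 j by rewrite !mxE; ring.
  rewrite (le_trans (ler_normD _ _))// [2 * e]mulrDl mul1r !normrM.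
  by apply: lerD; [rewrite -[leRHS]mulr1|rewrite -[leRHS]mul1r]; apply: ler_pM.
have hn : `|dot w w - dot v v| <= d%:R * (2 * e).
  rewrite !dotE -sumrB (le_trans (ler_norm_sum _ _ _))//.
  rewrite mulr_natl -[d in leRHS]card_ord -sumr_const; apply: ler_sum => i _.
  by rewrite distrC.
move=> i j; rewrite !mxE.
have -> : \sum_j0 v^T i j0 * v j0 j = v 0 i * v 0 j by rewrite big_ord1 mxE.
have -> : \sum_j0 w^T i j0 * w j0 j = w 0 i * w 0 j by rewrite big_ord1 mxE.
set a := v 0 i * v 0 j; set b := w 0 i * w 0 j.
set x := dot v v in nv hn *; set y := dot w w in nw hn *.
have x0 : 0 < x by apply: lt_le_trans nv; rewrite invr_gt0.
have y0 : 0 < y by apply: lt_le_trans nw; rewrite invr_gt0.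
have xi : x^-1 <= 2 by rewrite -[2]invrK lef_pV2 ?posrE// invr_gt0.
have yi : y^-1 <= 2 by rewrite -[2]invrK lef_pV2 ?posrE// invr_gt0.
rewrite [X in `|X|](_ : _ = - (2 * (a * ((y - x) * (x^-1 * y^-1)) + (a - b) * y^-1))); last first.
  by field; rewrite !gt_eqF.
rewrite normrN normrM ger0_norm//.
have -> : (8 + 16 * d%:R) * e = 2 * (1 * ((d%:R * (2 * e)) * (2 * 2)) + 2 * e * 2) by ring.
rewrite ler_wpM2l// (le_trans (ler_normD _ _))// lerD// normrM.
  have a1 : `|a| <= 1 by rewrite normrM mulr_ile1.
  apply: ler_pM => //; rewrite normrM; apply: ler_pM => //.
  by rewrite gtr0_norm ?mulr_gt0 ?invr_gt0// ler_pM// invr_ge0 ltW.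
by apply: ler_pM => //; [exact: pr|rewrite gtr0_norm ?invr_gt0].
Qed.

End Reflections.

(** * Connectedness of the Grassmannian through chains of short steps *)

Section GrassmannConnected.
Context {R : realType} {k d : nat}.
Hypothesis kd : (k < d)%N.
Variables (X : 'M[R]_(k, d) -> Prop) (e : R).
Hypotheses (e0 : 0 < e)
  (step : forall p q, orth_projection p -> orth_projection q -> X p -> near_gr e p q -> X q).

Lemma orth_complement (p : 'M[R]_(k, d)) : exists2 w : 'rV[R]_d, dot w w = 1 & p *m w^T = 0.
Proof.
have : kermx p^T != 0.
  rewrite kermx_eq0 /row_free mxrank_tr neq_ltn (leq_ltn_trans (rank_leq_row _))//.
move=> /rowV0Pn[v /sub_kermxP vp v0]; have [c c0 hc] := normalize v0.
exists (c *: v) => //; rewrite linearZ /= -scalemxAr -[p *m _]trmxK trmx_mul trmxK vp.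
by rewrite trmx0 scaler0.
Qed.

(* Joins [p] to [p *m reflection u] by reflections in vectors running along a
   segment from a unit vector orthogonal to the rows of [p] to [u]. *)
Lemma grassmann_reflection p u : orth_projection p -> dot u u = 1 -> X p ->
  X (p *m reflection u).
Proof.
move=> hp hu Xp.
have [w [hw pw uw]] : exists w : 'rV[R]_d, [/\ dot w w = 1, p *m w^T = 0 & 0 <= dot u w].
  have [w hw pw] := orth_complement p.
  have [uw|uw] := leP 0 (dot u w); first by exists w.
  exists (- w); split; first by rewrite dotNl dotNr opprK.
    by rewrite linearN /= mulmxN pw oppr0.
  by rewrite dotNr oppr_ge0 ltW.
pose v (t : R) := (1 - t) *: w + t *: u.
(* The sign of [w] was chosen to keep the segment away from 0: the squared norm of [v t] is at least
   [t^2 + (1 - t)^2]. *)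
have v12 t : 0 <= t <= 1 -> 2^-1 <= dot (v t) (v t).
  move=> /andP[t0 t1]; rewrite /v !(dotDl, dotDr, dotZl, dotZr) hu hw (dotC w).
  have h : 0 <= t * (1 - t) * dot u w by rewrite !mulr_ge0// subr_ge0.
  have := sqr_ge0 (t - 2^-1); rewrite expr2 => ?.
  have : (t - 2^-1) * (t - 2^-1) = t * t - t + 4^-1 by field.
  by nra.
have vne t : 0 <= t <= 1 -> v t != 0.
  move=> /v12 h; apply/eqP => vt0; move: h; rewrite vt0 /dot mul0mx mxE leNgt.
  by rewrite invr_gt0 ltr0n.
have vm t : 0 <= t <= 1 -> mle (v t) 1.
  move=> /andP[t0 t1] i j; rewrite !mxE (le_trans (ler_normD _ _))// !normrM.
  rewrite (ger0_norm t0) ger0_norm ?subr_ge0//.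
  rewrite [leRHS](_ : _ = (1 - t) * 1 + t * 1); last by ring.
  by rewrite lerD// ler_wpM2l ?subr_ge0//; apply: unit_row_mle.
pose B : R := 2 * k%:R * (d%:R * (1 * ((8 + 16 * d%:R) * 2))) + 1.
have B0 : 0 < B by rewrite ltr_wpDl// !mulr_ge0// addr_ge0// mulr_ge0.
pose N := (Num.trunc (B / e)).+1.
have NB : B / e <= N%:R by rewrite ltW// truncnS_gt// ltW// divr_gt0.
have N0 : 0 < N%:R :> R by rewrite ltr0n.
have tI i : (i <= N)%N -> 0 <= (i%:R / N%:R : R) <= 1.
  by move=> iN; rewrite divr_ge0//= ler_pdivrMr// mul1r ler_nat.
have Op i : (i <= N)%N -> orth_projection (p *m reflection (v (i%:R / N%:R))).
  by move=> /tI/vne/reflection_orth h; exact: orth_projectionM.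
have Xi i : (i <= N)%N -> X (p *m reflection (v (i%:R / N%:R))).
  elim: i => [_|i IH iN].
    by rewrite /v mul0r subr0 scale1r scale0r addr0 mulmx_reflection pw mul0mx scaler0 subr0.
  have iN' := ltnW iN; apply: step (IH iN') _ => //; try exact: Op.
  pose f : R := 2 / N%:R; have f0 : 0 <= f by rewrite divr_ge0.
  have vv : mle (v (i%:R / N%:R) - v (i.+1%:R / N%:R)) f.
    have -> : v (i%:R / N%:R) - v (i.+1%:R / N%:R) = N%:R^-1 *: (w - u).
      apply/rowP => j; rewrite !mxE -(natr1 i); by field; rewrite gt_eqF.
    move=> a b; rewrite !mxE normrM ger0_norm ?invr_ge0 ?ler0n// mulrC.
    rewrite ler_pM2r ?invr_gt0// (le_trans (ler_normB _ _))//.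
    by rewrite [leRHS](_ : 2 = 1 + 1)// lerD//; exact: unit_row_mle.
  have RR := reflection_lip f0 (vm _ (tI _ iN')) (vm _ (tI _ iN)) (v12 _ (tI _ iN')) (v12 _ (tI _ iN)) vv.
  have PR := mleM ler01 (orth_projection_mle hp) RR; rewrite mulmxBr in PR.
  have PG := near_gr_mle _ (Op _ iN') (Op _ iN) PR.
  apply: near_gr_le (PG _); last by rewrite !mulr_ge0// addr_ge0// mulr_ge0.
  apply: (@le_trans _ _ (B / N%:R)); last by rewrite ler_pdivrMr// mulrC -ler_pdivrMr.
  rewrite /f !mulrA ler_pM2r ?invr_gt0// /B.
  by rewrite !mulrA lerDl.
have := Xi N (leqnn _); by rewrite divff ?gt_eqF// /v subrr scale0r add0r scale1r.
Qed.

Lemma grassmann_connected p q : orth_projection p -> orth_projection q -> X p -> X q.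
Proof.
move=> hp hq Xp.
suff /(_ k (leqnn k))[q' [_ Xq' qq']] : forall l, (l <= k)%N -> exists q', [/\ orth_projection q', X q' &
    forall i : 'I_k, (i < l)%N -> row i q' = row i q].
  by have <- : q' = q by apply/row_matrixP => i; apply: qq'.
have rowdot (s : 'M[R]_(k, d)) (i j : 'I_k) : orth_projection s -> dot (row i s) (row j s) = (i == j)%:R.
  move=> /matrixP/(_ i j); rewrite !mxE => <-; rewrite dotE.
  by apply: eq_bigr => a _; rewrite !mxE.
elim=> [_|l IH lk]; first by exists p.
have [q' [hq' Xq' qq']] := IH (ltnW lk).
pose lo := Ordinal lk; pose u := row lo q' - row lo q.
have ltS (i : 'I_k) : (i < l.+1)%N -> i <> lo -> (i < l)%N.
  by rewrite ltnS leq_eqVlt => /orP[/eqP il|//] []; exact: val_inj.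
have [u0|u0] := eqVneq u 0.
  exists q'; split => // i il; have [->|/eqP ilo] := eqVneq i lo.
    by apply/eqP; rewrite -subr_eq0; apply/eqP.
  exact/qq'/ltS.
have [c c0 cu] := normalize u0.
exists (q' *m reflection (c *: u)); split.
- by apply: orth_projectionM => //; apply: reflection_orth; rewrite scaler_eq0 negb_or c0.
- exact: grassmann_reflection.
move=> i il; rewrite row_mul reflectionZ// mulmx_reflection mulmx_dot mul_scalar_mx scalerA.
have n0 : dot u u != 0 by rewrite gt_eqF// row_dot_gt0.
have uu : dot u u = 2 * dot (row lo q') u.
  rewrite {1}/u /u !(dotDl, dotDr, dotNl, dotNr) !rowdot// eqxx (dotC (row lo q)); ring.
have [->|/eqP ilo] := eqVneq i lo.
  have -> : 2 / dot u u * dot (row lo q') u = 1 by rewrite mulrAC -uu divff.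
  by rewrite scale1r /u opprB addrC subrK.
have il' := ltS _ il ilo.
have -> : dot (row i q') u = 0.
  by rewrite /u dotDr dotNr rowdot// qq'// rowdot// subrr.
by rewrite mulr0 scale0r subr0 qq'.
Qed.

End GrassmannConnected.

(** * Reachable directions *)

Section NearGr.
Context {R : realType} {k d : nat}.
Implicit Types (p q : 'M[R]_(k, d)) (O : 'M[R]_d).

Definition gr_dist : R := d%:R ^+ 2 + 1.

Lemma gr_dist_gt0 : 0 < gr_dist.
Proof. by rewrite /gr_dist ltr_wpDl// exprn_ge0. Qed.

Lemma near_gr_mulmx f p q O : 0 <= f -> orthogonal_mx O -> near_gr f p q ->
  near_gr (gr_dist * f) (p *m O) (q *m O).
Proof.
move=> f0 hO h; apply: near_gr_le (near_grM hO h).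
by rewrite ler_wpM2r// /gr_dist lerDl.
Qed.

Lemma near_gr_refl f p : 0 <= f -> near_gr f p p.
Proof. by rewrite /near_gr subrr => f0 i j; rewrite mxE normr0. Qed.

(** Either the first closed set contains the ball of half radius, or some smaller ball misses it and
    is covered by the remaining sets. *)
Lemma baire_finite (T : eqType) (P : T -> 'M[R]_(k, d) -> Prop) (cs : seq T) q f :
  (forall c q', orth_projection q' ->
    (forall eps, 0 < eps -> exists q'', [/\ orth_projection q'', near_gr eps q'' q' & P c q'']) ->
    P c q') ->
  orth_projection q -> 0 < f ->
  (forall s, orth_projection s -> near_gr f q s -> exists2 c, c \in cs & P c s) ->
  exists c q' f', [/\ orth_projection q', 0 < f' &
    forall s, orth_projection s -> near_gr f' q' s -> P c s].
Proof.
move=> closed; elim: cs q f => [|c cs IH] q f hq f0 cov.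
  by have [|c] := cov q hq; first exact/near_gr_refl/ltW.
have f20 : 0 < f / 2 by rewrite divr_gt0.
have [all_c|] := pselect (forall s, orth_projection s -> near_gr (f / 2) q s -> P c s).
  by exists c, q, (f / 2).
move=> /existsNP[s /not_implyP[hs /not_implyP[qs nPs]]].
have [eps [eps0 heps]] : exists eps, 0 < eps /\
    forall s', orth_projection s' -> near_gr eps s s' -> ~ P c s'.
  apply: contrapT => /forallNP h; apply/nPs/(closed _ _ hs) => eps eps0.
  apply: contrapT => /forallNP h'; apply: (h eps); split => // s' hs' ss' Ps'.
  by apply: (h' s'); split => //; apply: near_gr_sym.
have me : 0 < Num.min eps (f / 2) by rewrite lt_min eps0.
apply: (IH s _ hs me) => s' hs' ss'.
have [|c' ] := cov s' hs'.
  rewrite [f]splitr; apply: near_gr_tri qs (near_gr_le _ ss').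
  by rewrite ge_min lexx orbT.
rewrite inE => /orP[/eqP ->|c'cs Pc']; last by exists c'.
by move=> /heps; case => //; apply: near_gr_le ss'; rewrite ge_min lexx.
Qed.

End NearGr.

Section Reachable.
Context {R : realType} {d m k : nat}.
Local Notation I := 'I_m.+1.
Context (O : I -> 'M[R]_d) (e : rel I).
Hypothesis hO : forall i, orthogonal_mx (O i).
Local Notation OO := (OO O).
Local Notation D := (@gr_dist R d).

(* [w] is read from the letter [i] (included) to the letter [j] (excluded). *)
Definition transfer i j (w : seq I) := (head j w == i) && sorted e (rcons w j).

Lemma transfer_nil i : transfer i i [::].
Proof. by rewrite /transfer eqxx. Qed.

Lemma transfer_cat i j l u v : transfer i j u -> transfer j l v -> transfer i l (u ++ v).
Proof.
move=> /andP[/eqP hu su] /andP[/eqP hv sv].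
case: u hu su => [|a u] /= <-; first by move=> _; rewrite /transfer hv eqxx sv.
rewrite /transfer rcons_path => /andP[su uj].
rewrite /= eqxx /= rcons_cat cat_path su /=.
by case: v hv sv => [|b v] /= ->; rewrite ?uj ?andbT//= uj.
Qed.

Hypothesis irr : forall i j, exists2 u, transfer i j u & (0 < size u)%N.

Let succ i : exists j, e i j.
Proof.
have [[|a [|b u]]// ] := irr i i; first by rewrite /transfer /= andbT => /andP[/eqP -> h]; exists i.
by rewrite /transfer /= => /andP[/eqP -> /andP[h _]]; exists b.
Qed.

Let OOo w : orthogonal_mx (OO w).
Proof.
elim: w => [|i w IH] /=; first exact: orthogonal_mx1.
by apply: orthogonal_mxM => //; apply: hO.
Qed.

Hypothesis kd : (k < d)%N.
Hypothesis minimal : forall p q : 'M[R]_(k, d), orth_projection p -> orth_projection q ->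
  forall eps, 0 < eps -> exists2 u, sorted e u & near_gr eps (p *m OO u) q.

Let D0 : 0 < D. Proof. exact: gr_dist_gt0. Qed.

Section Arrow.
Variable a : I.

(* Recurrence makes this closed preorder symmetric; its classes are the orbit
   closures of the group generated by the loops at [a]. *)
Definition arrow (p q : 'M[R]_(k, d)) := forall eps, 0 < eps ->
  exists2 u, transfer a a u & near_gr eps (p *m OO u) q.

Lemma arrow_trans p q s : arrow p q -> arrow q s -> arrow p s.
Proof.
move=> pq qs eps eps0; have e2 : 0 < eps / 2 by rewrite divr_gt0.
have [v hv qv] := qs _ e2; have [|u hu pu] := pq (eps / 2 / D); first by rewrite divr_gt0.
exists (u ++ v); first exact: transfer_cat hu hv.
rewrite [eps]splitr; apply: near_gr_tri qv; rewrite OO_cat mulmxA.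
have := near_gr_mulmx (ltW _) (OOo v) pu; rewrite mulrCA divff ?gt_eqF// mulr1.
by apply; rewrite divr_gt0.
Qed.

Lemma transfer_pow u n : transfer a a u -> transfer a a (flatten (nseq n u)).
Proof.
move=> hu; elim: n => [|n IH]; first exact: transfer_nil.
exact: transfer_cat hu IH.
Qed.

(* The powers of [OO u] come arbitrarily close to [1]. *)
Lemma loop_recurrence u (p : 'M[R]_(k, d)) eps : transfer a a u -> orth_projection p -> 0 < eps ->
  exists2 v, transfer a a v & near_gr eps (p *m OO u *m OO v) p.
Proof.
move=> hu hp eps0; pose W n := OO (flatten (nseq n u)).
have WD n l : W (n + l)%N = W n *m W l by rewrite /W nseqD flatten_cat OO_cat.
pose del := eps / (2 * k%:R * (d%:R * (1 * d%:R)) + 1).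
have c1 : 0 < 2 * k%:R * (d%:R * (1 * d%:R)) + 1 :> R by rewrite ltr_wpDl// !mulr_ge0.
have del0 : 0 < del by rewrite divr_gt0.
have [T [col hcol]] := @finite_colouring R d d 1 _ del0.
have [x hx] := infinite_pigeonhole (fun n => col (W n)).
have [n _ cn] := hx 0%N; have [l nl cl] := hx n.+1.
exists (flatten (nseq (l - n.+1) u)); first exact: transfer_pow.
have lE : l = (n + (1 + (l - n.+1)))%N by rewrite addnA addn1 subnKC.
have close : mle (W l - W n) del.
  by apply: hcol; rewrite ?cn ?cl//; apply/orthogonal_mle/OOo.
have W1 : mle (W (1 + (l - n.+1))%N - 1%:M) (d%:R * del).
  apply: (@orthogonal_mulmx_mle_inv _ _ _ (W n)); first exact: OOo.
  by move: close; rewrite {1}lE WD mulmxBr mulmx1.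
rewrite -mulmxA -OO_cat; have -> : u ++ flatten (nseq (l - n.+1) u) = flatten (nseq (1 + (l - n.+1)) u) by [].
rewrite -/(W _); have W1' := mleM ler01 (orth_projection_mle hp) W1.
rewrite mulmxBr mulmx1 in W1'.
have dd : 0 <= d%:R * (1 * (d%:R * del)) :> R by rewrite !mulr_ge0// ltW.
have hpW : orth_projection (p *m W (1 + (l - n.+1))%N) := orth_projectionM hp (OOo _).
apply: near_gr_le (near_gr_mle dd hpW hp W1').
rewrite [leLHS](_ : _ = (2 * k%:R * (d%:R * (1 * d%:R))) * del); last by ring.
by rewrite /del mulrCA ger_pMr// ler_pdivrMr// [leRHS]mul1r lerDl.
Qed.

Lemma arrow_sym p q : orth_projection p -> arrow p q -> arrow q p.
Proof.
move=> hp pq eps eps0; have e2 : 0 < eps / 2 by rewrite divr_gt0.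
have [|u hu pu] := pq (eps / 2 / D); first by rewrite divr_gt0.
have [v hv uv] := loop_recurrence hu hp e2; exists v => //.
rewrite [eps]splitr; apply: near_gr_tri uv; apply: near_gr_sym.
have := near_gr_mulmx (ltW _) (OOo v) pu; rewrite mulrCA divff ?gt_eqF// mulr1.
by apply; rewrite divr_gt0.
Qed.

Lemma arrow_loop p u : transfer a a u -> arrow p (p *m OO u).
Proof. by move=> hu eps eps0; exists u => //; apply/near_gr_refl/ltW. Qed.

(** For each pair of letters the limits of [p *m OO u] over words from the first to the second form
    a closed set, and by minimality these finitely many sets cover everything. One has interior;
    adding fixed words at both ends turns its words into loops at [a]. *)
Lemma arrow_class_open : exists q f, [/\ orth_projection q, 0 < f &
  forall s : 'M[R]_(k, d), orth_projection s -> near_gr f q s -> arrow q s].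
Proof.
have [p hp] : exists p : 'M[R]_(k, d), orth_projection p.
  exists (pid_mx k); rewrite /orth_projection tr_pid_mx pid_mx_id ?pid_mx_1//.
  exact: ltnW.
pose P (c : I * I) q := forall eps, 0 < eps ->
  exists2 u, transfer c.1 c.2 u & near_gr eps (p *m OO u) q.
have closed c q : orth_projection q -> (forall eps, 0 < eps ->
    exists q', [/\ orth_projection q', near_gr eps q' q & P c q']) -> P c q.
  move=> hq h eps eps0; have e2 : 0 < eps / 2 by rewrite divr_gt0.
  have [q' [_ qq' /(_ _ e2)[u hu uq']]] := h _ e2; exists u => //.
  by rewrite [eps]splitr; apply: near_gr_tri uq' qq'.
have cover q : orth_projection q -> exists2 c, c \in enum predT & P c q.
  move=> hq; have eN (n : nat) : 0 < n.+1%:R^-1 :> R by rewrite invr_gt0.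
  have h n : exists x : (I * I) * seq I, transfer x.1.1 x.1.2 x.2 /\
      near_gr n.+1%:R^-1 (p *m OO x.2) q.
    have [[|i u] su uq] := minimal hp hq (eN n).
      by exists ((ord0, ord0), [::]); split => //; apply: transfer_nil.
    have [j hj] := succ (last i u); exists ((i, j), i :: u); split => //.
    by rewrite /transfer /= eqxx rcons_path hj andbT.
  have [x hx] := choice h; have [c hc] := infinite_pigeonhole (fun n => (x n).1).
  exists c => [|eps eps0]; first by rewrite mem_enum.
  have [l nl lc] := hc (Num.trunc eps^-1); have [xt xn] := hx l.
  exists (x l).2; first by rewrite -lc.
  apply: near_gr_le xn; rewrite -[leRHS]invrK lef_pV2 ?posrE ?invr_gt0//.
  apply: ltW (lt_le_trans (truncnS_gt _) _).
  by rewrite ler_nat ltnS.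
have cover' s : orth_projection s -> near_gr 1 p s -> exists2 c, c \in enum predT & P c s.
  by move=> hs _; exact: cover.
have [[i j] [q0 [f [hq0 f0 Pq0]]]] := baire_finite closed hp ltr01 cover'.
have [vi hvi _] := irr a i; have [wj hwj _] := irr j a.
(* Undoing the rotation of [vi] beforehand lets the loop [vi ++ u ++ wj] act on [p'] as [u ++ wj]
   acts on [p]. *)
pose p' := p *m (OO vi)^T; pose q1 := q0 *m OO wj.
have key s : orth_projection s -> near_gr (f / D) q1 s -> arrow p' s.
  move=> hs qs eps eps0.
  have ow := OOo wj; have ow' := orthogonal_mxT ow.
  have eD : 0 < eps / D by rewrite divr_gt0.
  have near : near_gr f q0 (s *m (OO wj)^T).
    have := near_gr_mulmx (ltW _) ow' qs; rewrite mulrCA divff ?gt_eqF// mulr1.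
    rewrite /q1 -mulmxA orthogonal_mxV// mulmx1; apply.
    by rewrite divr_gt0.
  have [u hu us] := Pq0 _ (orth_projectionM hs ow') near _ eD.
  exists (vi ++ u ++ wj); first exact: transfer_cat hvi (transfer_cat hu hwj).
  rewrite !OO_cat /p' !mulmxA -(mulmxA p) (OOo vi) mulmx1.
  have := near_gr_mulmx (ltW _) ow us; rewrite mulrCA divff ?gt_eqF// mulr1.
  rewrite -(mulmxA s) ow mulmx1; apply.
  by rewrite divr_gt0.
have hp' : orth_projection p' by apply: orth_projectionM => //; apply/orthogonal_mxT/OOo.
have hq1 : orth_projection q1 by exact: orth_projectionM.
have fD : 0 < f / D by rewrite divr_gt0.
exists q1, (f / D); split => // s hs qs.
apply: arrow_trans (key _ hs qs); apply: arrow_sym => //.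
by apply: key => //; apply/near_gr_refl/ltW.
Qed.

(** A loop brings any member of the class of [q0] back next to [q0], where the class contains a
    ball. Rotations distort distances by a bounded factor, so the class contains a ball of one fixed
    radius around each member, as the connectedness lemma demands. *)
Lemma arrow_total p q : orth_projection p -> orth_projection q -> arrow p q.
Proof.
have [q0 [f [hq0 f0 q0s]]] := arrow_class_open.
pose f' := f / 2 / D; have f'0 : 0 < f' by rewrite !divr_gt0.
suff X s : orth_projection s -> arrow q0 s.
  by move=> hp hq; apply: arrow_trans (X _ hq); apply: arrow_sym => //; apply: X.
move=> hs; apply: (@grassmann_connected _ _ _ kd (arrow q0) f' f'0 _ q0 s) => //.
  move=> q1 s' hq1 hs' q0q1 q1s'.
  have [|u hu uq] := arrow_sym hq0 q0q1 (eps := f / 2); first by rewrite divr_gt0.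
  have hsu : orth_projection (s' *m OO u) by apply: orth_projectionM.
  have q0su : arrow q0 (s' *m OO u).
    apply: q0s => //; rewrite [f]splitr; apply: near_gr_tri (near_gr_sym uq) _.
    have := near_gr_mulmx (ltW f'0) (OOo u) q1s'.
    by rewrite /f' mulrCA divff ?gt_eqF// mulr1.
  apply: arrow_trans q0su _; apply: arrow_sym => //; exact: arrow_loop.
by apply: q0s => //; apply/near_gr_refl/ltW.
Qed.

End Arrow.

(** The factor [2 k] in [grid_mx] keeps the leading square block within [1 / (2 k)] of the identity
    in every entry. *)
Lemma grid_mx_free Q (E : {ffun 'I_k -> {ffun 'I_d -> 'I_Q.+1}}) w :
  row_free (grid_mx E *m OO w : 'M[R]_(k, d)).
Proof.
have ow : row_free (OO w).
  by rewrite row_free_unit; have /mulmx1_unit[] := OOo w.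
rewrite /row_free mxrankMfree// eqn_leq rank_leq_row /=.
pose J : 'M[R]_(d, k) := \matrix_(j, l) (l == j :> nat)%:R.
have : grid_mx E *m J \in unitmx.
  apply: (@near_id_unit _ _ _ (2 * k%:R)^-1) => [i l|]; last first.
    rewrite invfM mulrCA; have [->|k0] := posnP k; first by rewrite mul0r mulr0.
    by rewrite divff ?mulr1 ?invf_lt1 ?ltr1n// pnatr_eq0 -lt0n.
  have k0 : (0 < k)%N := leq_ltn_trans (leq0n _) (ltn_ord i).
  pose l' := widen_ord (ltnW kd) l.
  rewrite [X in `|X|]mxE; have -> : (grid_mx E *m J) i l = grid_mx E i l'.
    rewrite mxE (bigD1 l')//= big1 ?addr0 => [|j]; first by rewrite [J _ _]mxE eqxx mulr1.
    by rewrite [J _ _]mxE eq_sym => /negbTE; rewrite -val_eqE /= => ->; rewrite mulr0.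
  rewrite !mxE [X in _ + _ - X](_ : _ = (i == l' :> nat)%:R)//.
  rewrite addrAC subrr add0r ger0_norm; last by rewrite mulr_ge0// invr_ge0 !mulr_ge0.
  rewrite invfM -mulrA ler_piMr ?invr_ge0 ?mulr_ge0// mulrC ler_pdivrMr// mul1r.
  by rewrite ler_nat ltnW.
move=> /mxrank_unit h; rewrite -{1}h; exact: mxrankM_maxl.
Qed.

(** Projections of the same colour can share a connecting word, so one word per colour and starting
    letter makes the list finite. *)
Lemma reachable_grid (nu : probability (borelType (Sigma m)) R)
    Q (E : {ffun 'I_k -> {ffun 'I_d -> 'I_Q.+1}}) u a :
  (forall w, (0 < gw nu w) = sorted e w) -> reachable O nu (grid_mx E *m OO u) a.
Proof.
move=> adm eta eta0; have [M [q [Mu hq qE]]] := orthonormal_factor (grid_mx_free E u).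
have [b [b0 hb]] := exists_mle (M *m q).
(* Its inverse [f] serves two purposes: the change of basis is invertible, and the final error is at
   most [eta]. *)
pose B : R := d%:R * b / eta + 2 * k%:R * (d%:R * d%:R) + 1.
have B0 : 0 < B by rewrite ltr_wpDl// addr_ge0 ?mulr_ge0 ?invr_ge0 ?(ltW b0) ?(ltW eta0).
pose f := B^-1; have f0 : 0 < f by rewrite invr_gt0.
have [T [col hcol]] := @finite_colouring R k d 1 (f / 2 / D / (2 * k%:R + 1)) ltac:(
  by rewrite !divr_gt0// ltr_wpDl// mulr_ge0).
have f2 : 0 < f / 2 by rewrite divr_gt0.
have pick (x : T * I) : exists v : seq I, (exists2 p, orth_projection p & col p = x.1) ->
    exists p, [/\ orth_projection p, col p = x.1, transfer x.2 a v & near_gr (f / 2) (p *m OO v) q].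
  have [[p hp px]|h] := pselect (exists2 p : 'M[R]_(k, d), orth_projection p & col p = x.1); last first.
    by exists [::] => /h.
  have [w hw _] := irr x.2 a.
  have [|v hv vq] := @arrow_total a (p *m OO w) q _ hq _ f2; first exact: orth_projectionM.
  exists (w ++ v) => _; exists p; split => //; first exact: transfer_cat hw hv.
  by rewrite OO_cat mulmxA.
have [V hV] := choice pick.
exists [seq V x | x <- enum predT] => p hp w w0 gw0.
have [c hc] : exists c, forall v, transfer c a v -> sorted e (w ++ rcons v a).
  case: w w0 gw0 => // i w _; rewrite adm => sw; have [c hc] := succ (last i w).
  exists c => v /andP[/eqP hv sv].
  rewrite /= cat_path (sw : path _ _ _) /=.
  by case: v hv sv => [|j v] /= ->; rewrite ?andbT// hc.
have hpw : orth_projection (p *m OO w) by apply: orth_projectionM.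
have [|p' [hp' pc tv qv]] := hV (col (p *m OO w), c); first by exists (p *m OO w).
set v := V _ in tv qv; rewrite /= in pc tv.
(* When the kernels of [q] and [p2] are close, [q *m p2^T *m p2] is close to [q *m q^T *m q = q];
   the factor [M] then recovers the grid direction. *)
exists v, (M *m (q *m (p *m OO w *m OO v)^T)).
pose p2 := p *m OO w *m OO v.
have hp2 : orth_projection p2 by exact: orth_projectionM.
have near : near_gr f q p2.
  rewrite [f]splitr; apply: near_gr_tri (near_gr_sym qv) _.
  set z := f / 2 / D / (2 * k%:R + 1) in hcol.
  have z0 : 0 < z by rewrite !divr_gt0// ltr_wpDl// mulr_ge0.
  have hz := near_gr_mle (ltW z0) hp' hpw
    (hcol _ _ (orth_projection_mle hp') (orth_projection_mle hpw) pc).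
  have kz0 : 0 <= 2 * k%:R * z by rewrite mulr_ge0// ltW.
  have := near_gr_mulmx kz0 (OOo v) hz.
  apply: near_gr_le; rewrite /z.
  rewrite [leLHS](_ : _ = (f / 2) * (2 * k%:R / (2 * k%:R + 1))); last first.
    field; rewrite !gt_eqF// ltr_wpDl// mulr_ge0//.
  by rewrite ler_piMr ?(ltW f2)// ler_pdivrMr ?mul1r ?lerDl// ltr_wpDl// mulr_ge0.
split.
- by apply/mapP; exists (col (p *m OO w), c); rewrite ?mem_enum.
- rewrite unitmx_mul Mu /=; suff : q *m p2^T *m (q *m p2^T)^T \in unitmx.
    by rewrite unitmx_mul => /andP[].
  apply: (@near_id_unit _ _ _ (d%:R * ((d%:R * (1 * f)) * 1))).
    have -> : q *m p2^T *m (q *m p2^T)^T - 1%:M = q *m (grassmann_pt p2 - grassmann_pt q) *m q^T.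
      rewrite [(q *m _)^T]trmx_mul trmxK mulmxBr mulmxBl /grassmann_pt.
      by rewrite [q *m (q^T *m q)]mulmxA hq mul1mx hq !mulmxA.
    apply: mleM; first by rewrite !mulr_ge0// ltW.
      by apply: mleM => //; [exact: orth_projection_mle|exact: near_gr_sym].
    exact/mleT/orth_projection_mle.
  rewrite [ltLHS](_ : _ = k%:R * (d%:R * d%:R) * f); last by ring.
  rewrite ltr_pdivrMr// mul1r /B -addrA ltr_wpDl ?mulr_ge0 ?invr_ge0 ?(ltW b0) ?(ltW eta0)//.
  rewrite -[ltLHS]mul1r (@le_lt_trans _ _ (2 * k%:R * (d%:R * d%:R)))// ?ltrDl//.
  by rewrite -[leRHS]mulrA ler_wpM2r ?mulr_ge0// ler1n.
- rewrite OO_cat qE.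
  have -> : M *m (q *m (p *m OO w *m OO v)^T) *m p *m (OO w *m OO v) - M *m q =
      (M *m q) *m (grassmann_pt p2 - grassmann_pt q).
    rewrite mulmxBr /grassmann_pt !mulmxA -[X in _ = _ - X *m q](mulmxA M) hq mulmx1.
    by rewrite -/p2.
  have := mleM (ltW b0) hb (near_gr_sym near); apply: mle_le.
  rewrite mulrA ler_pdivrMr// [eta * B]mulrC -ler_pdivrMr//.
  by rewrite /B -addrA lerDl addr_ge0// !mulr_ge0.
- by rewrite adm; apply: hc.
Qed.

End Reachable.

Lemma le_geometric (R : realType) (x y K q : R) : 0 < q < 1 ->
  (forall n, x <= y + K * q ^+ n) -> x <= y.
Proof.
move=> hq h; rewrite leNgt; apply/negP => xy.
have xy0 : 0 < x - y by rewrite subr_gt0.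
have [L hL] := poly_expr_decay (2 * K / (x - y)) 0 hq.
have := hL L (leqnn _); rewrite expr0 mulr1 mulrAC ler_pdivrMr// mul1r.
have := h L; lra.
Qed.

Lemma mle_geometric (R : realType) a b (X : 'M[R]_(a, b)) (K q : R) : 0 < q < 1 ->
  (forall n, mle X (K * q ^+ n)) -> X = 0.
Proof.
move=> hq h; apply/matrixP => i j; rewrite mxE; apply/eqP; rewrite -normr_le0.
by apply: (@le_geometric _ _ _ K q) => // n; rewrite add0r; exact: h.
Qed.

Lemma nested_limit (R : realType) (a b : nat -> R) :
  (forall n l, (n <= l)%N -> `|a l - a n| <= b n) -> exists y, forall n, `|y - a n| <= b n.
Proof.
move=> h; pose E := [set a n - b n | n in setT].
have ub l : ubound E (a l + b l).
  move=> _ [n _ <-]; have [nl|/ltnW ln] := leqP n l.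
    have := h _ _ nl; have := h _ _ (leqnn l); rewrite subrr normr0 ler_distl => ? /andP[]; lra.
  have := h _ _ ln; have := h _ _ (leqnn n); rewrite subrr normr0 ler_distl => ? /andP[]; lra.
exists (sup E) => n; rewrite ler_distl; apply/andP; split.
  by apply: ub_le_sup; [exists (a 0%N + b 0%N); exact: ub|exists n].
by apply: ge_sup => //; exists (a 0%N - b 0%N), 0%N.
Qed.

Lemma bolzano_weierstrass (R : realType) n (z : nat -> 'rV[R]_n) B :
  (forall l, mle (z l) B) ->
  exists y, forall eps N, 0 < eps -> exists2 l, (N <= l)%N & mle (z l - y) eps.
Proof.
move=> hz; have cB := rV_compact (fun _ : 'I_n => @segment_compact R (- B) B).
have [|y [_ hy]] := cB (z @ \oo).
  have : \forall l \near \oo, forall i, `[- B, B]%classic (z l ord0 i).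
    by near=> l; move=> i; rewrite /= in_itv /= -ler_norml; exact: hz.
  by [].
exists y => eps N eps0.
have [||_ [[l Nl <-] h]] := hy [set z l | l in [set l | (N <= l)%N]] [set v | mle (v - y) eps].
- have : \forall l \near \oo, [set z l | l in [set l | (N <= l)%N]] (z l).
    by near=> l; exists l => //; near: l; exact: nbhs_infty_ge.
  by [].
- exact: mle_nbhs_mx eps0 _.
by exists l.
Unshelve. all: by end_near.
Qed.

(** * Coding of the self-similar set *)

Section SystemData.
Context {R : realType} {d m : nat}.
Local Notation I := 'I_m.+1.

Lemma S_word_affine (S : I -> 'cV[R]_d -> 'cV[R]_d) r O t :
  (forall i x, S i x = r i *: (O i *m x) + t i) ->
  forall w x, S_word S w x = rr r w *: (OO O w *m x) + tt r O t w.
Proof.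
move=> SE; elim=> [|i w IH] x; first by rewrite /= rr_nil scale1r mul1mx addr0.
rewrite /= SE IH rr_cons mulmxDr scalerDr -scalemxAr scalerA mulmxA.
by rewrite addrA.
Qed.

Lemma S_word_cube (S : I -> 'cV[R]_d -> 'cV[R]_d) w x :
  similarity_system S -> unit_cube x -> unit_cube (S_word S w x).
Proof.
move=> hS cx; elim: w => //= i w IH; have [_] := hS i; apply.
by exists (S_word S w x).
Qed.

Lemma similarity_system_data (S : I -> 'cV[R]_d -> 'cV[R]_d) : similarity_system S ->
  exists r O t rm rM, system_data r O t rm rM /\ forall i x, S i x = r i *: (O i *m x) + t i.
Proof.
move=> hS; have h i : exists z : R * 'M[R]_d * 'cV[R]_d,
    similarity (S i) z.1.1 z.1.2 z.2 /\ z.1.1 < 1.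
  by have [[r [W [t h]]] _] := hS i; exists (r, W, t).
have [z hz] := choice h; pose r i := (z i).1.1; pose O i := (z i).1.2; pose t i := (z i).2.
have SE i x : S i x = r i *: (O i *m x) + t i by have [[_ _ ->]] := hz i.
case: (@arg_minP _ R _ ord0 predT r isT) => i _ hi.
case: (@arg_maxP _ R _ ord0 predT r isT) => j _ hj.
exists r, O, t, (r i), (r j); split => //; split.
- by have [[]] := hz i.
- by have [] := hz j.
- by move=> l; apply/andP; split; [exact: hi|exact: hj].
- by move=> l; have [[]] := hz l.
- move=> w l; have := @S_word_cube S w 0 hS; rewrite (S_word_affine SE) mulmx0 scaler0 add0r.
  by apply=> ?; rewrite mxE lexx ler01.
Qed.

Section Coding.
Context (S : I -> 'cV[R]_d -> 'cV[R]_d) (r : I -> R) (O : I -> 'M[R]_d) (t : I -> 'cV[R]_d).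
Context {rm rM : R} (sd : system_data r O t rm rM)
  (SE : forall i x, S i x = r i *: (O i *m x) + t i).
Local Notation rr := (rr r).
Local Notation OO := (OO O).
Local Notation tt := (tt r O t).
Implicit Types (x : Sigma m).

Let rM01 : 0 < rM < 1. Proof. by rewrite (sd_rM0 sd) (sd_rM sd). Qed.

Let rr_wordD x n l : rr (word x (n + l)) <= rM ^+ l.
Proof.
rewrite word_cat rr_cat; apply: le_trans (ler_piMl (ltW (rr_gt0 sd _)) (rr_le1 sd _)) _.
by have := rr_le sd (word (sft n x) l); rewrite size_word.
Qed.

Lemma coding_limit : exists Pi : Sigma m -> 'cV[R]_d, forall x,
  [/\ unit_cube (Pi x), forall n, mle (Pi x - tt (word x n)) (d%:R * rr (word x n)) &
      forall n, Pi x = tt (word x n) + rr (word x n) *: (OO (word x n) *m Pi (sft n x))].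
Proof.
have h x : exists y : 'cV[R]_d, forall n, mle (y - tt (word x n)) (d%:R * rr (word x n)).
  have hi i : exists y, forall n, `|y - tt (word x n) i 0| <= d%:R * rr (word x n).
    apply: nested_limit => n l nl; rewrite -(subnKC nl) word_cat tt_cat [tt _ in X in _ - X]lock.
    rewrite mxE -lock addrAC subrr add0r mxE normrM gtr0_norm ?(rr_gt0 sd)//.
    rewrite mulrC ler_pM2r ?(rr_gt0 sd)//.
    have := orthogonal_mulmx_mle (OO_orth sd (word x n)) (tt_mle sd (word (sft n x) (l - n))).
    by rewrite mulr1; apply.
  have [y hy] := choice hi; exists (\col_i y i) => n i j; rewrite ord1 !mxE; exact: hy.
have [Pi hPi] := choice h; exists Pi => x; split => // [i|n].
  have rrM n : d%:R * rr (word x n) <= d%:R * rM ^+ n.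
    by apply: ler_wpM2l => //; have := rr_wordD x 0 n.
  apply/andP; split; apply: (@le_geometric _ _ _ d%:R rM) => // n;
    have := hPi x n i 0; rewrite !mxE ler_norml => /andP[h1 h2];
    have /andP[h3 h4] := sd_t sd (word x n) i; have := rrM n; lra.
apply/eqP; rewrite -subr_eq0; apply/eqP.
apply: (@mle_geometric _ _ _ _ (d%:R + d%:R * d%:R) rM) => // l.
have -> : Pi x - (tt (word x n) + rr (word x n) *: (OO (word x n) *m Pi (sft n x))) =
    (Pi x - tt (word x (n + l))) - rr (word x n) *: (OO (word x n) *m
       (Pi (sft n x) - tt (word (sft n x) l))).
  rewrite word_cat tt_cat mulmxBr scalerBr.
  set b := rr _ *: (OO _ *m Pi _); set e := rr _ *: (OO _ *m tt _).
  by rewrite [in RHS]opprB [RHS]addrA -[X in _ = X - _]addrA [in RHS]opprD subrK opprD addrA.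
rewrite mulrDl; apply: mleB.
  by apply: mle_le (hPi _ _); rewrite ler_wpM2l.
rewrite -mulrA; apply: (@mle_le _ _ _ _ (1 * (d%:R * (d%:R * rM ^+ l)))); first by rewrite mul1r.
have hs : mle (Pi (sft n x) - tt (word (sft n x) l)) (d%:R * rM ^+ l).
  by apply: mle_le (hPi _ _); apply: ler_wpM2l => //; have := rr_wordD (sft n x) 0 l.
have := orthogonal_mulmx_mle (OO_orth sd (word x n)) hs => ho i j.
by rewrite mxE normrM ler_pM// gtr0_norm ?(rr_gt0 sd)//; exact: rr_le1 sd _.
Qed.

(** The intersection defining [coding] contains the point of [coding_limit], and any of its points
    is within a multiple of [rM ^ l] of that one for all [l]. *)
Lemma codingP x : [/\ unit_cube (coding S x),
  forall n, mle (coding S x - tt (word x n)) (d%:R * rr (word x n)) &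
  forall n, coding S x = tt (word x n) + rr (word x n) *: (OO (word x n) *m coding S (sft n x))].
Proof.
have [Pi hPi] := coding_limit.
suff E y : coding S y = Pi y by rewrite !E; have [h1 h2 h3] := hPi x; split => // n; rewrite E.
have [cy hy ey] := hPi y.
pose F := \bigcap_(n in [set n : nat | (1 <= n)%N]) (S_word S (word y n) @` (@unit_cube R d)).
have hF : F (coding S y).
  apply: xgetPex; exists (Pi y) => n _; exists (Pi (sft n y)); first by have [] := hPi (sft n y).
  by rewrite (S_word_affine SE) addrC -ey.
apply/eqP; rewrite -subr_eq0; apply/eqP.
apply: (@mle_geometric _ _ _ _ (d%:R + d%:R) rM) => // l.
have hr : rr (word y l.+1) <= rM ^+ l by have := rr_wordD y 1 l.
have := hy l.+1; have : (S_word S (word y l.+1) @` (@unit_cube R d)) (coding S y) by exact: (hF l.+1).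
move: (word y l.+1) hr => w hr [z cz]; rewrite (S_word_affine SE) => zE hw.
have -> : coding S y - Pi y = rr w *: (OO w *m z) - (Pi y - tt w) by rewrite -zE opprB addrA.
rewrite mulrDl; apply: mleB; last by apply: mle_le hw; rewrite ler_wpM2l.
have hz : mle z 1 by move=> i j; rewrite ord1; have /andP[h1 h2] := cz i; rewrite ger0_norm.
have ho := orthogonal_mulmx_mle (OO_orth sd w) hz; rewrite mulr1 in ho.
by move=> i j; rewrite mxE normrM mulrC ler_pM// gtr0_norm ?(rr_gt0 sd).
Qed.

Lemma coding_ball x y n : word x n = word y n ->
  mle (coding S x - coding S y) (2 * d%:R * rM ^+ n).
Proof.
move=> xy; have [_ /(_ n) hx _] := codingP x; have [_ /(_ n) hy _] := codingP y.
rewrite xy in hx; have := mle_tri hx (mleBC hy); apply: mle_le.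
rewrite -mulrDr -mulrA mulrCA ler_wpM2l// mulr2n mulrDl !mul1r.
by have := rr_le sd (word y n); rewrite size_word; lra.
Qed.

Lemma open_coding_preimage (U : set 'cV[R]_d) : open U -> open (coding S @^-1` U).
Proof.
move=> oU; have H x : U (coding S x) -> exists n, cyl (word x n) `<=` coding S @^-1` U.
  move=> Ux; have [e [e0 he]] := mx_nbhs_mle (open_nbhs_nbhs (conj oU Ux)).
  have [n hn] := poly_expr_decay (2 * d%:R / e) 0 rM01; exists n => y.
  rewrite /cyl /= size_word => /coding_ball hy; apply: he; apply: mle_le hy.
  by have := hn n (leqnn n); rewrite expr0 mulr1 mulrAC ler_pdivrMr// mul1r.
have -> : coding S @^-1` U = \bigcup_(w in [set w | cyl w `<=` coding S @^-1` U]) cyl w.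
  apply/seteqP; split=> [x /H[n hn]|x [w /= h cw]]; last exact: h.
  by exists (word x n) => //; rewrite /cyl /= size_word.
by apply: bigcup_open => w _; exact: open_cyl.
Qed.

Lemma measurable_coding : measurable_fun setT
  (coding S : borelType (Sigma m) -> borelType 'cV[R]_d).
Proof.
apply: (@measurability _ _ (borelType (Sigma m)) (borelType 'cV[R]_d) setT _ (@open 'cV[R]_d)) => // _ [U oU <-]; rewrite setTI.
by apply: measurable_open; exact: open_coding_preimage.
Qed.

End Coding.
End SystemData.

Lemma measurable_project (R : realType) d k (p : 'M[R]_(k, d)) :
  measurable_fun setT (project p).
Proof.
apply: (@measurability _ _ (borelType 'cV[R]_d) (borelType 'cV[R]_k) setT _ (@open 'cV[R]_k)) => // _ [U oU <-]; rewrite setTI.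
apply: sub_sigma_algebra; rewrite /= openE => x Ux.
have [e [e0 he]] := mx_nbhs_mle (open_nbhs_nbhs (conj oU Ux)).
have [b [b0 hb]] := exists_mle p.
have db : 0 < d%:R * b + 1 by rewrite ltr_wpDl// mulr_ge0// ltW.
apply: (@mle_nbhs_mx _ _ _ _ _ (e / (d%:R * b + 1))) => [|y hy]; first by rewrite divr_gt0.
apply: he; rewrite /project -mulmxBr; apply: mle_le (mleM (ltW b0) hb hy).
rewrite mulrA mulrCA ger_pMr// ler_pdivrMr// mul1r.
by rewrite lerDl.
Qed.

(** * Admissible words and the separation gap *)

Section SubshiftWords.
Context {m : nat} (A : 'M[nat]_m.+1).
Local Notation I := 'I_m.+1.
Hypotheses (A01 : zero_one A) (irrA : irreducible_mx A).

Definition adj : rel I := fun i j => A i j == 1%N.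

Lemma adj_gt0 i j : (0 < A i j)%N -> adj i j.
Proof. by rewrite /adj; have [->|->] := A01 i j. Qed.

Lemma transfer_mx n i j : (0 < (A ^+ n) i j)%N -> exists2 u, transfer adj i j u & size u = n.
Proof.
elim: n i => [|n IH] i.
  rewrite expr0 mxE; have [<- _|] := eqVneq i j; last by rewrite ltnn.
  by exists [::] => //; rewrite transfer_nil.
rewrite exprS mxE; case: (pickP (fun l => 0 < A i l * (A ^+ n) l j)%N) => [l|h]; last first.
  rewrite big1// => l _; have := h l; rewrite lt0n => /negbFE/eqP h0; exact: h0.
rewrite muln_gt0 => /andP[il lj] _; have [u ul su] := IH _ lj.
exists (i :: u); last by rewrite /= su.
apply: (transfer_cat (u := [:: i]) _ ul).
by rewrite /transfer /= eqxx andbT; apply: adj_gt0.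
Qed.

Lemma transfer_irreducible i j : exists2 u, transfer adj i j u & (0 < size u)%N.
Proof. by have [n [n0 /transfer_mx[u hu su]]] := irrA i j; exists u; rewrite ?su. Qed.

Lemma adj_succ i : exists j, adj i j.
Proof.
have [[|a [|b u]]// ] := transfer_irreducible i i.
  by rewrite /transfer /= andbT => /andP[/eqP -> h]; exists i.
by rewrite /transfer /= => /andP[/eqP -> /andP[h _]]; exists b.
Qed.

Lemma SFT_word x n : SFT A x -> sorted adj (word x n).
Proof.
move=> hx; apply/(sortedP ord0) => l; rewrite size_word => ln.
by rewrite !nth_mkseq ?(ltnW ln)//; apply/eqP/hx.
Qed.

(** Irreducibility gives every letter a successor; iterating a choice of successors continues the
    word forever. *)
Lemma SFT_extend w : sorted adj w -> exists2 x, SFT A x & word x (size w) = w.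
Proof.
move=> /(sortedP ord0) sw; have [f hf] := choice adj_succ.
pose x n := if (n < size w)%N then nth ord0 w n else iter (n - size w).+1 f (last ord0 w).
exists (x : Sigma m) => [n|]; last first.
  apply: (@eq_from_nth _ ord0); first by rewrite size_word.
  by move=> i; rewrite size_word => iw; rewrite nth_mkseq// /x iw.
apply/eqP; rewrite -/(adj _ _) /x.
case: (ltngtP n.+1 (size w)) => [nw|nw|nw].
- exact: sw.
- by rewrite subSn//; exact: hf.
- by rewrite -nw subnn /= -nth_last -nw /=; exact: hf.
Qed.

Lemma SFT_levels : SFT A = \bigcap_n (level n (sorted adj)).
Proof.
apply/seteqP; split=> [x hx n _|x hx l]; first exact: SFT_word.
have /(sortedP ord0)/(_ l) := hx l.+2 Logic.I; rewrite size_word leqnn => /(_ isT).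
by rewrite !nth_mkseq// => /eqP.
Qed.

Lemma measurable_SFT : measurable (SFT A : set (borelType (Sigma m))).
Proof. by rewrite SFT_levels; apply: bigcapT_measurable => n; exact: measurable_level. Qed.

Lemma cylinderE w : cylinder A w = SFT A `&` cyl w.
Proof. by []. Qed.

Lemma cylinder_unsorted w : ~~ sorted adj w -> cylinder A w = set0.
Proof.
move=> nw; apply/seteqP; split=> // x [hx xw]; move/negP: nw; apply.
by rewrite -xw; exact: SFT_word.
Qed.

End SubshiftWords.

Section SystemHypotheses.
Context {R : realType} {d m : nat}.
Local Notation I := 'I_m.+1.
Context (S : I -> 'cV[R]_d -> 'cV[R]_d) (r : I -> R) (O : I -> 'M[R]_d) (t : I -> 'cV[R]_d)
  (A : 'M[nat]_m.+1).
Context {rm rM : R} (sd : system_data r O t rm rM)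
  (SE : forall i x, S i x = r i *: (O i *m x) + t i).
Hypotheses (A01 : zero_one A) (irrA : irreducible_mx A).
Local Notation OO := (OO O).
Local Notation tt := (tt r O t).

Lemma S_mle_near i x y e : mle (x - y) e -> mle (S i x - S i y) (d%:R * e).
Proof.
move=> h; rewrite !SE opprD addrACA subrr addr0 -scalerBr -mulmxBr.
have ho := orthogonal_mulmx_mle (sd_O sd i) h => a b.
have r0 := sd_r_gt0 sd i; have r1 : r i <= 1.
  by have /andP[_ h1] := sd_r sd i; exact: le_trans h1 (ltW (sd_rM sd)).
rewrite mxE normrM gtr0_norm//; apply: le_trans (ho a b).
by rewrite ler_piMl.
Qed.

Lemma separation_letters i j : strong_separation S A -> i != j ->
  (S i @` unit_cube) `&` (S j @` unit_cube) = set0.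
Proof.
move=> sep ij.
have [x hx xi] := @SFT_extend _ _ A01 irrA [:: i] isT.
have [y hy yj] := @SFT_extend _ _ A01 irrA [:: j] isT.
have := sep x y 1%N 1%N hx hy; rewrite (xi : word x 1 = _) (yj : word y 1 = _) /=.
apply; split; rewrite /= ?andbF ?orbF ?andbT//=.
by rewrite eq_sym.
Qed.

(** Without a gap, points in the images of two distinct letters come arbitrarily close. Limits of
    the tails stay in the closed cube and produce a common point of the two images. *)
Lemma strong_separation_gap : strong_separation S A -> exists2 c, 0 < c & separated r O t c.
Proof.
move=> sep; apply: contrapT => H.
have h n : exists x : (I * I) * (seq I * seq I), x.1.1 != x.1.2 /\
    mle (tt (x.1.1 :: x.2.1) - tt (x.1.2 :: x.2.2)) n.+1%:R^-1.
  apply: contrapT => /forallNP h; apply: H; exists n.+1%:R^-1; first by rewrite invr_gt0.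
  move=> i j u v ij; apply: contrapT => /forallNP h'; apply: (h ((i, j), (u, v))).
  by split=> //= a b; rewrite ord1 leNgt; apply/negP => h1; apply: (h' a); exact: ltW.
have [x hx] := choice h; have [[i j] hij] := infinite_pigeonhole (fun n => (x n).1).
have h2 n : exists l, (n <= l)%N /\ (x l).1 = (i, j) by have [l] := hij n; exists l.
have [f hf] := choice h2.
(* Joining the two tails in one row vector makes a single cluster point serve both. *)
pose z n := row_mx (tt (x (f n)).2.1)^T (tt (x (f n)).2.2)^T.
have [|y hy] := @bolzano_weierstrass _ _ z 1.
  move=> n a b; rewrite mxE; case: fintype.split => b'; rewrite mxE; exact: tt_mle sd _ _ _.
pose y1 := (lsubmx y)^T; pose y2 := (rsubmx y)^T.
have near eps N : 0 < eps -> exists2 l, (N <= l)%N &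
    mle (tt (x (f l)).2.1 - y1) eps /\ mle (tt (x (f l)).2.2 - y2) eps.
  move=> /(hy eps N)[l Nl hl]; exists l => //; split=> a b; rewrite ord1.
    by have := hl 0 (lshift d a); rewrite [X in `|X|]mxE row_mxEl !mxE.
  by have := hl 0 (rshift d a); rewrite [X in `|X|]mxE row_mxEr !mxE.
have cube z' : (forall eps, 0 < eps -> exists w, mle (tt w - z') eps) -> unit_cube z'.
  move=> hz a; apply/andP; split; rewrite leNgt; apply/negP => ha.
    have [|w /(_ a 0)] := hz (- z' a 0 / 2); first by lra.
    by rewrite !mxE ler_norml; have /andP[? ?] := sd_t sd w a => /andP[? ?]; lra.
  have [|w /(_ a 0)] := hz ((z' a 0 - 1) / 2); first by lra.
  by rewrite !mxE ler_norml; have /andP[? ?] := sd_t sd w a => /andP[? ?]; lra.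
have c1 : unit_cube y1 by apply: cube => eps /(near _ 0%N)[l _ [h1 h1']]; exists (x (f l)).2.1.
have c2 : unit_cube y2 by apply: cube => eps /(near _ 0%N)[l _ [h1 h1']]; exists (x (f l)).2.2.
have ij : i != j by have [_ e] := hf 0%N; have [] := hx (f 0%N); rewrite e.
have : (S i @` unit_cube `&` S j @` unit_cube) (S i y1).
  split; [by exists y1|exists y2 => //; apply/eqP; rewrite -subr_eq0; apply/eqP/matrixP => a b].
  rewrite [RHS]mxE; apply/eqP; rewrite -normr_le0; apply/ler_addgt0Pl => eps eps0.
  rewrite addr0; have e4 : 0 < eps / (4 * (d%:R + 1)) by rewrite divr_gt0// mulr_gt0// ltr_wpDl.
  have [l Nl [h1 h1']] := near _ (Num.trunc (2 / eps)) e4.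
  have [lf fe] := hf l; have [_ hl0] := hx (f l); rewrite fe in hl0.
  have eS i' u : tt (i' :: u) = S i' (tt u) by rewrite SE.
  have hl : mle (S i (tt (x (f l)).2.1) - S j (tt (x (f l)).2.2)) (f l).+1%:R^-1 by rewrite -!eS.
  have le : (f l).+1%:R^-1 <= eps / 2.
    rewrite -[leRHS]invrK lef_pV2 ?posrE ?invr_gt0 ?divr_gt0// invf_div.
    apply: ltW (lt_le_trans (truncnS_gt _) _); rewrite ler_nat ltnS.
    by apply: leq_trans Nl _; have [] := hf l.
  have de : d%:R * (eps / (4 * (d%:R + 1))) <= eps / 4.
    have d1 : 0 < d%:R + 1 :> R by rewrite ltr_wpDl.
    rewrite [leLHS](_ : _ = eps / 4 * (d%:R / (d%:R + 1))); last by field; rewrite gt_eqF.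
    by rewrite ler_piMr ?divr_ge0 ?(ltW eps0)// ler_pdivrMr// mul1r lerDl.
  have := le_trans (S_mle_near j h1' a b) de; have := le_trans (S_mle_near i h1 a b) de.
  have := le_trans (hl a b) le; clear -eps0; rewrite !mxE !ler_norml.
  by move=> /andP[? ?] /andP[? ?] /andP[? ?]; apply/andP; split; lra.
by rewrite (separation_letters sep ij).
Qed.

(** Comparing linear parts gives proportional orthogonal matrices; their Gram matrices identify the
    two ratios, read off at a coordinate, which exists since [0 < d]. *)
Lemma orthogonal_part_word w Ow : (0 < d)%N -> orthogonal_part (S_word S w) Ow -> Ow = OO w.
Proof.
move=> d0 [rw [tw [rw0 hO Sw]]].
have e x : rw *: (Ow *m x) + tw = rr r w *: (OO w *m x) + tt w.
  by rewrite -(S_word_affine SE).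
have te : tw = tt w by have := e 0; rewrite !mulmx0 !scaler0 !add0r.
have E : rw *: Ow = rr r w *: OO w.
  apply/matrixP => a b; have := e (delta_mx b 0); rewrite te => /addIr.
  by rewrite -!colE => /matrixP/(_ a 0); rewrite !mxE.
have rE : rw = rr r w.
  have : (rw *: Ow)^T *m (rw *: Ow) = (rr r w *: OO w)^T *m (rr r w *: OO w) by rewrite E.
  rewrite [(rw *: Ow)^T]linearZ [(rr r w *: OO w)^T]linearZ /= -!scalemxAl -!scalemxAr !scalerA.
  rewrite hO (OO_orth sd w) => /matrixP/(_ (Ordinal d0) (Ordinal d0)); rewrite !mxE eqxx !mulr1.
  by rewrite -!expr2 => /eqP; rewrite eqrXn2// ?(ltW rw0) ?(ltW (rr_gt0 sd w))// => /eqP.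
by apply: (@scalerI _ _ rw); [rewrite gt_eqF|rewrite E rE].
Qed.

Lemma minimality_words k : (0 < d)%N -> minimality k S A ->
  forall p q : 'M[R]_(k, d), orth_projection p -> orth_projection q ->
  forall eps, 0 < eps -> exists2 u, sorted (adj A) u & near_gr eps (p *m OO u) q.
Proof.
move=> d0 hmin p q hp hq eps eps0.
have gq : grassmannian (k := k) (grassmann_pt q) by exists q.
have [|_ [[x [n [Ow [hx hOw ->]]]] h]] := hmin p hp _ gq [set Q | mle (Q - grassmann_pt q) eps].
  exact: mle_nbhs_mx eps0 _.
exists (word x n); first exact: SFT_word.
by rewrite -(orthogonal_part_word d0 hOw).
Qed.

End SystemHypotheses.

(** * Gibbs measures *)

Section GibbsQuasiBernoulli.
Context {R : realType} {m : nat} (A : 'M[nat]_m.+1) (phi : Sigma m -> R)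
  (nu : probability (borelType (Sigma m)) R).
Local Notation I := 'I_m.+1.
Local Notation g := (gw nu).
Hypotheses (A01 : zero_one A) (irrA : irreducible_mx A) (nuG : gibbs_symbolic A phi nu).
Implicit Types (u v w : seq I) (x : Sigma m).

Lemma gibbs_gw w : fine (nu (cylinder A w)) = g w.
Proof.
have [nu1 _] := nuG; have mS := measurable_SFT A; have mc := measurable_cyl w.
have nS : Pr nu (~` SFT A) = 0.
  have := Pr_split nu (@measurableT _ _) mS; rewrite PrT setTI setTD {1}/Pr nu1 /=; lra.
rewrite /gw (Pr_split nu mc mS) cylinderE setIC -/(Pr nu _).
have : Pr nu (cyl w `\` SFT A) <= Pr nu (~` SFT A).
  by apply: Pr_le; [exact: measurableD|exact: measurableC|move=> x []].
have := Pr_ge0 nu (cyl w `\` SFT A); rewrite nS; lra.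
Qed.

Definition gibbs_weight n x := expR (birkhoff_sum phi n x - n%:R * pressure A phi).

Lemma gibbs_weightD n l x :
  gibbs_weight (n + l) x = gibbs_weight n x * gibbs_weight l (sft n x).
Proof.
rewrite /gibbs_weight -expRD natrD mulrDl; congr expR.
rewrite /birkhoff_sum (big_cat_nat (n := n)) ?leq_addr//= -{2}[n]add0n big_addn addKn.
rewrite opprD addrACA; congr (_ + (_ - _)); apply: eq_bigr => i _; congr phi.
apply: funext => j; rewrite /sft.
have shiftE p (y : Sigma m) : iter p Defs.shift y = (fun q => y (p + q)%N).
  elim: p => [|p IH]; first exact: funext.
  by rewrite iterS IH; apply: funext => q; rewrite /Defs.shift addSnnS.
by rewrite !shiftE addnA [(n + i)%N]addnC.
Qed.

Lemma SFT_sft n x : SFT A x -> SFT A (sft n x).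
Proof. by move=> h l; rewrite /sft addnS; exact: h. Qed.

(** The Gibbs inequality holds at every point of a cylinder, so one sequence starting with [u ++ v]
    serves for [u], after shifting for [v], and for the whole word. Its weights multiply exactly.
    The two summands of the constant serve [qb_le] and [qb_ge] respectively. *)
Lemma gibbs_quasi_bernoulli : exists C, quasi_bernoulli g C.
Proof.
have [_ [C1 [C2 [C10 C20 hC]]]] := nuG.
have E0 n x : 0 < gibbs_weight n x by exact: expR_gt0.
have hg n x : SFT A x -> C1 * gibbs_weight n x <= g (word x n) <= C2 * gibbs_weight n x.
  move=> /(hC x n); rewrite gibbs_gw -/(gibbs_weight n x).
  by rewrite ler_pdivlMr// ler_pdivrMr.
have g0 w : ~~ sorted (adj A) w -> g w = 0.
  by move=> /cylinder_unsorted h; rewrite -gibbs_gw h measure0.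
have gg u v : sorted (adj A) (u ++ v) -> exists E F, [/\ 0 < E, 0 < F,
    C1 * E <= g u <= C2 * E, C1 * F <= g v <= C2 * F &
    C1 * (E * F) <= g (u ++ v) <= C2 * (E * F)].
  move=> /(SFT_extend A01 irrA)[x hx xw].
  have uE : word x (size u) = u.
    by rewrite -(take_word x (leq_addr (size v) _)) -size_cat xw take_size_cat.
  have vE : word (sft (size u) x) (size v) = v.
    by have := word_cat x (size u) (size v); rewrite -size_cat xw uE => /eqP; rewrite eqseq_cat// => /andP[_ /eqP].
  exists (gibbs_weight (size u) x), (gibbs_weight (size v) (sft (size u) x)); split=> //.
  - by have := hg (size u) x hx; rewrite uE.
  - by have := hg (size v) _ (SFT_sft (size u) hx); rewrite vE.
  - by have := hg (size u + size v)%N x hx; rewrite -gibbs_weightD -size_cat xw.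
have K1 : 0 < C2 / C1 ^+ 2 by rewrite divr_gt0// exprn_gt0.
have K2 : 0 < C2 ^+ 2 / C1 by rewrite divr_gt0// exprn_gt0.
exists (C2 / C1 ^+ 2 + C2 ^+ 2 / C1); split.
- exact: gw_nil.
- by move=> w; exact: gw_ge0.
- by move=> w; exact: gw_rcons.
- move=> u v; case: (boolP (sorted (adj A) (u ++ v))) => [/gg[E [F [E0' F0 /andP[u1 u2] /andP[v1 v2] /andP[w1 w2]]]]|/g0 ->]; last first.
    by rewrite !mulr_ge0 ?gw_ge0// addr_ge0 ?ltW.
  apply: le_trans w2 _; apply: (@le_trans _ _ (C2 / C1 ^+ 2 * ((C1 * E) * (C1 * F)))).
    by rewrite le_eqVlt; apply/orP; left; apply/eqP; field; rewrite gt_eqF.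
  rewrite -[leRHS]mulrA; apply: ler_pM; rewrite ?(ltW K1) ?lerDl ?(ltW K2)//.
    by rewrite !mulr_ge0// ltW.
  by apply: ler_pM => //; rewrite mulr_ge0// ltW.
- move=> u v h; case: (boolP (sorted (adj A) (u ++ v))) => [/gg[E [F [E0' F0 /andP[u1 u2] /andP[v1 v2] /andP[w1 w2]]]]|/g0 h0]; last first.
    by rewrite h0 ltxx in h.
  apply: (@le_trans _ _ ((C2 * E) * (C2 * F))); first by rewrite ler_pM// gw_ge0.
  apply: (@le_trans _ _ (C2 ^+ 2 / C1 * (C1 * (E * F)))).
    by rewrite le_eqVlt; apply/orP; left; apply/eqP; field; rewrite gt_eqF.
  apply: ler_pM; rewrite ?(ltW K2) ?lerDr ?(ltW K1)//.
  by rewrite !mulr_ge0// ltW.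
Qed.

Lemma gibbs_gw_gt0 w : (0 < g w) = sorted (adj A) w.
Proof.
have [_ [C1 [C2 [C10 C20 hC]]]] := nuG.
case: (boolP (sorted (adj A) w)) => [/(SFT_extend A01 irrA)[x hx xw]|/cylinder_unsorted h].
  have /andP[+ _] := hC x (size w) hx; rewrite xw gibbs_gw ler_pdivlMr ?expR_gt0//.
  by apply: lt_le_trans; rewrite mulr_gt0// expR_gt0.
by rewrite -gibbs_gw h measure0 ltxx.
Qed.

End GibbsQuasiBernoulli.

Lemma sorted_glue (T : eqType) (e : rel T) u a y :
  sorted e (rcons u a) -> sorted e (a :: y) -> sorted e (u ++ a :: y).
Proof.
by case: u => [|b u]//=; rewrite rcons_path cat_path /= => /andP[-> ->].
Qed.

Lemma ler_sum_uniq (R : numDomainType) (T : eqType) (s s' : seq T) (F : T -> R) :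
  (forall x, 0 <= F x) -> uniq s -> {subset s <= s'} ->
  \sum_(x <- s) F x <= \sum_(x <- s') F x.
Proof.
move=> F0; elim: s s' => [|x s IH] s' /= us ss'.
  by rewrite big_nil sumr_ge0.
have /andP[xs us'] := us; have xs' : x \in s' by apply: ss'; rewrite inE eqxx.
rewrite big_cons (big_rem x xs') /= lerD2l; apply: IH => // y ys.
rewrite rem_mem//; last by apply: ss'; rewrite inE ys orbT.
by apply: contraNneq xs => <-.
Qed.

(** * Covers of coded sets by cylinders *)

Section WordCovers.
Context {R : realType} {d m : nat}.
Local Notation I := 'I_m.+1.
Context (S : I -> 'cV[R]_d -> 'cV[R]_d) (r : I -> R) (O : I -> 'M[R]_d) (t : I -> 'cV[R]_d).
Context {rm rM : R} (sd : system_data r O t rm rM)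
  (SE : forall i x, S i x = r i *: (O i *m x) + t i).
Local Notation rr := (rr r).

Lemma sum_uniq_words (F : seq I -> R) (P : pred (seq I)) (l : seq (seq I)) :
  (forall w, 0 <= F w) -> uniq l ->
  exists N, \sum_(w <- l | P w) F w <= \sum_(n < N) \sum_(w <- words n | P w) F w.
Proof.
move=> F0 ul; exists (\max_(w <- l) size w).+1.
have -> : \sum_(w <- l | P w) F w =
    \sum_(w <- l | P w) \sum_(n < (\max_(w <- l) size w).+1 | size w == n) F w.
  rewrite big_seq_cond [RHS]big_seq_cond; apply: eq_bigr => w /andP[wl _].
  have hw : (size w < (\max_(w <- l) size w).+1)%N.
    by rewrite ltnS (big_rem w)//= leq_maxl.
  by rewrite (big_pred1 (Ordinal hw))// => n; rewrite -val_eqE /= eq_sym.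
rewrite (exchange_big_dep predT)//=; apply: ler_sum => n _.
rewrite -big_filter -[leRHS]big_filter; apply: ler_sum_uniq => //; first exact: filter_uniq.
by move=> w; rewrite !mem_filter mem_words => /andP[/andP[-> ->] _].
Qed.

Lemma null_cover_words s (E : set 'cV[R]_d) : 0 < s ->
  (forall eps, 0 < eps -> exists P : pred (seq I),
    E `<=` coding S @` [set x | exists n, P (word x n)] /\
    forall N, \sum_(n < N) \sum_(w <- words n | P w) rr w `^ s <= eps) ->
  null_cover s E.
Proof.
move=> s0 h eps eps0; pose D : R := 2 * d%:R.
have D0 : 0 <= D by rewrite mulr_ge0.
have Ds : 0 < D `^ s + 1 by rewrite ltr_wpDl// powR_ge0.
have [|P [EP sumP]] := h (eps / (D `^ s + 1)); first by rewrite divr_gt0.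
apply: countable_cover => //.
exists (fun w => if P w then coding S @` cyl w else set0),
  (fun w => if P w then D * rr w else 0); split.
- move=> y /EP[x [n Pn] <-]; exists (word x n) => //; rewrite Pn.
  by exists x => //; rewrite /cyl /= size_word.
- by move=> w; case: ifP => // _; rewrite mulr_ge0// ltW// (rr_gt0 sd).
- move=> w; case: ifP => _; last by move=> ? ? [].
  move=> _ _ [x xw <-] [y yw <-].
  have [_ /(_ (size w)) hx _] := codingP sd SE x; have [_ /(_ (size w)) hy _] := codingP sd SE y.
  rewrite (xw : word x _ = w) in hx; rewrite (yw : word y _ = w) in hy.
  have := mle_tri hx (mleBC hy); apply: mle_le.
  by rewrite /D -mulrDl -mulr2n mulr_natl.
- move=> l ul; have [N hN] := sum_uniq_words (F := fun w => rr w `^ s) P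
    (fun w => powR_ge0 _ _) ul.
  rewrite (eq_bigr (fun w => if P w then D `^ s * rr w `^ s else 0)); last first.
    move=> w _; case: ifP => _; last by rewrite powR0// gt_eqF.
    by rewrite powRM// ltW// (rr_gt0 sd).
  rewrite -big_mkcond /= -mulr_sumr.
  apply: (@le_trans _ _ (D `^ s * (eps / (D `^ s + 1)))).
    by rewrite ler_wpM2l ?powR_ge0// (le_trans hN).
  by rewrite mulrCA ger_pMr// ler_pdivrMr// mul1r lerDl.
Qed.

End WordCovers.

Lemma sum_geometric_tail (R : realFieldType) (q : R) n0 N : 0 < q < 1 ->
  \sum_(n < N | (n0 <= n)%N) q ^+ n <= q ^+ n0 / (1 - q).
Proof.
move=> /andP[q0 q1]; have q10 : 0 < 1 - q by rewrite subr_gt0.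
rewrite ler_pdivlMr//; case: (leqP n0 N) => [nN|Nn]; last first.
  by rewrite big1 ?mul0r ?exprn_ge0 ?ltW// => n nn; move: (ltn_ord n) nn; lia.
suff -> : (\sum_(n < N | (n0 <= n)%N) q ^+ n) * (1 - q) = q ^+ n0 - q ^+ N.
  by rewrite gerBl exprn_ge0// ltW.
rewrite -(subnKC nN); elim: (N - n0)%N => [|l IH].
  by rewrite addn0 big1 ?mul0r ?subrr// => n nn; move: (ltn_ord n) nn; lia.
rewrite addnS big_mkcond big_ord_recr -big_mkcond /= leq_addr mulrDl IH exprS; ring.
Qed.

Section FrostmanMeasure.
Context {R : realType} {d m : nat}.
Local Notation I := 'I_m.+1.
Context (S : I -> 'cV[R]_d -> 'cV[R]_d) (r : I -> R) (O : I -> 'M[R]_d) (t : I -> 'cV[R]_d).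
Context {rm rM : R} (sd : system_data r O t rm rM)
  (SE : forall i x, S i x = r i *: (O i *m x) + t i).
Context (nu : probability (borelType (Sigma m)) R).
Local Notation rr := (rr r).
Local Notation g := (gw nu).

Definition heavy_tails (s : R) (n0 : nat) : set (borelType (Sigma m)) :=
  \bigcup_n level (n0 + n) (fun w => rr w `^ s < g w).

Lemma measurable_heavy_tails s n0 : measurable (heavy_tails s n0).
Proof. by apply: bigcupT_measurable => n; exact: measurable_level. Qed.

Lemma sum_words_gw n : \sum_(w <- words n) g w = 1.
Proof. by rewrite -(Pr_level nu n xpredT) -(PrT nu); congr Pr; apply/seteqP; split. Qed.

(** A heavy word of length [n] satisfies [rr w ^ s' <= rM ^ (n (s' - s)) g w], and the weights of
    one length sum to 1, so the sums over long words are geometric tails. *)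
Lemma heavy_tails_null_cover s s' : 0 < s -> s < s' ->
  null_cover s' (coding S @` (\bigcap_n heavy_tails s n)).
Proof.
move=> s0 ss; have s'0 := lt_trans s0 ss; apply: (null_cover_words sd SE) => // eps eps0.
pose q := rM `^ (s' - s); have a0 : 0 < s' - s by rewrite subr_gt0.
have q01 : 0 < q < 1.
  rewrite powR_gt0 ?(sd_rM0 sd)//=; have <- : 1 `^ (s' - s) = 1 :> R by rewrite powR1.
  by rewrite gt0_ltr_powR ?nnegrE ?(sd_rM sd)// ltW// (sd_rM0 sd).
have [n0 hn0] := poly_expr_decay ((1 - q)^-1 / eps) 0 q01.
exists (fun w => (n0 <= size w)%N && (rr w `^ s < g w)); split=> [_ [x hx <-]|N].
  exists x => //; have [n _ hn] := hx n0 Logic.I; exists (n0 + n)%N.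
  by rewrite size_word leq_addr.
apply: (@le_trans _ _ (\sum_(n < N | (n0 <= n)%N) q ^+ n)); last first.
  apply: le_trans (sum_geometric_tail _ _ q01) _.
  have := hn0 n0 (leqnn _); rewrite expr0 mulr1 mulrAC ler_pdivrMr// mul1r; by rewrite mulrC.
rewrite [leRHS]big_mkcond; apply: ler_sum => n _.
rewrite big_seq_cond; case: (leqP n0 n) => nn; last first.
  by rewrite big1// => w /andP[]; rewrite mem_words => /eqP -> /andP[]; rewrite leqNgt nn.
rewrite -[leRHS]mulr1 -(sum_words_gw n) mulr_sumr -big_seq_cond.
rewrite [leRHS](bigID (fun w => (n0 <= size w)%N && (rr w `^ s < g w))) /= -[leLHS]addr0.
apply: lerD; last by rewrite sumr_ge0// => w _; rewrite mulr_ge0 ?exprn_ge0 ?gw_ge0// ltW//; case/andP: q01.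
rewrite big_seq_cond [leRHS]big_seq_cond; apply: ler_sum => w /andP[].
rewrite mem_words => /eqP wn /andP[_ hw].
have -> : s' = (s' - s) + s by rewrite subrK.
rewrite powRD; last by rewrite (gt_eqF (rr_gt0 sd w)) implybT.
rewrite ler_pM ?powR_ge0 ?(ltW hw)//.
rewrite /q -powR_mulrn ?powR_ge0// -powRrM mulrC powRrM powR_mulrn ?(ltW (sd_rM0 sd))//.
rewrite -wn ge0_ler_powR ?nnegrE ?(ltW a0) ?(ltW (rr_gt0 sd _)) ?exprn_ge0 ?(ltW (sd_rM0 sd))//.
exact: rr_le sd _.
Qed.

(** If bad blocks kept mass [delta] for every [n0], so would the limsup of the heavy words, whose
    coding lies in a null Borel set. *)
Lemma frostman_of_null s s' : 0 < s -> s < s' ->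
  (forall G : set (borelType 'cV[R]_d), measurable G -> null_cover s' G ->
     Pr nu (coding S @^-1` G) = 0) ->
  frostman r nu s.
Proof.
move=> s0 ss hnull delta delta0; apply: contrapT => /forallNP H.
have big n : delta <= Pr nu (heavy_tails s n).
  have /existsNP[L /negP] := H n; rewrite -ltNge => /ltW/le_trans; apply.
  rewrite -Pr_level; apply: Pr_le; [exact: measurable_level|exact: measurable_heavy_tails|].
  move=> x; rewrite /level /= /good_word -has_predC => /hasP[j]; rewrite mem_iota add0n => jL.
  rewrite /= negb_or -leqNgt -ltNge take_word// => /andP[nj hj].
  by exists (j - n)%N => //; rewrite /level /= subnKC.
have dec n : heavy_tails s n.+1 `<=` heavy_tails s n.
  by move=> x [p _ hp]; exists p.+1 => //; rewrite addnS -addSn.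
have := Pr_bigcap_ge (measurable_heavy_tails s) dec big.
have [G [mG EG nG]] := null_cover_hull (lt_trans s0 ss) (heavy_tails_null_cover s0 ss).
rewrite leNgt => /negP; apply; apply: le_lt_trans delta0.
rewrite -(hnull G mG nG); apply: Pr_le.
- by apply: bigcapT_measurable => n; exact: measurable_heavy_tails.
- rewrite -[_ @^-1` _]setTI; exact: (measurable_coding sd SE).
- by move=> x hx; apply: EG; exists x.
Qed.

End FrostmanMeasure.

(** * A Markov measure on the subshift *)

Section CylinderMass.
Context {R : realType} {m : nat}.
Local Notation I := 'I_m.+1.
Variable g : seq I -> R.
Hypotheses (g_nil : g [::] = 1) (g_ge0 : forall w, 0 <= g w)
  (g_rcons : forall w, \sum_i g (rcons w i) = g w).
Implicit Types (u v w : seq I) (s : R) (i j : I).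

(* The words of a given length, in lexicographic order, cut [[0, 1[] into
   consecutive intervals of lengths [g w]. *)
Definition left_end w : R :=
  \sum_(n < size w) \sum_(j : I | (j < nth ord0 w n)%N) g (rcons (take n w) j).

Definition in_slot w s := left_end w <= s < left_end w + g w.

Lemma left_end_rcons w i :
  left_end (rcons w i) = left_end w + \sum_(j : I | (j < i)%N) g (rcons w j).
Proof.
rewrite /left_end size_rcons big_ord_recr /= nth_rcons ltnn eqxx; congr (_ + _).
  apply: eq_bigr => n _; rewrite nth_rcons ltn_ord.
  by rewrite -cats1 takel_cat// ltnW.
by rewrite -cats1 take_size_cat.
Qed.

Lemma partial_sum_le w i : \sum_(j : I | (j < i)%N) g (rcons w j) + g (rcons w i) <= g w.
Proof.
rewrite -[leRHS]g_rcons [leRHS](bigID (fun j : I => (j < i)%N)) /= lerD2l.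
by rewrite (bigD1 i) ?ltnn//= lerDl sumr_ge0.
Qed.

Lemma partial_sum_lt w i i' : (i < i')%N ->
  \sum_(j : I | (j < i)%N) g (rcons w j) + g (rcons w i) <= \sum_(j : I | (j < i')%N) g (rcons w j).
Proof.
move=> ii'; rewrite [leRHS](bigID (fun j : I => (j < i)%N)) /=.
apply: lerD.
  rewrite le_eqVlt; apply/orP; left; apply/eqP; apply: eq_bigl => j.
  by case: (ltnP j i) => ji; rewrite ?andbF// andbT (ltn_trans ji).
by rewrite (bigD1 i) ?ltnn ?ii'//= lerDl sumr_ge0.
Qed.

Lemma in_slot_rcons w i s : in_slot (rcons w i) s -> in_slot w s.
Proof.
rewrite /in_slot left_end_rcons => /andP[h1 h2].
have := partial_sum_le w i; have : 0 <= \sum_(j : I | (j < i)%N) g (rcons w j) by rewrite sumr_ge0.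
by move=> h3 h4; apply/andP; split; lra.
Qed.

Lemma in_slot_uniq w i i' s : in_slot (rcons w i) s -> in_slot (rcons w i') s -> i = i'.
Proof.
wlog: i i' / (i < i')%N => [H h1 h2|ii'].
  by apply/val_inj; case: (ltngtP i i') => // ii'; [rewrite (H i i')|rewrite (H i' i)].
rewrite /in_slot !left_end_rcons => /andP[_ h1] /andP[h2 _].
by have := lt_le_trans h1 (le_trans _ h2); rewrite -addrA lerD2l ltxx => /(_ (partial_sum_lt w ii')).
Qed.

(** The default letter only concerns reals outside [[0, 1[], which carry no mass for the uniform
    measure. *)
Definition next_letter w s : I := odflt ord0 [pick i | in_slot (rcons w i) s].

Fixpoint slot_word n s : seq I :=
  if n is n'.+1 then rcons (slot_word n' s) (next_letter (slot_word n' s) s) else [::].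

Definition slot_point s : Sigma m := fun l => next_letter (slot_word l s) s.

Lemma word_slot_point n s : word (slot_point s) n = slot_word n s.
Proof. by elim: n => // n IH; rewrite wordS IH. Qed.

Lemma in_slot_word w s : in_slot w s -> slot_word (size w) s = w.
Proof.
elim/last_ind: w => [//|w i IH] h; rewrite size_rcons /= IH ?(in_slot_rcons h)//.
congr rcons; rewrite /next_letter; case: pickP => [j hj|/(_ i)]; last by rewrite h.
exact: in_slot_uniq hj h.
Qed.

Lemma measurable_slot w : measurable ([set s | in_slot w s] : set (measurableTypeR R)).
Proof.
rewrite (_ : [set s | _] = `[left_end w, left_end w + g w[%classic)//.
Qed.

(** The next letter is a function of finitely many slot memberships, so the set is a finite union of
    finite intersections of slots and complements. *)
Lemma measurable_next_letter w (P : pred I) :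
  measurable ([set s | P (next_letter w s)] : set (measurableTypeR R)).
Proof.
pose F (e : {ffun I -> bool}) : I := odflt ord0 [pick i | e i].
have -> : [set s | P (next_letter w s)] = \bigcup_(e in [set e | P (F e)])
    \bigcap_(i in [set: I]) [set s | in_slot (rcons w i) s = e i].
  apply/seteqP; split=> [s Ps|s [e /= Pe he]].
    exists [ffun i => in_slot (rcons w i) s] => [|i _ /=]; last by rewrite ffunE.
    rewrite /= /F (eq_pick (Q := fun i => in_slot (rcons w i) s))// => i.
    by rewrite ffunE.
  rewrite /= /next_letter (eq_pick (Q := fun i => e i))// => i; exact: he.
apply: fin_bigcup_measurable => [|e _]; first exact: finite_finset.
apply: fin_bigcap_measurable => [|i _]; first exact: finite_finset.
case: (e i); first exact: measurable_slot.
rewrite (_ : [set s | _] = ~` [set s | in_slot (rcons w i) s]); last first.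
  by apply/seteqP; split=> s /=; case: in_slot.
by apply: measurableC; exact: measurable_slot.
Qed.

Lemma measurable_slot_word n w :
  measurable ([set s | slot_word n s = w] : set (measurableTypeR R)).
Proof.
elim: n w => [|n IH] w.
  case: w => [|i w].
    by rewrite (_ : [set s | _] = setT)//; apply/seteqP; split.
  by rewrite (_ : [set s | _] = set0)//; apply/seteqP; split.
elim/last_ind: w => [|w i _].
  rewrite (_ : [set s | _] = set0)//; apply/seteqP; split => // s /= h.
  by have := congr1 size h; rewrite size_rcons.
rewrite (_ : [set s | _] = [set s | slot_word n s = w] `&` [set s | next_letter w s == i]).
  by apply: measurableI; [exact: IH|exact: (measurable_next_letter w (pred1 i))].
apply/seteqP; split=> s /=; first by move/rcons_inj => [<- ->]; rewrite eqxx.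
by move=> [-> /eqP ->].
Qed.

Definition slot_map : measurableTypeR R -> borelType (Sigma m) := slot_point.

Lemma measurable_slot_map : measurable_fun setT slot_map.
Proof.
apply: (@measurability _ _ (measurableTypeR R) (borelType (Sigma m)) setT _ (@open (Sigma m))) => // _ [U oU <-].
rewrite setTI (open_bigcup_cyl oU) bigcup_words preimage_bigcup.
apply: bigcupT_measurable => n; case: pickle_inv => [w|]; last by rewrite preimage_set0.
case: ifP => _; last by rewrite preimage_set0.
rewrite (_ : _ @^-1` _ = [set s | slot_word (size w) s = w]); first exact: measurable_slot_word.
by apply/seteqP; split=> s; rewrite /cyl /preimage /= word_slot_point.
Qed.

HB.instance Definition _ := isMeasurableFun.Build _ _ _ _ slot_map measurable_slot_map.

Lemma left_end_ge0 w : 0 <= left_end w.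
Proof. by apply: sumr_ge0 => n _; apply: sumr_ge0. Qed.

Lemma left_end_le w : left_end w + g w <= 1.
Proof.
elim/last_ind: w => [|w i IH]; first by rewrite /left_end big_ord0 g_nil add0r.
apply: le_trans IH; rewrite left_end_rcons -addrA lerD2l; exact: partial_sum_le.
Qed.

Lemma uniform_slot w : uniform_prob (@ltr01 R) [set s | in_slot w s] = (g w)%:E.
Proof.
rewrite /uniform_prob integral_uniform_pdf setIidl; last first.
  move=> s /andP[h1 h2]; rewrite /= in_itv /=; apply/andP; split.
    exact: le_trans (left_end_ge0 w) h1.
  exact: le_trans (ltW h2) (left_end_le w).
rewrite (eq_integral (fun=> 1%:E)); last first.
  move=> s; rewrite inE => /andP[h1 h2]; rewrite /uniform_pdf subr0 invr1 ifT//.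
  rewrite (le_trans (left_end_ge0 w) h1)/=.
  exact: le_trans (ltW h2) (left_end_le w).
rewrite integral_cst//=; last exact: measurable_slot.
rewrite mul1e (_ : [set s | _] = `[left_end w, left_end w + g w[%classic); last first.
  by apply/seteqP; split=> s /=; rewrite in_itv.
rewrite lebesgue_measure_itv /= lte_fin ltrDl; case: ifPn => [_|].
  by rewrite -EFinD addrC addKr.
by rewrite -leNgt => h; congr EFin; apply/eqP; rewrite eq_le h g_ge0.
Qed.

(** The uniform measure on the unit interval is pushed forward by [slot_map]. The slot of [w] maps
    into its cylinder, which gives one inequality; as both weights are additive over one-letter
    extensions, equality propagates from the empty word. *)
Lemma exists_cylinder_measure : exists nu : probability (borelType (Sigma m)) R,
  forall w, gw nu w = g w.
Proof.
pose P : probability (measurableTypeR R) R := uniform_prob (@ltr01 R).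
pose nu : probability (borelType (Sigma m)) R := distribution P slot_map.
exists nu; have le w : g w <= gw nu w.
  rewrite -lee_fin -uniform_slot /gw -PrE; last exact: measurable_cyl.
  apply: le_measure; rewrite ?inE.
  - exact: measurable_slot.
  - rewrite (_ : _ @^-1` _ = [set s | slot_word (size w) s = w]); first exact: measurable_slot_word.
    by apply/seteqP; split=> s; rewrite /cyl /preimage /= word_slot_point.
  - by move=> s /in_slot_word h; rewrite /cyl /preimage /= word_slot_point.
elim/last_ind => [|w i IH]; first by rewrite gw_nil g_nil.
apply/eqP; rewrite eq_le le andbT.
have := gw_rcons nu w; rewrite IH -[RHS]g_rcons [LHS](bigD1 i)//= [RHS](bigD1 i)//= => h.
have : \sum_(j | j != i) g (rcons w j) <= \sum_(j | j != i) gw nu (rcons w j) by apply: ler_sum.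
lra.
Qed.

End CylinderMass.

Section MarkovWeights.
Context {R : realType} {m : nat}.
Local Notation I := 'I_m.+1.
Context (e : rel I) (h : I -> R) (h0 : forall i, 0 < h i) (succ : forall i, exists j, e i j).
Implicit Types (i j : I) (u v w : seq I).

Definition out_weight i := \sum_(j | e i j) h j.

Lemma out_weight_gt0 i : 0 < out_weight i.
Proof.
have [j ij] := succ i; rewrite /out_weight (bigD1 j)//= ltr_wpDr//.
by apply: sumr_ge0 => l _; exact: ltW.
Qed.

Definition transition i j : R := if e i j then h j / out_weight i else 0.

Lemma transition_ge0 i j : 0 <= transition i j.
Proof. by rewrite /transition; case: ifP => // _; rewrite divr_ge0 ?ltW ?out_weight_gt0. Qed.

Lemma transition_gt0 i j : (0 < transition i j) = e i j.
Proof.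
by rewrite /transition; case: ifP => _; rewrite ?ltxx// divr_gt0 ?out_weight_gt0.
Qed.

Lemma transition_sum i : \sum_j transition i j = 1.
Proof.
by rewrite -big_mkcond /= -mulr_suml divff// gt_eqF// out_weight_gt0.
Qed.

Lemma transition_le1 i j : transition i j <= 1.
Proof.
rewrite -(transition_sum i) (bigD1 j)//= lerDl sumr_ge0// => l _; exact: transition_ge0.
Qed.

Fixpoint chain i w : R := if w is j :: w' then transition i j * chain j w' else 1.

Definition markov w : R := if w is i :: w' then m.+1%:R^-1 * chain i w' else 1.

Lemma chain_ge0 i w : 0 <= chain i w.
Proof. by elim: w i => //= j w IH i; rewrite mulr_ge0// transition_ge0. Qed.

Lemma chain_gt0 i w : (0 < chain i w) = path e i w.
Proof.
elim: w i => [|j w IH] i /=; first exact: ltr01.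
have [ij|ij] := boolP (e i j); first by rewrite pmulr_rgt0 ?transition_gt0.
by rewrite /transition (negbTE ij) mul0r ltxx.
Qed.

Lemma chain_cat i u v : chain i (u ++ v) = chain i u * chain (last i u) v.
Proof. by elim: u i => [|j u IH] i /=; rewrite ?mul1r// IH mulrA. Qed.

Lemma markov_ge0 w : 0 <= markov w.
Proof. by case: w => //= i w; rewrite mulr_ge0// chain_ge0. Qed.

Lemma markov_gt0 w : (0 < markov w) = sorted e w.
Proof. by case: w => [|i w] /=; [exact: ltr01|rewrite pmulr_rgt0 ?chain_gt0]. Qed.

Lemma markov_rcons w : \sum_i markov (rcons w i) = markov w.
Proof.
case: w => [|i w] /=.
  rewrite (eq_bigr (fun=> m.+1%:R^-1)); last by move=> i _; rewrite mulr1.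
  by rewrite sumr_const card_ord -[LHS]mulr_natl divff// pnatr_eq0.
rewrite -mulr_sumr; congr (_ * _); rewrite -[RHS]mulr1 -(transition_sum (last i w)) mulr_sumr.
by apply: eq_bigr => j _; rewrite -cats1 chain_cat /= mulr1.
Qed.

(** Cutting a word changes its weight only by a transition probability and the uniform initial
    weight; an allowed transition is at least the minimum of [h] divided by its sum. *)
Lemma markov_quasi_bernoulli : exists C, forall nu : probability (borelType (Sigma m)) R,
  (forall w, gw nu w = markov w) -> quasi_bernoulli (gw nu) C.
Proof.
case: (@arg_minP _ R _ ord0 predT h isT) => i0 _ hmin.
pose H := \sum_j h j; pose C := m.+1%:R + H / h i0 + 1.
have H0 : 0 <= H by apply: sumr_ge0 => j _; exact: ltW.
have q0 : 0 <= H / h i0 by rewrite divr_ge0// ltW.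
exists C => nu hnu; have M1 : 1 <= m.+1%:R :> R by rewrite ler1n.
have C1 : 1 <= C by rewrite /C lerDr addr_ge0.
have C0 : 0 <= C := le_trans ler01 C1.
have split u v a b : markov (a :: u ++ b :: v) =
    m.+1%:R * transition (last a u) b * (markov (a :: u) * markov (b :: v)).
  by rewrite /= chain_cat /=; field; rewrite gt_eqF// ltr0n.
have mm u v : 0 <= markov u * markov v := mulr_ge0 (markov_ge0 u) (markov_ge0 v).
split.
- exact: gw_nil.
- by move=> w; exact: gw_ge0.
- by move=> w; exact: gw_rcons.
- move=> [|a u] [|b v]; rewrite ?cats0 ?cat0s !hnu.
  + by rewrite !mulr1.
  + by rewrite mulr1 ler_peMl// markov_ge0.
  + by rewrite mulr1 ler_peMl// markov_ge0.
  rewrite cat_cons split -[leRHS]mulrA ler_wpM2r ?mm//.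
  apply: (@le_trans _ _ m.+1%:R); first by rewrite ler_piMr// transition_le1.
  by rewrite /C -addrA lerDl addr_ge0.
- move=> [|a u] [|b v]; rewrite ?cats0 ?cat0s !hnu.
  + by rewrite !mulr1.
  + by rewrite mul1r => _; rewrite ler_peMl// markov_ge0.
  + by rewrite mulr1 => _; rewrite ler_peMl// markov_ge0.
  rewrite cat_cons => hp; have ab : e (last a u) b.
    by move: hp; rewrite markov_gt0 /= cat_path /= => /and3P[].
  rewrite split [leRHS]mulrA -[leLHS]mul1r ler_wpM2r ?mm//.
  have T : h i0 / H <= transition (last a u) b.
    rewrite /transition ab ler_pM ?invr_ge0 ?(ltW (h0 _))//; first exact: hmin.
    rewrite lef_pV2 ?posrE ?out_weight_gt0//.
      by rewrite /H /out_weight [leRHS](bigID (e (last a u))) /= lerDl sumr_ge0// => j _; exact: ltW.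
    apply: lt_le_trans (out_weight_gt0 (last a u)) _.
    by rewrite /H /out_weight [leRHS](bigID (e (last a u))) /= lerDl sumr_ge0// => j _; exact: ltW.
  have H1 : 0 < H by rewrite /H (bigD1 ord0)//= ltr_wpDr// sumr_ge0// => j _; exact: ltW.
  apply: (@le_trans _ _ (H / h i0 * (1 * (h i0 / H)))).
    rewrite mul1r le_eqVlt; apply/orP; left; apply/eqP; field; by rewrite !gt_eqF.
  apply: ler_pM => //; first by rewrite mul1r divr_ge0// ltW.
    by rewrite /C addrAC lerDr addr_ge0.
  by apply: ler_pM => //; rewrite divr_ge0// ltW.
Qed.

(** The hypothesis on [h] bounds each transition by [r i ^ s * (h j / h i)], and the quotients
    telescope along the word. The last letter has no outgoing transition and costs a constant. *)
Lemma markov_le (r : I -> R) s rm : 0 < rm -> (forall i, rm <= r i) -> 0 <= s ->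
  (forall i, h i <= r i `^ s * out_weight i) ->
  exists K, forall w, markov w <= K * rr r w `^ s.
Proof.
move=> rm0 rmr s0 hle; have r0 i : 0 < r i := lt_le_trans rm0 (rmr i).
have rr0 w : 0 < rr r w.
  by elim: w => [|i w IH]; rewrite ?rr_nil// rr_cons mulr_gt0.
have T i j : transition i j <= r i `^ s * (h j / h i).
  rewrite /transition; case: ifP => _; last by rewrite mulr_ge0 ?powR_ge0// divr_ge0 ?ltW.
  have hw := out_weight_gt0 i; rewrite ler_pdivrMr//.
  have -> : r i `^ s * (h j / h i) * out_weight i = h j * (r i `^ s * out_weight i / h i).
    by field; rewrite gt_eqF.
  by rewrite ler_peMr ?(ltW (h0 j))// ler_pdivlMr// mul1r.
have ch w i : chain i w <= rr r (belast i w) `^ s * (h (last i w) / h i).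
  elim: w i => [|j w IH] i /=.
    by rewrite rr_nil powR1 mul1r divff// gt_eqF.
  rewrite rr_cons (powRM _ (ltW (r0 _)) (ltW (rr0 _))).
  rewrite [leRHS](_ : _ = (r i `^ s * (h j / h i)) * (rr r (belast j w) `^ s * (h (last j w) / h j))).
    by rewrite ler_pM ?transition_ge0 ?chain_ge0.
  by field; rewrite !gt_eqF.
case: (@arg_maxP _ R _ ord0 predT h isT) => i1 _ hmax.
case: (@arg_minP _ R _ ord0 predT h isT) => i0 _ hmin.
exists (1 + rm `^ (- s) * (h i1 / h i0)) => -[|i w].
  by rewrite rr_nil powR1 mulr1 /= lerDl mulr_ge0 ?powR_ge0// divr_ge0 ?ltW.
have rms : 0 < rm `^ s by rewrite powR_gt0.
rewrite /markov; apply: (@le_trans _ _ (chain i w)).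
  by rewrite ler_piMl ?chain_ge0// invf_le1 ?ler1n.
apply: le_trans (ch w i) _.
have -> : rr r (i :: w) = rr r (belast i w) * r (last i w).
  by rewrite lastI -cats1 rr_cat rr_cons rr_nil mulr1.
rewrite (powRM _ (ltW (rr0 _)) (ltW (r0 _))) [leRHS]mulrCA ler_wpM2l ?powR_ge0//.
apply: (@le_trans _ _ (h i1 / h i0)).
  by rewrite ler_pM ?invr_ge0 ?(ltW (h0 _)) ?lef_pV2 ?posrE//; [exact: hmax|exact: hmin].
have hh : 0 <= h i1 / h i0 by rewrite divr_ge0 ?ltW.
apply: (@le_trans _ _ (rm `^ (- s) * (h i1 / h i0) * r (last i w) `^ s)); last first.
  by rewrite ler_wpM2r ?powR_ge0// lerDr.
rewrite mulrAC ler_peMl// powRN mulrC ler_pdivlMr// mul1r.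
by rewrite ge0_ler_powR// nnegrE ltW.
Qed.

End MarkovWeights.

(** * Weighted adjacency matrices and the dimension of the fractal *)

Section TransferMatrix.
Context {R : realType} {d m : nat}.
Local Notation I := 'I_m.+1.
Context (S : I -> 'cV[R]_d -> 'cV[R]_d) (r : I -> R) (O : I -> 'M[R]_d) (t : I -> 'cV[R]_d)
  (A : 'M[nat]_m.+1).
Context {rm rM : R} (sd : system_data r O t rm rM)
  (SE : forall i x, S i x = r i *: (O i *m x) + t i).
Hypotheses (A01 : zero_one A) (irrA : irreducible_mx A).
Local Notation rr := (rr r).
Variable s : R.

Definition weighted_adjacency : 'M[R]_m.+1 := \matrix_(i, j) (r i `^ s * (adj A i j)%:R).
Local Notation B := weighted_adjacency.

Let rs_gt0 i : 0 < r i `^ s. Proof. by rewrite powR_gt0// (sd_r_gt0 sd). Qed.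

Lemma transfer_pow_ge0 n i j : 0 <= (B ^+ n) i j.
Proof.
elim: n i => [|n IH] i; first by rewrite expr0 mxE ler0n.
by rewrite exprS mxE sumr_ge0// => l _; rewrite !mulr_ge0// mxE mulr_ge0// ltW.
Qed.

Lemma transfer_powD n p i l j : (B ^+ n) i l * (B ^+ p) l j <= (B ^+ (n + p)) i j.
Proof.
rewrite exprD mxE (bigD1 l)//= lerDl sumr_ge0// => q _.
by rewrite mulr_ge0// transfer_pow_ge0.
Qed.

Lemma transfer_pow_gt0 n i j : (0 < (A ^+ n) i j)%N -> 0 < (B ^+ n) i j.
Proof.
elim: n i => [|n IH] i; first by rewrite !expr0 !mxE; case: eqVneq => //; rewrite ltr01.
rewrite exprS mxE; case: (pickP (fun l => 0 < A i l * (A ^+ n) l j)%N) => [l|h]; last first.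
  rewrite big1// => l _; have := h l; rewrite lt0n => /negbFE/eqP h0; exact: h0.
rewrite muln_gt0 => /andP[il lj] _; rewrite exprS mxE (bigD1 l)//= ltr_wpDr//.
  by rewrite sumr_ge0// => q _; rewrite mulr_ge0 ?transfer_pow_ge0// mxE mulr_ge0// ltW.
by rewrite mulr_gt0 ?IH// mxE mulr_gt0// (adj_gt0 A01 il) ltr01.
Qed.

Lemma transfer_loop_pow i n q : 1 <= (B ^+ n) i i -> 1 <= (B ^+ (n * q)) i i.
Proof.
move=> h; elim: q => [|q IH]; first by rewrite muln0 expr0 mxE eqxx.
rewrite mulnS; apply: le_trans (transfer_powD n (n * q) i i i).
by rewrite -[leLHS]mul1r ler_pM.
Qed.

(* The sum of the columns [B ^+ p] over one long loop is superharmonic. *)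
Lemma exists_subinvariant i n : (0 < n)%N -> 1 <= (B ^+ n) i i ->
  exists h : I -> R, (forall j, 0 < h j) /\
    forall j, h j <= r j `^ s * out_weight (adj A) h j.
Proof.
move=> n0 hn; have [p hp] := choice (fun j => irrA j i).
(* A multiple of the loop length beyond the times [p j]: then [h], the column [i] of
   [1 + B + ... + B ^ (N - 1)], is positive, and [B h - h] is the column [i] of [B ^ N - 1], which
   is nonnegative. *)
pose N := (n * (\max_j p j).+1)%N.
have pN j : (p j < N)%N.
  by apply: (@leq_trans (\max_j p j).+1); [rewrite ltnS leq_bigmax|rewrite leq_pmull].
exists (fun j => \sum_(q < N) (B ^+ q) j i); split=> j.
  rewrite (bigD1 (Ordinal (pN j)))//= ltr_wpDr ?transfer_pow_gt0//; last by have [] := hp j.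
  by rewrite sumr_ge0// => q _; exact: transfer_pow_ge0.
have -> : r j `^ s * out_weight (adj A) (fun j => \sum_(q < N) (B ^+ q) j i) j =
    \sum_(q < N) (B ^+ q.+1) j i.
  under [RHS]eq_bigr do rewrite exprS mxE.
  rewrite exchange_big /= /out_weight big_mkcond mulr_sumr; apply: eq_bigr => l _.
  rewrite -mulr_sumr mxE -mulrA; congr (_ * _).
  by case: (adj A j l); rewrite ?mul1r ?mul0r.
have N0 : (0 < N)%N by rewrite muln_gt0 n0.
rewrite -(prednK N0) [leLHS]big_ord_recl [leRHS]big_ord_recr /= [leLHS]addrC.
rewrite (prednK N0); apply: lerD; first by apply: ler_sum => q _; rewrite /bump leq0n.

rewrite expr0 mxE; case: (eqVneq j i) => [->|_]; last exact: transfer_pow_ge0.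
exact: transfer_loop_pow.
Qed.

Lemma word_sum_transfer n i :
  \sum_(w <- words n) (path (adj A) i w)%:R * rr (i :: w) `^ s = \sum_j (B ^+ n) i j * r j `^ s.
Proof.
elim: n i => [|n IH] i.
  rewrite sum_words0 mul1r rr_cons rr_nil mulr1 expr0 (bigD1 i)//= big1 ?addr0.
    by rewrite mxE eqxx mul1r.
  by move=> j ji; rewrite mxE eq_sym (negbTE ji) mul0r.
rewrite sum_wordsS; under [RHS]eq_bigr do rewrite exprS mxE mulr_suml.
rewrite [RHS]exchange_big /=; apply: eq_bigr => l _.
under [RHS]eq_bigr do rewrite -mulrA.
rewrite -mulr_sumr -IH mulr_sumr; apply: eq_bigr => w _.
rewrite rr_cons powRM ?(ltW (sd_r_gt0 sd _)) ?(ltW (rr_gt0 sd _))// mxE.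
by case: (adj A i l) => /=; rewrite ?mulr1 ?mulr0 ?mul0r//; ring.
Qed.

(** Closing a path by a fixed return path gives a loop, of weight below 1, so the powers of [B] stay
    bounded. Together with [exists_subinvariant] this dichotomy on loops stands in for the spectral
    radius; the passage from [s] to [s'] makes bounded covering sums tend to 0. *)
Lemma fractal_null_cover s' : 0 < s -> s < s' ->
  (forall i n, (0 < n)%N -> (B ^+ n) i i < 1) -> null_cover s' (fractal S A).
Proof.
move=> s0 ss hB; have s'0 := lt_trans s0 ss.
have a0 : 0 < s' - s by rewrite subr_gt0.
have [p hp] := choice (fun x : I * I => irrA x.1 x.2).
pose c x := (B ^+ p x) x.1 x.2.
have c0 x : 0 < c x by apply: transfer_pow_gt0; have [] := hp x.
have Bc n i j : (B ^+ n) i j <= (c (j, i))^-1.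
  rewrite -[leRHS]mul1r ler_pdivlMr//; apply: le_trans (transfer_powD _ _ _ _ _) _.
  by apply/ltW/hB; rewrite addn_gt0; have [-> _] := hp (j, i); rewrite orbT.
pose K := \sum_i \sum_j (c (j, i))^-1 * r j `^ s.
have K0 : 0 <= K by rewrite sumr_ge0// => i _; rewrite sumr_ge0// => j _; rewrite mulr_ge0 ?powR_ge0 ?invr_ge0 ?ltW.
apply: (null_cover_words sd SE) => // eps eps0.
have [|n hn] := @powR_expr_decay _ (K / eps) rM (s' - s) 0 _ a0.
  by rewrite (sd_rM0 sd) (sd_rM sd).
exists (fun w => (size w == n.+1) && sorted (adj A) w); split=> [_ [x hx <-]|N].
  by exists x => //; exists n.+1; rewrite size_word eqxx SFT_word.
apply: (@le_trans _ _ (\sum_(w <- words n.+1 | sorted (adj A) w) rr w `^ s')).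
  have z j : j != n.+1 -> \sum_(w <- words j | (size w == n.+1) && sorted (adj A) w) rr w `^ s' = 0.
    move=> jn; rewrite big_seq_cond big1// => w /andP[]; rewrite mem_words => /eqP ->.
    by rewrite (negbTE jn).
  have nn : \sum_(w <- words n.+1 | (size w == n.+1) && sorted (adj A) w) rr w `^ s' =
      \sum_(w <- words n.+1 | sorted (adj A) w) rr w `^ s'.
    rewrite big_seq_cond [RHS]big_seq_cond; apply: eq_bigl => w; rewrite mem_words.
    by case: eqP.
  have pos : 0 <= \sum_(w <- words n.+1 | sorted (adj A) w) rr w `^ s'.
    by rewrite sumr_ge0// => w _; exact: powR_ge0.
  case: (ltnP n.+1 N) => nN; last first.
    by rewrite big1// => j _; apply: z; rewrite neq_ltn (leq_trans (ltn_ord j) nN).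
  rewrite (bigD1 (Ordinal nN))//= nn [X in _ + X]big1 ?addr0// => j jn; apply: z.
  by apply: contra jn => /eqP jn; apply/eqP/val_inj.
have step : \sum_(w <- words n.+1 | sorted (adj A) w) rr w `^ s' <= (rM ^+ n) `^ (s' - s) * K.
  rewrite big_mkcond sum_wordsS /K mulr_sumr; apply: ler_sum => i _.
  apply: (@le_trans _ _ ((rM ^+ n) `^ (s' - s) * \sum_j (B ^+ n) i j * r j `^ s)); last first.
    rewrite ler_wpM2l ?powR_ge0//; apply: ler_sum => j _.
    by rewrite ler_wpM2r ?powR_ge0.
  rewrite -word_sum_transfer mulr_sumr big_seq_cond [leRHS]big_seq_cond.
  apply: ler_sum => w /andP[]; rewrite mem_words => /eqP wn _ /=.
  case: (path _ _ _); last by rewrite mul0r mulr0.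
  have -> : rr (i :: w) `^ s' = rr (i :: w) `^ (s' - s) * rr (i :: w) `^ s.
    by rewrite -powRD ?subrK// (gt_eqF (rr_gt0 sd (i :: w))) implybT.
  rewrite mul1r.
  rewrite ler_wpM2r ?powR_ge0// ge0_ler_powR ?nnegrE ?(ltW a0) ?(ltW (rr_gt0 sd _)) ?exprn_ge0 ?(ltW (sd_rM0 sd))//.
  rewrite rr_cons -wn (le_trans _ (rr_le sd w))// ler_piMl ?(ltW (rr_gt0 sd _))//.
  by have := rr_le1 sd [:: i]; rewrite rr_cons rr_nil mulr1.
apply: le_trans step _.
by have := hn n (leqnn n); rewrite expr0 mulr1 mulrAC ler_pdivrMr// mul1r mulrC.
Qed.

End TransferMatrix.

Lemma lte_between (R : realType) (x : R) (M : \bar R) : (x%:E < M)%E ->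
  exists2 y, x < y & (y%:E < M)%E.
Proof.
case: M => [a| |]//; last by move=> _; exists (x + 1); rewrite ?ltry// ltrDl ltr01.
by rewrite lte_fin => xa; exists ((x + a) / 2); rewrite ?lte_fin; lra.
Qed.

(** * The two dimension formulas *)

Section MainBounds.
Context {R : realType} {d m k : nat}.
Local Notation I := 'I_m.+1.
Context (S : I -> 'cV[R]_d -> 'cV[R]_d) (r : I -> R) (O : I -> 'M[R]_d) (t : I -> 'cV[R]_d)
  (A : 'M[nat]_m.+1).
Context {rm rM : R} (sd : system_data r O t rm rM)
  (SE : forall i x, S i x = r i *: (O i *m x) + t i).
Hypotheses (A01 : zero_one A) (irrA : irreducible_mx A) (sepA : strong_separation S A)
  (kd : (1 <= k <= d.-1)%N) (minA : minimality k S A).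
Implicit Types (p : 'M[R]_(k, d)) (s : R).

Let k0 : (0 < k)%N. Proof. by case/andP: kd. Qed.
Let k_lt_d : (k < d)%N.
Proof. by move: kd; case: (d) => [|d'] /=; [case: (k)|move=> /andP[]; rewrite ltnS]. Qed.

Lemma project_lipschitz p (x y : 'cV[R]_d) e : orth_projection p ->
  mle (x - y) e -> mle (p *m x - p *m y) (d%:R * e).
Proof.
move=> hp h; rewrite -mulmxBr; have := mleM ler01 (orth_projection_mle hp) h.
by rewrite mul1r.
Qed.

Lemma null_cover_project p s E : orth_projection p -> 0 < s ->
  null_cover s E -> null_cover s (project p @` E).
Proof.
move=> hp s0; apply: (null_cover_lipschitz s0 (K := d%:R)).
  by rewrite ltr0n (leq_ltn_trans _ k_lt_d).
by move=> x y e; exact: project_lipschitz.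
Qed.

Lemma project_coding_mle p x : orth_projection p -> mle (p *m coding S x) d%:R.
Proof.
move=> hp; have [cx _ _] := codingP sd SE x.
have hx : mle (coding S x) 1.
  by move=> i j; rewrite ord1; have /andP[h1 h2] := cx i; rewrite ger0_norm.
by have := mleM ler01 (orth_projection_mle hp) hx; rewrite !mulr1.
Qed.

Lemma dimH_box_le : (dimH (box (0 : 'cV[R]_k) d%:R) <= k%:R%:E)%E.
Proof.
apply/lee_addgt0Pr => e e0; rewrite -EFinD; apply: dimH_le.
  by rewrite ltr_wpDl.
apply: (@null_cover_cube _ _ _ d%:R); rewrite ?ltrDl// ?ltr_wpDl//.
by move=> x; rewrite /box /= subr0.
Qed.

Lemma project_not_null (nu : probability (borelType (Sigma m)) R) C s s1 p Y :
  (forall w, (0 < gw nu w) = sorted (adj A) w) -> quasi_bernoulli (gw nu) C ->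
  0 < s -> s < s1 -> s1 <= k%:R -> frostman r nu s1 -> orth_projection p ->
  measurable Y -> 0 < Pr nu Y -> ~ null_cover s ((fun x => p *m coding S x) @` Y).
Proof.
move=> adm qb s0 ss s1k fr hp mY Y0.
have [c c0 sep] := strong_separation_gap sd SE A01 irrA sepA.
have HPi x n : mle (coding S x - tt r O t (word x n)) (d%:R * rr r (word x n)).
  by have [] := codingP sd SE x.
have PiE x n : coding S x =
    tt r O t (word x n) + rr r (word x n) *: (OO O (word x n) *m coding S (sft n x)).
  by have [] := codingP sd SE x.
have glue u a y : 0 < gw nu (rcons u a) -> 0 < gw nu (a :: y) -> 0 < gw nu (u ++ a :: y).
  by rewrite !adm; exact: sorted_glue.
have hit Q (E : {ffun 'I_k -> {ffun 'I_d -> 'I_Q.+1}}) u a : reachable O nu (grid_mx E *m OO O u) a.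
  apply: (@reachable_grid R d m k O (adj A) (sd_O sd) _ k_lt_d) adm.
    exact: transfer_irreducible.
  move=> p' q' hp' hq' eps eps0.
  exact: (minimality_words sd SE (leq_ltn_trans (leq0n k) k_lt_d) minA hp' hq' eps0).
have [D [K [rho0 [[mD DY] D0 rho00 K0 hD]]]] :=
  core_mass sd qb c0 sep k0 HPi PiE glue hit s0 ss s1k fr hp mY Y0.
move=> hs; apply: (mass_distribution s0 mD D0 rho00 K0 hD).
by apply: null_cover_sub hs => _ [x Dx <-]; exists x => //; exact: DY.
Qed.

Lemma frostman_of_le (nu : probability (borelType (Sigma m)) R) s s1 K :
  s < s1 -> (forall w, gw nu w <= K * rr r w `^ s1) -> frostman r nu s.
Proof.
move=> ss hg delta delta0; have a0 : 0 < s1 - s by rewrite subr_gt0.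
have [|n0 hn] := @powR_expr_decay _ K rM (s1 - s) 0 _ a0.
  by rewrite (sd_rM0 sd) (sd_rM sd).
have K0 : 0 <= K by have := hg [::]; rewrite rr_nil powR1 mulr1 gw_nil; apply: le_trans.
exists n0 => L; rewrite big_seq_cond big1 ?(ltW delta0)// => v /andP[].
rewrite mem_words => /eqP vL /negP; case; apply/allP => n; rewrite mem_iota add0n ltnS => nL.
case: (ltnP n n0) => //= nn; apply: le_trans (hg _) _; set u := take n v.
have un : size u = n by rewrite size_takel ?vL.
have -> : rr r u `^ s1 = rr r u `^ (s1 - s) * rr r u `^ s.
  by rewrite -powRD ?subrK// (gt_eqF (rr_gt0 sd u)) implybT.
rewrite mulrA ler_piMl ?powR_ge0//; apply: le_trans (hn n nn).
rewrite expr0 mulr1 ler_wpM2l// ge0_ler_powR ?nnegrE ?(ltW a0) ?(ltW (rr_gt0 sd _)) ?exprn_ge0 ?(ltW (sd_rM0 sd))//.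
by rewrite -un; exact: rr_le sd u.
Qed.

Lemma exists_frostman s s' : 0 < s -> s < s' -> ~ null_cover s' (fractal S A) ->
  exists nu : probability (borelType (Sigma m)) R,
    [/\ forall w, (0 < gw nu w) = sorted (adj A) w, exists C, quasi_bernoulli (gw nu) C &
      exists K, forall w, gw nu w <= K * rr r w `^ s].
Proof.
move=> s0 ss hF.
have [i [n [n0 hn]]] : exists i n, (0 < n)%N /\ 1 <= (weighted_adjacency r A s ^+ n) i i.
  apply: contrapT => H; apply: hF; apply: (fractal_null_cover sd SE A01 irrA s0 ss) => i n n0.
  by rewrite ltNge; apply/negP => hn; apply: H; exists i, n.
have [h [h0 hh]] := exists_subinvariant sd A01 irrA n0 hn.
have succ := adj_succ A01 irrA.
have [nu hnu] := exists_cylinder_measure (erefl : markov (adj A) h [::] = 1)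
  (markov_ge0 h0 succ) (markov_rcons h0 succ).
exists nu; split=> [w||].
- by rewrite hnu (markov_gt0 h0 succ).
- have [C hC] := markov_quasi_bernoulli h0 succ; exists C; exact: hC.
have [|K hK] := markov_le h0 succ (sd_rm sd) _ (ltW s0) hh.
  by move=> j; have /andP[] := sd_r sd j.
by exists K => w; rewrite hnu.
Qed.

Lemma Pr_SFT (nu : probability (borelType (Sigma m)) R) :
  (forall w, (0 < gw nu w) = sorted (adj A) w) -> 0 < Pr nu (SFT A).
Proof.
move=> adm; apply: lt_le_trans ltr01 _; rewrite SFT_levels; apply: Pr_bigcap_ge => [n|n x|n].
- exact: measurable_level.
- by rewrite /level /mkset wordS; case: (word x n) => //= a u; rewrite rcons_path => /andP[].
rewrite Pr_level -(sum_words_gw nu n) [leRHS]big_mkcond; apply: ler_sum => w _.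
by case: ifPn => // /negbTE h; rewrite leNgt adm h.
Qed.

Lemma dim_project_fractal p : orth_projection p ->
  dimH (project p @` fractal S A) = Order.min (k%:R%:E : \bar R) (dimH (fractal S A)).
Proof.
move=> hp; apply/eqP; rewrite eq_le; apply/andP; split.
  rewrite le_min; apply/andP; split.
    apply: le_trans dimH_box_le; apply: le_dimH => s s0 hs; apply: dimH_le => //.
    apply: null_cover_sub hs => _ [_ [x _ <-] <-].
    by rewrite /box /= subr0; exact: project_coding_mle.
  by apply: le_dimH => s s0 hs; apply: dimH_le => //; exact: null_cover_project.
(* Three intermediate exponents: failure of nullity at [s3] yields Markov weights of exponent [s2],
   these give the Frostman property at [s1], and the projection bound follows at [s]. *)
apply: le_dimH => s s0 hs; rewrite leNgt; apply/negP => /lte_between[s1 ss1 /lte_between[s2 s12 /lte_between[s3 s23]]].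
rewrite lt_min lte_fin => /andP[s3k s3F].
have s30 := lt_trans (lt_trans s0 (lt_trans ss1 s12)) s23.
have [|nu [adm [C qb] [K hK]]] := exists_frostman (lt_trans s0 (lt_trans ss1 s12)) s23.
  by move=> /(dimH_le s30); rewrite leNgt s3F.
have s1k : s1 <= k%:R by apply/ltW/(lt_trans s12)/(lt_trans s23).
apply: (project_not_null adm qb s0 ss1 s1k (frostman_of_le s12 hK) hp (measurable_SFT A) (Pr_SFT adm)).
by apply: null_cover_sub hs => _ [x hx <-]; exists (coding S x) => //; exists x.
Qed.

Lemma dim_project_measure (mu : probability (borelType 'cV[R]_d) R)
    (nu : probability (borelType (Sigma m)) R) C p :
  (forall w, (0 < gw nu w) = sorted (adj A) w) -> quasi_bernoulli (gw nu) C ->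
  (forall E : set (borelType 'cV[R]_d), measurable E -> mu E = nu (coding S @^-1` E)) ->
  orth_projection p ->
  dimH_measure (pushforward mu (project p)) = Order.min (k%:R%:E : \bar R) (dimH_measure mu).
Proof.
move=> adm qb muE hp.
have mcod (E : set (borelType 'cV[R]_d)) : measurable E ->
    measurable (coding S @^-1` E : set (borelType (Sigma m))).
  by move=> mE; rewrite -[_ @^-1` _]setTI; exact: (measurable_coding sd SE).
have mproj (E : set (borelType 'cV[R]_k)) : measurable E ->
    measurable (project p @^-1` E : set (borelType 'cV[R]_d)).
  by move=> mE; rewrite -[_ @^-1` _]setTI; exact: measurable_project.
apply/eqP; rewrite eq_le; apply/andP; split.
  rewrite le_min; apply/andP; split.
    apply: le_trans dimH_box_le; apply: ereal_inf_lbound; exists (box 0 d%:R) => //.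
    split; first exact: measurable_box.
    rewrite /pushforward muE; last by apply: mproj; exact: measurable_box.
    rewrite (_ : _ @^-1` _ = setT) ?probability_setT ?lte01//.
    apply/seteqP; split=> // x _; rewrite /preimage /box /= subr0; exact: project_coding_mle.
  apply: le_ereal_inf_tmp => _ [G [mG G0] <-]; apply: le_dimH => s s0 hs.
  (* The projection of a Borel set need not be Borel, so a Borel hull that is still null replaces
     it. *)
  have [H [mH GH hH]] := null_cover_hull s0 (null_cover_project hp s0 hs).
  apply: le_trans (dimH_le s0 hH); apply: ereal_inf_lbound; exists H => //; split => //.
  apply: lt_le_trans G0 _; apply: le_measure; rewrite ?inE//; first exact: mproj.
  by move=> x Gx; apply: GH; exists x.
apply: le_ereal_inf_tmp => _ [E [mE E0] <-]; apply: le_dimH => s s0 hs.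
rewrite leNgt; apply/negP => /lte_between[s1 ss1 /lte_between[s2 s12]].
rewrite lt_min lte_fin => /andP[s2k s2mu].
(* A Borel set of positive mass that is null at exponent [s2] would bring the dimension of [mu] down
   to [s2]. *)
have fr : frostman r nu s1.
  apply: (frostman_of_null sd SE (lt_trans s0 ss1) s12) => G mG hG; apply/eqP.
  rewrite eq_le Pr_ge0 andbT leNgt; apply/negP => G0; move: s2mu; apply/negP; rewrite -leNgt.
  apply: le_trans (dimH_le (lt_trans (lt_trans s0 ss1) s12) hG).
  apply: ereal_inf_lbound; exists G => //; split => //.
  by rewrite muE// PrE ?lte_fin//; exact: mcod.
have s1k : s1 <= k%:R by apply/ltW/(lt_trans s12).
apply: (project_not_null adm qb s0 ss1 s1k fr hp (Y := coding S @^-1` (project p @^-1` E))).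
- by apply: mcod; exact: mproj.
- rewrite -lte_fin -PrE; last by apply: mcod; exact: mproj.
  by rewrite -muE//; exact: mproj.
by apply: null_cover_sub hs => _ [x hx <-].
Qed.

End MainBounds.

Theorem theorem2p10 (R : realType) (d m k : nat)
    (S : 'I_m.+1 -> 'cV[R]_d -> 'cV[R]_d) (A : 'M[nat]_m.+1)
    (mu : probability (borelType 'cV[R]_d) R) :
  similarity_system S ->
  zero_one A -> irreducible_mx A ->
  strong_separation S A ->
  (1 <= k <= d.-1)%N ->
  minimality k S A ->
  gibbs_on_fractal S A mu ->
  forall p : 'M[R]_(k, d), orth_projection p ->
    dimH_measure (pushforward mu (project p))
      = Order.min (k%:R%:E : \bar R) (dimH_measure mu) /\
    dimH (project p @` fractal S A)
      = Order.min (k%:R%:E : \bar R) (dimH (fractal S A)).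
Proof.
move=> hS A01 irrA sepA kd minA [phi [nu [_ _ nuG muE]]] p hp.
have [r [W [t [rm [rM [sd SE]]]]]] := similarity_system_data hS.
have [C qb] := gibbs_quasi_bernoulli A01 irrA nuG.
split; last exact: (dim_project_fractal sd SE).
exact: (dim_project_measure sd SE A01 irrA sepA kd minA (gibbs_gw_gt0 A01 irrA nuG) qb muE hp).
Qed.
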